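(* Let $G$ be a connected graph with at least two vertices, let $s$ be the number of vertices of degree $3$ in $G$, and let $t$ be the number of vertices of degree at least $4$ in $G$. Let $u(G)$ denote the maximal number of leaves in a spanning tree of $G$. Then $$u(G)\ \ge\ \frac{2}{5}\,t+\frac{1}{5}\,s+\frac{8}{5}.$$ Moreover, $$u(G)\ \ge\ \frac{2}{5}\,t+\frac{1}{5}\,s+2$$ holds for all such graphs $G$ with exactly three exceptions up to isomorphism: $C_6^2$, $C_8^2$ and $G_8$.
   Context: Graphs are finite, undirected, without loops and multiple edges. A leaf of a tree is a vertex of degree $1$ in the tree. For a connected graph $G$, $u(G)$ is the maximum, over all spanning trees $F$ of $G$, of the number of leaves of $F$. For $n\in\{6,8\}$, $C_n^2$ is the square of the cycle on $n$ vertices: its vertices are those of the cycle $C_n$, and two distinct vertices are adjacent if and only if their distance in $C_n$ is at most $2$. $G_8$ is the $4$-regular graph on the $8$ vertices $a_1,a_2,r_1,r_2,r_3,b_1,b_2,b_3$ with the following edges: $a_1a_2$; all edges $a_ir_j$ for $i\in\{1,2\}$, $j\in\{1,2,3\}$; $b_1b_2$, $b_1b_3$, $b_2b_3$; and $r_1b_1$, $r_1b_2$, $r_2b_1$, $r_2b_3$, $r_3b_2$, $r_3b_3$. *)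

(* Defs.v *)
From mathcomp Require Import all_boot all_order all_algebra.

Set Implicit Arguments.
Unset Strict Implicit.
Unset Printing Implicit Defensive.

Record sgraph := SGraph {
  svertex :> finType;
  sedge : rel svertex;
  sedge_sym : symmetric sedge;
  sedge_irr : irreflexive sedge }.

Definition isomorphic (G H : sgraph) : Prop :=
  exists2 f : G -> H, bijective f & forall x y, sedge (f x) (f y) = sedge x y.

Section Relations.
Variables (T : finType) (e : rel T).

Definition degree (x : T) : nat := #|[set y | e x y]|.

Definition is_connected : bool := [forall x, forall y, connect e x y].

(* The bound on the length of the cycle only serves decidability: a
   duplicate-free sequence has at most #|T| items (see [acyclicP]). *)
Definition acyclic : bool :=
  [forall n : 'I_#|T|.+1, forall c : n.-tuple T, (2 < n) ==> ~~ ucycleb e c].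

Lemma acyclicP :
  reflect (forall c : seq T, 2 < size c -> uniq c -> ~~ cycle e c) acyclic.
Proof.
apply: (iffP forallP) => [ac c c2 Uc | ac n].
  have ltc : size c < #|T|.+1 by rewrite ltnS -(card_uniqP Uc) max_card.
  have /forallP /(_ (in_tuple c)) := ac (Ordinal ltc).
  by rewrite /= c2 /ucycleb Uc andbT.
apply/forallP => c; apply/implyP => n2; rewrite /ucycleb.
by case Uc: (uniq c); rewrite ?andbF // andbT ac ?size_tuple.
Qed.

Fixpoint walk (k : nat) (x y : T) : bool :=
  if k is k'.+1 then [exists z, e x z && walk k' z y] else x == y.

(* The length of a shortest walk, or #|T| if there is no walk. *)
Definition dist (x y : T) : nat := find (fun k => walk k x y) (iota 0 #|T|).

Lemma walk_rcons k x y z : walk k x y -> e y z -> walk k.+1 x z.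
Proof.
elim: k x => [|k IHk] x.
  by move=> /eqP -> eyz; apply/existsP; exists z; rewrite eyz /=.
move=> /existsP [w /andP [exw wkwy]] eyz; apply/existsP; exists w.
by rewrite exw; apply: IHk.
Qed.

Lemma dist_sym : symmetric e -> commutative dist.
Proof.
move=> sym_e.
have walk_sym k x y : walk k x y -> walk k y x.
  elim: k x => [|k IHk] x; first by rewrite /= eq_sym.
  move=> /existsP [z /andP [exz /IHk wyz]].
  by apply: walk_rcons wyz _; rewrite sym_e.
by move=> x y; apply: eq_find => k; apply/idP/idP; apply: walk_sym.
Qed.

End Relations.

Definition edges (G : sgraph) : {set {set G}} :=
  [set [set p.1; p.2] | p : G * G & sedge p.1 p.2].

Section SpanningTrees.
Variable G : sgraph.

(* Adjacency in the spanning subgraph of G with edge set F. *)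
Definition adj (F : {set {set G}}) : rel G := fun x y => [set x; y] \in F.

Definition spanning_tree (F : {set {set G}}) : bool :=
  [&& F \subset edges G, is_connected (adj F) & acyclic (adj F)].

Definition nleaves (F : {set {set G}}) : nat :=
  #|[set x | degree (adj F) x == 1]|.

Definition max_leaves : nat :=
  \max_(F : {set {set G}} | spanning_tree F) nleaves F.

End SpanningTrees.

Definition cycle_rel n : rel 'I_n :=
  fun i j => (i != j) && ((j == i.+1 %[mod n]) || (i == j.+1 %[mod n])).

Lemma cycle_rel_sym n : symmetric (@cycle_rel n).
Proof. by move=> i j; rewrite /cycle_rel eq_sym orbC. Qed.

Lemma cycle_rel_irr n : irreflexive (@cycle_rel n).
Proof. by move=> i; rewrite /cycle_rel eqxx. Qed.

(* This is the cycle C_n only for n >= 3. *)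
Definition cycle_graph n : sgraph :=
  SGraph (@cycle_rel_sym n) (@cycle_rel_irr n).

Definition square_rel (G : sgraph) : rel G :=
  fun x y => (x != y) && (dist (@sedge G) x y <= 2).

Lemma square_rel_sym G : symmetric (@square_rel G).
Proof.
move=> x y; rewrite /square_rel eq_sym.
by rewrite (dist_sym (@sedge_sym G)).
Qed.

Lemma square_rel_irr G : irreflexive (@square_rel G).
Proof. by move=> x; rewrite /square_rel eqxx. Qed.

Definition square (G : sgraph) : sgraph :=
  SGraph (@square_rel_sym G) (@square_rel_irr G).

(* a_1, a_2 are 0, 1;  r_1, r_2, r_3 are 2, 3, 4;  b_1, b_2, b_3 are 5, 6, 7. *)
Definition G8_edges : seq (nat * nat) :=
  [:: (0, 1);
      (0, 2); (0, 3); (0, 4); (1, 2); (1, 3); (1, 4);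
      (5, 6); (5, 7); (6, 7);
      (2, 5); (2, 6); (3, 5); (3, 7); (4, 6); (4, 7)].

Definition G8_rel : rel 'I_8 :=
  fun i j => ((i : nat, j : nat) \in G8_edges)
          || ((j : nat, i : nat) \in G8_edges).

Lemma G8_rel_sym : symmetric G8_rel.
Proof. by move=> i j; rewrite /G8_rel orbC. Qed.

Lemma G8_rel_irr : irreflexive G8_rel.
Proof. by case; do 8?[case=> //]. Qed.

Definition G8 : sgraph := SGraph G8_rel_sym G8_rel_irr.

Definition nvert_deg3 (G : sgraph) : nat :=
  #|[set x : G | degree (@sedge G) x == 3]|.

Definition nvert_deg_ge4 (G : sgraph) : nat :=
  #|[set x : G | 4 <= degree (@sedge G) x]|.

(* Main.v *)
Require Import Defs.
From mathcomp Require Import all_boot all_order all_algebra.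
From mathcomp Require Import zify lra.

(* A tree is grown from its set I of inner vertices: at every stage it spans I and the
   neighbours of I, and the vertices outside I hang as leaves.  Its value is
   4 #leaves + #dead leaves - sum of costs, where a leaf is dead when all its neighbours
   are already in the tree and a vertex costs 2, 1 or 0 according to its degree
   being at least 4, equal to 3 or smaller.  All leaves of a spanning tree are dead, so the
   value of a spanning tree is 5 u - 2 t - s: the task is to reach the value 10.

   Expanding a leaf with two outside neighbours never decreases the value.  If such
   expansions never gain anything, the last of them could have been chosen differently with
   a gain, except in one configuration: a triangle a b c whose remaining
   neighbours are three leaves v (adjacent to a, b), q (to a, c), r (to b, c).  Hence
   every debt can be paid back, and a non-spanning tree of value k extends to a spanning
   tree of value k + 2 in graphs without pendant vertices.  (A pendant vertex provides
   a starting tree of value 9, after which a gain of 1 is enough.)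

   So in a graph that misses the bound no non-spanning tree has value 8.  Stars and double
   stars then force 4-regularity and every edge into a triangle; a star with a dead leaf yields
   G8, a star whose rim is a 4-cycle yields C_6^2, a star whose rim is a path continued
   by another triangle strip yields C_8^2.  Otherwise the graph looks locally like the line
   graph of a cubic graph, and a star (value 6) with expansions reaches the value 8 before it
   gets stuck. *)

Set Implicit Arguments.
Unset Strict Implicit.
Unset Printing Implicit Defensive.

(** * Trees grown around a set of inner vertices *)

(** Expanding a leaf with m outside neighbours changes the value by at least 4 (m - 1) - 2 m = 2 m -
    4. So m = 2 never loses, m >= 3 gains at least 2, and m = 1 can lose: this is where debts arise.
    If the added vertex itself has two outside neighbours, the debt is at most 1. To finish at k + 2
    in spite of it, a spanning extension must gain 3, which is why [gains 2] asks for 3 at the end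
    but only for 1 before.

    The obstacle is a tripod that uses up all remaining vertices: it ends the construction with a
    gain of 2. Then the expansion just before it is reconsidered. Either postponing that expansion
    gains 3, or the graph contains the configuration [wheel], which by itself carries a tree of
    value 9 and so is harmless.

    In a 4-regular graph a star has value at least 16 - 10 = 6, so the gain of 2 gives 8: this is
    the constant 8/5.

    That the exceptions do miss the bound is seen from the non-leaves of a spanning tree. They
    dominate the graph, so there are at least 2 of them in C_6^2 and at least 3 in C_8^2 and G_8. *)

Section Trees.
Variable G : sgraph.
Implicit Types (x y z : G) (I X : {set G}) (F : {set {set G}}).

Definition nbr x : {set G} := [set y | sedge x y].

Lemma in_nbr x y : (y \in nbr x) = sedge x y.
Proof. by rewrite inE. Qed.

(* Locked so that [inE] does not unfold memberships in [dom I]. *)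
Definition dom I : {set G} := locked (I :|: \bigcup_(x in I) nbr x).

Lemma domE I : dom I = I :|: \bigcup_(x in I) nbr x.
Proof. by rewrite /dom -lock. Qed.

Lemma in_dom I y : y \in dom I = (y \in I) || [exists x in I, sedge x y].
Proof.
rewrite domE inE; congr orb; apply/bigcupP/exists_inP.
  by case=> x xI; rewrite in_nbr => xy; exists x.
by case=> x xI xy; exists x; rewrite ?in_nbr.
Qed.

Lemma mem_dom I x : x \in I -> x \in dom I.
Proof. by rewrite in_dom => ->. Qed.

Lemma nbr_dom I x : x \in I -> nbr x \subset dom I.
Proof. by move=> xI; rewrite domE subsetU // (bigcup_sup x) ?orbT. Qed.

Lemma domU1 x I : x \in dom I -> dom (x |: I) = dom I :|: nbr x.
Proof.
move=> xd; apply/setP=> y; rewrite !domE bigcup_setU big_set1.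
rewrite !(in_setU, in_set1); case: eqP => [->|_] /=.
  by move: xd; rewrite domE !in_setU => ->.
by rewrite -orbA (orbC (y \in nbr x)).
Qed.

Lemma dom1 x : dom [set x] = x |: nbr x.
Proof. by rewrite domE big_set1. Qed.

(** The edges of the tree are not recorded, because the value depends on [I] alone. Taking the new
    vertex from [dom I] keeps [I] connected; [grown_built] recovers a tree. *)
Inductive grown : {set G} -> Prop :=
| grown1 x : grown [set x]
| grownU1 x I : grown I -> x \in dom I -> x \notin I -> grown (x |: I).

(** Attaching one pendant vertex at a time makes connectedness and acyclicity provable by
    induction. *)
Inductive built : {set G} -> {set {set G}} -> Prop :=
| built1 x : built [set x] set0
| builtU1 x y X F : built X F -> x \in X -> y \notin X -> sedge x y ->
    built (y |: X) ([set x; y] |: F).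

Lemma set2_inj x y z : y != x -> [set x; y] = [set x; z] -> y = z.
Proof.
move=> yx /setP/(_ y); rewrite !inE eqxx orbT (negPf yx) /=.
by move/esym/eqP.
Qed.

Lemma adj_sym F : symmetric (adj F).
Proof. by move=> x y; rewrite /adj setUC. Qed.

Lemma adj_sedge F x u : F \subset edges G -> adj F x u -> sedge x u.
Proof.
move=> FE xu; have /imsetP[[a b] /= ab E] := subsetP FE _ xu.
have : a \in [set x; u] by rewrite E !inE eqxx.
have : b \in [set x; u] by rewrite E !inE eqxx orbT.
have abF : a != b by apply: contraTneq ab => ->; rewrite inE sedge_irr.
rewrite inE /= in ab.
rewrite !inE => /orP[]/eqP ? /orP[]/eqP ?; subst; rewrite ?eqxx // in abF *.
by rewrite sedge_sym.
Qed.

Lemma built_edges X F : built X F ->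
  F \subset edges G /\ forall x y, adj F x y -> (x \in X) && (y \in X).
Proof.
elim=> {X F} [x|x y X F _ [FE FX] xX yX xy].
  split=> [|x' y'].
    by rewrite sub0set.
  by rewrite /adj in_set0.
split.
  by rewrite subUset FE andbT sub1set; apply/imsetP; exists (x, y); rewrite ?inE.
move=> x' y' /setU1P[E|/FX/andP[xX' yX']]; last by rewrite !in_setU xX' yX' !orbT.
have : x' \in [set x; y] by rewrite -E !inE eqxx.
have : y' \in [set x; y] by rewrite -E !inE eqxx orbT.
by rewrite !inE => /orP[]/eqP-> /orP[]/eqP->; rewrite ?eqxx ?xX ?orbT.
Qed.

Lemma built_connect X F : built X F ->
  forall x y, x \in X -> y \in X -> connect (adj F) x y.
Proof.
elim=> {X F} [x|x y X F bXF IH xX yX xy].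
  by move=> x' y'; rewrite !inE => /eqP-> /eqP->.
have sub : subrel (connect (adj F)) (connect (adj ([set x; y] |: F))).
  apply: connect_sub => u v uv; apply: connect1.
  by rewrite /adj inE; apply/orP; right.
have csym := sym_connect_sym (@adj_sym ([set x; y] |: F)).
have toy u : u \in X -> connect (adj ([set x; y] |: F)) u y.
  move=> uX; apply: connect_trans (sub _ _ (IH _ _ uX xX)) _.
  by apply: connect1; rewrite /adj !inE eqxx.
move=> u v; rewrite !inE => /orP[/eqP->|uX] /orP[/eqP->|vX] //.
- by rewrite csym toy.
- exact: toy.
- exact/sub/IH.
Qed.

Lemma built_new x y X F z : built X F -> x \in X -> y \notin X ->
  adj ([set x; y] |: F) y z = (z == x).
Proof.
move=> /built_edges[_ FX] xX yX; rewrite /adj !inE.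
have -> : ([set y; z] \in F) = false.
  by apply/negP=> /FX; rewrite (negPf yX).
rewrite orbF; apply/eqP/eqP => [E|->]; last by rewrite setUC.
apply/esym/(@set2_inj y); last by rewrite E setUC.
by apply: contraNneq yX => <-.
Qed.

Lemma built_old x y X F u v : built X F -> u != y -> v != y ->
  adj ([set x; y] |: F) u v = adj F u v.
Proof.
move=> bXF uy vy; rewrite /adj !inE; apply/orb_idl => /eqP E.
have : y \in [set u; v] by rewrite E !inE eqxx orbT.
by rewrite !inE eq_sym (negPf uy) eq_sym (negPf vy).
Qed.

(** A cycle avoiding the newest vertex lies in the older tree, and a cycle through it would need two
    distinct neighbours of a vertex that has only one. *)
Lemma built_acyclic X F : built X F -> acyclic (adj F).
Proof.
move=> bXF; apply/acyclicP; elim: bXF => {X F} [x|x y X F bXF IH xX yX xy] c c2 Uc.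
  case: c c2 Uc => [//|a [//|b c]] _ _; rewrite /= /adj inE //.
have [yc|ync] := boolP (y \in c); last first.
  apply: contra (IH c c2 Uc); apply: sub_in_cycle (allss c).
  move=> u v uc vc; rewrite /= (built_old _ bXF) //.
    by apply: contraNneq ync => <-.
  by apply: contraNneq ync => <-.
apply/negP=> cyc.
(* After rotation [y] comes first; its successor [a] and its predecessor [b] on the cycle must both
   be [x], against uniqueness. *)
case: (rot_to yc) cyc => i c' Ec.
rewrite -(rot_cycle i) Ec; have : 2 < size (y :: c') by rewrite -Ec size_rot.
have : uniq (y :: c') by rewrite -Ec rot_uniq.
case: c' {Ec} => [//|a s]; case/lastP: s => [//|s b].
rewrite /= rcons_path last_rcons !(inE, mem_rcons, negb_or).
case/and3P=> _ /andP[/negP ab _] _ _ /and3P[ya _].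
rewrite adj_sym (built_new _ bXF) // => /eqP bx.
by move: ya; rewrite (built_new _ bXF) // => /eqP ax; case: ab; rewrite ax bx.
Qed.

(** When a vertex becomes inner, all its neighbours not yet reached are attached to it. A vertex
    that never becomes inner is therefore touched only once. *)
Lemma grown_built I : grown I -> exists2 F, built (dom I) F &
  forall z, z \in dom I -> z \notin I -> degree (adj F) z = 1.
Proof.
(* Attaching several vertices at [x] gives them degree 1 and alters no other degree than that of
   [x]. *)
have attach x X F (bXF : built X F) (A : {set G}) : x \in X -> A \subset nbr x ->
    exists2 F', built (X :|: A) F' &
      forall z, z \in X :|: A -> z != x ->
        degree (adj F') z = if z \in X then degree (adj F) z else 1.
  move=> xX; elim: {A}_.+1 {-2}A (ltnSn #|A|) => // n IH A ltA sA.
  have [AX|/subsetPn[y yA yX]] := boolP (A \subset X).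
    exists F => [|z]; first by move/setUidPl: AX ->.
    by move/setUidPl: AX -> => ->.
  have [||F' bF' dF'] := IH (A :\ y).
  - by move: ltA; rewrite (cardsD1 y A) yA ltnS.
  - exact: subset_trans (subsetDl _ _) sA.
  have yXA : y \notin X :|: A :\ y by rewrite !inE eqxx (negPf yX).
  have xXA : x \in X :|: A :\ y by rewrite !inE xX.
  have E : X :|: A = y |: (X :|: A :\ y) by rewrite setUCA setD1K.
  exists ([set x; y] |: F').
    rewrite E; apply: builtU1 => //.
    by rewrite -in_nbr (subsetP sA).
  move=> z; rewrite E in_setU1; have [-> _ yx|zy /= zXA zx] := eqVneq z y.
    rewrite (negPf yX) /degree -(cards1 x); apply: eq_card => u.
    by rewrite !inE (built_new _ bF').
  rewrite -dF' //; apply: eq_card => u; rewrite !inE.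
  have [->|uy] := eqVneq u y; last by rewrite (built_old _ bF').
  rewrite adj_sym (built_new _ bF') // (negPf zx).
  by apply/esym/negP => /(built_edges bF').2; rewrite (negPf yXA) andbF.
elim=> {I} [x|x I gI [F bF dF] xd xI].
  have [F bF dF] := attach x [set x] set0 (built1 x) (nbr x) (set11 x) (subxx _).
  rewrite dom1; exists F => // z zd zx.
  by rewrite dF // ?(negPf zx) //; rewrite inE in zx.
have [F' bF' dF'] := attach x _ F bF (nbr x) xd (subxx _).
exists F'; first by rewrite domU1.
move=> z; rewrite domU1 // !in_setU1 negb_or => zd /andP[zx zI].
by rewrite dF' //; case: ifP => // zd'; apply: dF.
Qed.

(* A vertex of degree 1 in G is a leaf of every spanning tree, even if it lies in [I]. *)
Definition leaves I : {set G} := [set x in dom I | (x \notin I) || (degree (@sedge G) x <= 1)].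

(** A pendant vertex of [G] has degree at most 1 in the tree because the tree uses edges of [G], and
    at least 1 because the tree connects two vertices. *)
Lemma grown_max_leaves I : 1 < #|G| -> grown I -> dom I = setT ->
  #|leaves I| <= max_leaves G.
Proof.
move=> G2 gI dI; have [F bF dF] := grown_built gI.
rewrite dI in bF dF; have [FE _] := built_edges bF.
have cF x y : connect (adj F) x y by apply: built_connect bF _ _ _ _; rewrite inE.
have stF : spanning_tree F.
  rewrite /spanning_tree FE (built_acyclic bF) andbT /=.
  by apply/forallP=> x; apply/forallP=> y.
apply: leq_trans (leq_bigmax_cond F stF); apply/subset_leq_card/subsetP=> x.
rewrite !inE => /andP[_ /orP[xI|x1]]; first by rewrite dF ?inE.
have [y] : exists y, y \notin [set x].
  by apply/existsP; rewrite -negb_forall; apply: contraTN G2 => /forallP xG;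
     rewrite -leqNgt -(cards1 x) -cardsT subset_leq_card //; apply/subsetP=> z _.
rewrite inE => yx; have /connectP[p] := cF x y.
case: p => [/= _ E|z p /= /andP[xz _] _]; first by rewrite E eqxx in yx.
rewrite eqn_leq; apply/andP; split.
  apply: leq_trans x1; apply/subset_leq_card/subsetP=> u; rewrite !inE => xu.
  exact: adj_sedge xu.
by apply/card_gt0P; exists z; rewrite inE.
Qed.

End Trees.

(** * The value of a tree *)

Section Potential.
Variable G : sgraph.
Implicit Types (x y z v : G) (A B I : {set G}) (k : nat).
Local Notation e := (@sedge G).
Local Notation dg := (degree (@sedge G)).

Lemma card_nbr x : #|nbr x| = dg x.
Proof. by []. Qed.

(** The subtraction is truncated, so degrees 0 and 1 also cost 0. *)
Definition cost x := minn (dg x - 2) 2.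
Definition weight A := \sum_(x in A) cost x.

Lemma weight_le A : weight A <= 2 * #|A|.
Proof.
by rewrite mulnC -sum_nat_const; apply: leq_sum => x _; apply: geq_minr.
Qed.

Lemma weightU A B : [disjoint A & B] -> weight (A :|: B) = weight A + weight B.
Proof. by move=> AB; rewrite /weight -bigU //; apply: eq_bigl => x; rewrite in_setU. Qed.

Lemma weight1 x : weight [set x] = cost x.
Proof. exact: big_set1. Qed.

Lemma weight2 x y : x != y -> weight [set x; y] = cost x + cost y.
Proof. by move=> xy; rewrite weightU ?weight1 // disjoints1 inE. Qed.

Lemma weightT : weight setT = 2 * nvert_deg_ge4 G + nvert_deg3 G.
Proof.
rewrite /nvert_deg_ge4 /nvert_deg3 -!sum1_card big_distrr /=.
rewrite (eq_bigl (fun x => 3 < dg x)) => [|x]; last by rewrite inE.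
rewrite [X in _ + X](eq_bigl (fun x => dg x == 3)) => [|x]; last by rewrite inE.
rewrite big_mkcond [X in _ = _ + X]big_mkcond -big_split /=.
rewrite /weight; apply: eq_big => [x|x _]; first by rewrite inE.
by rewrite /cost; do 2!case: ifP; lia.
Qed.

Definition frontier I : {set G} := dom I :\: I.
Definition out I x : {set G} := nbr x :\: dom I.
Definition dead I : {set G} := [set x in leaves I | nbr x \subset dom I].
Definition value I k := weight (dom I) + k <= 4 * #|leaves I| + #|dead I|.
(** This is the bound with constant 2, cleared of denominators. *)
Definition rich := 2 * nvert_deg_ge4 G + nvert_deg3 G + 10 <= 5 * max_leaves G.

Lemma in_frontier I x : (x \in frontier I) = (x \in dom I) && (x \notin I).
Proof. by rewrite inE andbC. Qed.

Lemma in_out I x y : (y \in out I x) = e x y && (y \notin dom I).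
Proof. by rewrite inE in_nbr andbC. Qed.

Lemma domPn I x y : y \notin dom I -> e x y -> x \notin I.
Proof.
by move=> yd xy; apply: contra yd => xI; apply: (subsetP (nbr_dom xI)); rewrite in_nbr.
Qed.

Lemma frontier_nbr I x y : x \in dom I -> y \notin dom I -> e x y -> x \in frontier I.
Proof. by move=> xd yd xy; rewrite in_frontier xd (domPn yd xy). Qed.

Lemma frontier_inner I x : x \in frontier I -> exists2 u, u \in I & e u x.
Proof.
rewrite in_frontier in_dom => /andP[/orP[->//|/exists_inP[u uI ux]] _].
by exists u.
Qed.

Lemma leaf_in_dom I x : x \in leaves I -> x \in dom I.
Proof. by rewrite inE => /andP[]. Qed.

Lemma frontier_leaf I x : x \in frontier I -> x \in leaves I.
Proof. by rewrite in_frontier inE => /andP[-> ->]. Qed.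

Lemma out_degree I x : x \in frontier I -> out I x != set0 -> 1 < dg x.
Proof.
move=> /frontier_inner[u uI ux] /set0Pn[y]; rewrite in_out => /andP[xy yd].
rewrite -card_nbr (cardsD1 u) (cardsD1 y) !inE sedge_sym ux xy andbT /=.
by case: eqP yd => // ->; rewrite mem_dom.
Qed.

Lemma out0 I x : (out I x == set0) = (nbr x \subset dom I).
Proof. by rewrite /out setD_eq0. Qed.

Lemma out_dead I x : out I x != set0 -> x \notin dead I.
Proof. by rewrite out0 inE negb_and orbC => ->. Qed.

Lemma frontier_dead I x : x \in frontier I -> (x \in dead I) = (out I x == set0).
Proof. by move/frontier_leaf=> xl; rewrite out0 [LHS]inE xl. Qed.

Lemma outE I x : x \in dom I -> dom (x |: I) = dom I :|: out I x.
Proof.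
by move=> xd; rewrite domU1 // /out; apply/setP=> y; rewrite !in_setU in_setD; case: (y \in dom I).
Qed.

Lemma dom_out I x y : x \in dom I ->
  (y \in dom (x |: I)) = (y \in dom I) || (y \in out I x).
Proof. by move=> xd; rewrite outE // in_setU. Qed.

Lemma dom_expand I x : x \in dom I -> dom I \subset dom (x |: I).
Proof. by move=> xd; rewrite outE // subsetUl. Qed.

Lemma frontier_expand I x y : x \in dom I ->
  (y \in frontier (x |: I)) = ((y \in frontier I) && (y != x)) || (y \in out I x) && (y != x).
Proof.
move=> xd; rewrite !in_frontier dom_out // in_setU1 negb_or.
have := @mem_dom _ I y; rewrite in_out.
by case: (y \in dom I); case: (y \in I) => H; case: (y != x); case: (e x y) => //=;
  move: (H isT).
Qed.

Lemma expand_leaves I x : x \in frontier I -> out I x != set0 ->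
  leaves (x |: I) = leaves I :\ x :|: out I x.
Proof.
move=> xf ox; have d1 := out_degree xf ox; have xd : x \in dom I by case/setDP: xf.
apply/setP=> z; rewrite in_setU in_setD1 !inE -/(out I x) dom_out // in_out.
have [->|zx] /= := eqVneq z x; first by rewrite leqNgt d1 sedge_irr !andbF.
have := @mem_dom _ I z.
by case: (z \in dom I); case: (z \in I) => H; case: (e x z); case: (dg z <= 1) => //=;
  move: (H isT).
Qed.

Lemma expand_card I x : x \in frontier I -> out I x != set0 ->
  (#|leaves (x |: I)|).+1 = #|leaves I| + #|out I x|.
Proof.
move=> xf ox; rewrite expand_leaves // cardsU.
have -> : (leaves I :\ x) :&: out I x = set0.
  apply/setP=> z; rewrite !in_setI in_setD1 in_out in_set0; apply/negP.
  by case/andP=> /andP[_ /leaf_in_dom->]; rewrite andbF.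
by rewrite cards0 subn0 [#|leaves I|](cardsD1 x) frontier_leaf.
Qed.

Lemma expand_dead I x : x \in frontier I -> out I x != set0 ->
  dead I \subset dead (x |: I).
Proof.
move=> xf ox; apply/subsetP=> z zd; have zx : z != x.
  by apply: contraNneq (out_dead ox) => <-.
have xd : x \in dom I by case/setDP: xf.
move: zd; rewrite [z \in dead I]inE => /andP[zl zn].
rewrite inE expand_leaves // in_setU in_setD1 zx zl /=.
exact: subset_trans zn (dom_expand xd).
Qed.

Lemma expand_weight I x : x \in dom I ->
  weight (dom (x |: I)) = weight (dom I) + weight (out I x).
Proof.
move=> xd; rewrite outE // weightU // disjoints_subset.
by apply/subsetP=> z zd; rewrite inE in_out zd andbF.
Qed.

(** The leaf [x] is traded for the vertices of [out I x], hence the 4 on the left. Old dead leaves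
    stay dead, and [s] lists some leaves that die now. *)
Lemma expand_value I x (s : seq G) k k' : x \in frontier I -> out I x != set0 ->
  uniq s -> {subset s <= dead (x |: I) :\: dead I} -> value I k ->
  weight (out I x) + k' + 4 <= 4 * #|out I x| + size s + k -> value (x |: I) k'.
Proof.
move=> xf ox Us ss; rewrite /value expand_weight; last by case/setDP: xf.
have := expand_card xf ox.
have : #|dead I| + size s <= #|dead (x |: I)|.
  rewrite -(card_uniqP Us) -[#|dead (x |: I)|](cardsID (dead I)) (setIidPr (expand_dead xf ox)).
  by rewrite leq_add2l subset_leq_card //; apply/subsetP.
lia.
Qed.

Lemma new_dead I x z : x \in frontier I -> z \in frontier (x |: I) ->
  nbr z \subset dom (x |: I) -> (z \notin dom I) || (out I z != set0) ->
  z \in dead (x |: I) :\: dead I.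
Proof.
move=> xf zf zn zI; rewrite in_setD [X in _ && X]frontier_dead // out0 zn andbT.
case/orP: zI => [|/out_dead//]; apply: contra.
by rewrite inE => /andP[/leaf_in_dom].
Qed.

Lemma value_le I k k' : k' <= k -> value I k -> value I k'.
Proof. by rewrite /value => kk; apply: leq_trans; rewrite leq_add2l. Qed.

Lemma value_full I k : dom I = setT ->
  value I k = (weight setT + k <= 5 * #|leaves I|).
Proof.
move=> dI; rewrite /value dI.
have -> : dead I = leaves I by apply/setP=> z; rewrite inE dI subsetT andbT.
by rewrite -mulSnr.
Qed.

Lemma value_max_leaves I k : 1 < #|G| -> grown I -> dom I = setT -> value I k ->
  2 * nvert_deg_ge4 G + nvert_deg3 G + k <= 5 * max_leaves G.
Proof.
move=> G2 gI dI; rewrite value_full // weightT => /leq_trans; apply.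
by rewrite leq_mul2l grown_max_leaves.
Qed.

Lemma rich_value I : 1 < #|G| -> grown I -> dom I = setT -> value I 10 -> rich.
Proof. exact: value_max_leaves. Qed.

Lemma grown_expand I x : grown I -> x \in frontier I -> grown (x |: I).
Proof. by move=> gI /setDP[xd xI]; apply: grownU1. Qed.

Lemma expand_proper I x : x \in frontier I -> out I x != set0 ->
  dom I \proper dom (x |: I).
Proof.
move=> /setDP[xd _] /set0Pn[y yo]; apply/properP; split; first exact: dom_expand.
by exists y; [rewrite dom_out // yo orbT | move: yo; rewrite in_out => /andP[]].
Qed.

(** Otherwise [dom I] would be closed under adjacency. *)
Lemma grown_connected I : is_connected e -> grown I -> dom I != setT ->
  exists2 x, x \in frontier I & out I x != set0.
Proof.
move=> cG gI dI; have [x xI] : exists x, x \in I.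
  by case: gI => [x|x I' *]; exists x; rewrite !inE eqxx.
have xd := mem_dom xI.
have [/exists_inP[z zf zo]|/exists_inPn H] :=
  boolP [exists z in frontier I, out I z != set0]; first by exists z.
case/negP: dI; apply/eqP/setP=> y; rewrite [RHS]inE.
have /forallP/(_ x)/forallP/(_ y) xy := cG.
rewrite -(@closed_connect _ e (mem (dom I)) _ _ _ xy) //.
apply: intro_closed => [|u w uw ud]; first exact/sym_connect_sym/sedge_sym.
apply: contraTT uw => wd; apply/negP=> uw.
have uf := frontier_nbr ud wd uw.
by case/negP: (H u uf); apply/set0Pn; exists w; rewrite in_out uw.
Qed.

End Potential.

(** * Expanding a leaf *)

Section Growth.
Variable G : sgraph.
Implicit Types (x y z v : G) (A B I : {set G}) (k : nat).
Local Notation e := (@sedge G).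
Local Notation dg := (degree (@sedge G)).

Lemma card_gt_ex (T : finType) (A : {set T}) (s : seq T) :
  size s < #|A| -> exists2 x, x \in A & x \notin s.
Proof.
move=> sA; have /subsetPn[x xA xs] : ~~ (A \subset [set x in s]).
  apply: contraL sA => /subset_leq_card AS; rewrite -leqNgt.
  by apply: leq_trans AS _; rewrite cardsE card_size.
by exists x => //; move: xs; rewrite inE.
Qed.

Definition active I x := (x \in frontier I) && (1 < #|out I x|).

Lemma active_out I x : active I x -> out I x != set0.
Proof. by case/andP=> _ o2; rewrite -card_gt0 ltnW. Qed.

Lemma active_ex I x y z : x \in dom I -> y != z -> e x y -> e x z ->
  y \notin dom I -> z \notin dom I -> active I x.
Proof.
move=> xd yz xy xz yd zd; rewrite /active (frontier_nbr xd yd xy) /=.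
by rewrite (cardsD1 y) (cardsD1 z) !inE xy xz yd zd eq_sym yz.
Qed.

(* [slack] is the surplus gained when the extension is already spanning. *)
Definition gains slack I k := exists I', [/\ grown I', dom I \proper dom I' &
  (dom I' != setT /\ value I' k.+1) \/ (dom I' = setT /\ value I' (k.+1 + slack))].

(** Every source of gain is absent: the two new vertices cost 2 each, which uses up the 4 earned by
    one more leaf, and nothing dies. *)
Definition idle I v := [&& dom (v |: I) != setT, #|out I v| <= 2,
  [forall z in out I v, 3 < dg z] & dead (v |: I) :\: dead I == set0].

Lemma cost_lt4 x : dg x < 4 -> cost x <= 1.
Proof. by rewrite /cost; lia. Qed.

Lemma cost_le2 x : cost x <= 2.
Proof. exact: geq_minr. Qed.

Lemma out2P I v : active I v -> #|out I v| <= 2 ->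
  exists a b, [/\ a != b, out I v = [set a; b], e v a, e v b & a \notin dom I /\ b \notin dom I].
Proof.
case/andP=> _ o2 o2'; have /cards2P[a [b [ab E]]] : #|out I v| == 2 by rewrite eqn_leq o2'.
exists a, b; rewrite ab E.
have : a \in out I v by rewrite E !inE eqxx.
have : b \in out I v by rewrite E !inE eqxx orbT.
by rewrite !in_out => /andP[-> ->] /andP[-> ->].
Qed.

Lemma idle_value I v k : active I v -> idle I v -> value I k -> value (v |: I) k.
Proof.
move=> av /and4P[_ o2 _ _] Vk; have o0 := active_out av.
case/andP: (av) => vf o2'.
apply: (@expand_value _ _ _ [::]) Vk _ => //.
by move: (weight_le (out I v)) o2'; clear; lia.
Qed.

(** Three new leaves, a new vertex of degree at most 3, or a death each gain at least 1. If the
    expansion spans, the deaths of the new vertices raise the gain to 3. *)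
Lemma active_idle I v k : grown I -> active I v -> value I k ->
  idle I v \/ gains 2 I k.
Proof.
move=> gI av Vk; have o0 := active_out av; case/andP: (av) => vf o1.
have vd : v \in dom I by case/setDP: vf.
have gI' := grown_expand gI vf; have pI' := expand_proper vf o0.
have wo := weight_le (out I v).
have [o2|o3] := leqP #|out I v| 2; last first.
  right; exists (v |: I); split=> //.
  have [E|N] := eqVneq (dom (v |: I)) setT; [right|left]; split=> //; last first.
    by apply: (@expand_value _ _ _ [::]) Vk _ => //=; move: wo o3; clear; lia.
  apply: (@expand_value _ _ _ (enum (out I v))) Vk _ => //.
  - exact: enum_uniq.
  - move=> z; rewrite mem_enum => zo.
    have [vz zd] : e v z /\ z \notin dom I by apply/andP; rewrite -in_out.
    apply: new_dead => //; rewrite ?E ?subsetT ?zd //.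
    rewrite frontier_expand // zo; apply/orP; right.
    by apply: contraNneq zd => ->.
  - by rewrite -cardE; move: wo o3; clear; lia.
have [a [b [ab E va vb [ad bd]]]] := out2P av o2.
have av' : a != v by apply: contraNneq ad => ->.
have bv : b != v by apply: contraNneq bd => ->.
have [T|N] := eqVneq (dom (v |: I)) setT.
  right; exists (v |: I); split=> //; right; split=> //.
  have nd z : z != v -> z \in frontier I :|: out I v ->
      (z \notin dom I) || (out I z != set0) -> z \in dead (v |: I) :\: dead I.
    move=> zv zfo; apply: new_dead => //; last by rewrite T subsetT.
    by rewrite frontier_expand // zv !andbT -in_setU.
  have nda : a \in dead (v |: I) :\: dead I.
    by apply: nd; rewrite ?ad // E !inE eqxx orbT.
  have ndb : b \in dead (v |: I) :\: dead I.
    by apply: nd; rewrite ?bd // E !inE eqxx !orbT.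
  rewrite E weight2 // cards2 ab in wo.
  have [d4|d3] := leqP 4 (dg a); last first.
    apply: (@expand_value _ _ _ [:: a; b]) Vk _ => //=.
    - by rewrite inE ab.
    - by move=> z; rewrite 2!in_cons in_nil orbF => /orP[]/eqP->.
    - rewrite E weight2 // cards2 ab; move: (cost_lt4 d3) (cost_le2 b).
      by clear; lia.
  (* The new vertices cost up to 4, so the deaths of [a] and [b] give only 2. The third death is
     that of an old leaf [z] adjacent to [a], which exists because [a] has degree at least 4. *)
  have [z] : exists2 z, z \in nbr a & z \notin [:: v; b; a] by apply: card_gt_ex.
  rewrite in_nbr !inE !negb_or => az /and3P[zv zb za].
  have zd : z \in dom I.
    have : z \in dom (v |: I) by rewrite T inE.
    by rewrite dom_out // E !inE (negPf za) (negPf zb) !orbF.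
  have za' : e z a by rewrite sedge_sym.
  have ndz : z \in dead (v |: I) :\: dead I.
    apply: nd; rewrite // ?in_setU ?(frontier_nbr zd ad za') //.
    by apply/orP; right; apply/set0Pn; exists a; rewrite in_out za'.
  apply: (@expand_value _ _ _ [:: a; b; z]) Vk _ => //=.
  - by rewrite !inE negb_or ab eq_sym za eq_sym zb.
  - by move=> u; rewrite 3!in_cons in_nil orbF => /or3P[]/eqP->.
  - by rewrite E weight2 // cards2 ab; move: wo; clear; lia.
have [d4|] := boolP [forall z in out I v, 3 < dg z]; last first.
  case/forall_inPn=> z zo; rewrite -leqNgt => d3.
  right; exists (v |: I); split=> //; left; split=> //.
  apply: (@expand_value _ _ _ [::]) Vk _ => //=.
  have := cost_lt4 d3; rewrite E weight2 // cards2 ab; move: (cost_le2 a) (cost_le2 b).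
  by move: zo; rewrite E !inE => /orP[]/eqP->; clear; lia.
have [D0|/set0Pn[z zD]] := eqVneq (dead (v |: I) :\: dead I) set0.
  by left; rewrite /idle N o2 d4 D0 eqxx.
right; exists (v |: I); split=> //; left; split=> //.
apply: (@expand_value _ _ _ [:: z]) Vk _ => //=.
  by move=> u; rewrite mem_seq1 => /eqP->.
by move: wo; rewrite E weight2 // cards2 ab; clear; lia.
Qed.

Lemma idle_alive I v z : active I v -> idle I v -> z \in frontier (v |: I) ->
  (z \notin dom I) || (out I z != set0) -> out (v |: I) z != set0.
Proof.
move=> /andP[vf _] /and4P[_ _ _ /eqP D0] zf zI; apply/negP=> o0.
by have := new_dead vf zf; rewrite D0 in_set0 -out0 o0 zI => /(_ isT isT).
Qed.

End Growth.

(** * Tripods *)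

Ltac eqcases z := repeat match goal with |- context [z == ?u] => case: (z == u) end.

Section Tripods.
Variable G : sgraph.
Implicit Types (x y z v : G) (A B I : {set G}) (k : nat).
Local Notation e := (@sedge G).
Local Notation dg := (degree (@sedge G)).

Record tripod I a b c v q r : Prop := Tripod {
  tripod_uniq : uniq [:: a; b; c; v; q; r];
  tripod_v : v \in frontier I;
  tripod_q : q \in frontier I;
  tripod_r : r \in frontier I;
  tripod_nbr_a : forall z, e a z = (z \in [:: v; q; b; c]);
  tripod_nbr_b : forall z, e b z = (z \in [:: v; r; a; c]);
  tripod_nbr_c : forall z, e c z = (z \in [:: q; r; a; b]);
  tripod_out_v : out I v = [set a; b];
  tripod_out_q : out I q = [set a; c];
  tripod_out_r : out I r = [set b; c] }.

(** This case is kept apart because its gain of 2 spans the graph, one less than [gains 2] requires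
    there. *)
Definition final_tripod I a b c v q r :=
  tripod I a b c v q r /\ ~: dom I = [set a; b; c].

Lemma tripod_rot I a b c v q r : tripod I a b c v q r -> tripod I b c a r v q.
Proof.
case=> U vf qf rf Na Nb Nc ov oq or_; split=> //; rewrite ?ov // 1?setUC //.
- by apply: (leq_size_uniq U) => // z; rewrite !inE; eqcases z.
- by move=> z; rewrite Nb !inE; eqcases z.
- by move=> z; rewrite Nc !inE; eqcases z.
Qed.

(** Expanding [v] loses nothing. Expanding [a] then adds only [c], at cost at most 2, while [q],
    [r], [b] and [c] die: the gain is 4 - 2. *)
Lemma tripod_gain I a b c v q r k : tripod I a b c v q r -> grown I -> value I k ->
  [/\ grown (a |: (v |: I)), dom (a |: (v |: I)) = dom I :|: [set a; b; c] &
      value (a |: (v |: I)) (k + 2)].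
Proof.
case=> U vf qf rf Na Nb Nc ov oq or_ gI Vk.
have gI1 := grown_expand gI vf.
have vd : v \in dom I by case/setDP: vf.
have [ad bd] : a \notin dom I /\ b \notin dom I.
  have : a \in out I v by rewrite ov !inE eqxx.
  have : b \in out I v by rewrite ov !inE eqxx orbT.
  by rewrite !in_out => /andP[_ ->] /andP[_ ->].
have cd : c \notin dom I.
  by have : c \in out I q; [rewrite oq !inE eqxx orbT | rewrite in_out => /andP[]].
have D1 z : (z \in dom (v |: I)) = (z \in dom I) || (z \in [:: a; b]).
  by rewrite dom_out // ov !inE.
move: U; rewrite /= !inE !negb_or -!andbA.
case/andP=> ab /and5P[ac av aq ar /and5P[bc bv bq br /and5P[cv cq cr vq /and3P[vr qr _]]]].
have af1 : a \in frontier (v |: I) by rewrite frontier_expand // ov !inE eqxx av orbT.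
have ad1 : a \in dom (v |: I) by case/setDP: af1.
have o1 : out (v |: I) a = [set c].
  apply/setP=> z; rewrite in_out Na D1 !inE.
  have [->|zv] := eqVneq z v; first by rewrite vd (eq_sym v c) (negPf cv).
  have [->|zq] := eqVneq z q.
    by case/setDP: qf => -> _; rewrite (eq_sym q c) (negPf cq).
  have [->|zb] := eqVneq z b; first by rewrite !orbT (negPf bc).
  have [->|zc] := eqVneq z c; last by [].
  by rewrite (negPf cd) eq_sym (negPf ac).
have gI2 := grown_expand gI1 af1.
have D2 : dom (a |: (v |: I)) = dom I :|: [set a; b; c].
  by apply/setP=> z; rewrite dom_out // o1 D1 !inE !orbA.
split=> //.
have V1 : value (v |: I) k.
  apply: (@expand_value _ _ _ [::]) Vk _ => //.
    by rewrite ov; apply/set0Pn; exists a; rewrite !inE eqxx.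
  by move: (weight_le (out I v)); rewrite ov cards2 ab; clear; lia.
apply: (@expand_value _ _ _ [:: q; r; b; c]) V1 _ => //.
- by rewrite o1; apply/set0Pn; exists c; rewrite inE.
- by rewrite /= !inE !negb_or qr (eq_sym q) bq (eq_sym q) cq (eq_sym r) br (eq_sym r) cr bc.
- have H z : z \in frontier (v |: I) -> z != a -> nbr z \subset dom (a |: (v |: I)) ->
      e z c -> z \in dead (a |: (v |: I)) :\: dead (v |: I).
    move=> zf za zn zc; apply: new_dead => //.
      by rewrite frontier_expand // zf za.
    apply/orP; right; apply/set0Pn; exists c; rewrite in_out zc D1 !inE.
    by rewrite negb_or cd negb_or eq_sym ac eq_sym bc.
  have H2 z : z \in frontier I -> z != v -> z \in frontier (v |: I).
    by move=> zf zv; rewrite frontier_expand // zf zv.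
  have H3 z : out I z \subset [set a; b; c] -> nbr z \subset dom (a |: (v |: I)).
    move=> /subsetP oz; apply/subsetP=> u; rewrite in_nbr D2 in_setU => zu.
    by case ud: (u \in dom I) => //=; apply: oz; rewrite in_out zu ud.
  have H4 z s : (forall u, e z u = (u \in s)) -> all (fun u => u \in dom (a |: (v |: I))) s ->
      nbr z \subset dom (a |: (v |: I)).
    move=> Hz /allP Hs; apply/subsetP=> u; rewrite in_nbr Hz; exact: Hs.
  have inD z : z \in dom I -> z \in dom (a |: (v |: I)) by rewrite D2 in_setU => ->.
  have [qd rd] : q \in dom I /\ r \in dom I by case/setDP: qf; case/setDP: rf.
  have [ad2 bd2 cd2] : [/\ a \in dom (a |: (v |: I)), b \in dom (a |: (v |: I)) &
      c \in dom (a |: (v |: I))] by rewrite D2 !in_setU !in_set1 !eqxx !orbT.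
  have [[qv rv] [qa ra]] : (q != v /\ r != v) /\ (q != a /\ r != a).
    by rewrite (eq_sym q) vq (eq_sym r) vr (eq_sym q) aq (eq_sym r) ar.
  move=> z; rewrite 4!in_cons in_nil orbF => /or4P[]/eqP->.
  + apply: H; rewrite ?H2 //.
    * by apply: H3; rewrite oq subUset !sub1set !inE !eqxx ?orbT.
    * by rewrite sedge_sym Nc !inE eqxx.
  + apply: H; rewrite ?H2 //.
    * by apply: H3; rewrite or_ subUset !sub1set !inE !eqxx ?orbT.
    * by rewrite sedge_sym Nc !inE eqxx ?orbT.
  + apply: H; rewrite 1?eq_sym //.
    * by rewrite frontier_expand // ov !inE eqxx bv !orbT.
    * by apply: (H4 _ _ Nb); rewrite /= (inD v) ?(inD r) ?ad2 ?cd2.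
    * by rewrite Nb !inE eqxx !orbT.
  + apply: new_dead => //.
    * by rewrite frontier_expand // o1 in_set1 eqxx (eq_sym c a) ac orbT.
    * by apply: (H4 _ _ Nc); rewrite /= (inD q) ?(inD r) ?ad2 ?bd2.
    * by rewrite D1 !inE (negPf cd) (eq_sym c a) (eq_sym c b) (negPf ac) (negPf bc).
- by rewrite o1 cards1 weight1 /=; move: (cost_le2 c); clear; lia.
Qed.

(** The hub [c] is joined to the 4-cycle [a], [b], [r], [q]; the vertex [v] completes a triangle on
    [a], [b] and [w] one on [q], [r]. *)
Record wheel c a b q r v w : Prop := Wheel {
  wheel_uniq : uniq [:: c; a; b; q; r; v; w];
  wheel_nbr_c : forall z, e c z = (z \in [:: q; r; a; b]);
  wheel_nbr_a : forall z, e a z = (z \in [:: v; q; b; c]);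
  wheel_nbr_b : forall z, e b z = (z \in [:: v; r; a; c]);
  wheel_nbr_q : forall z, e q z = (z \in [:: a; c; w; r]);
  wheel_nbr_r : forall z, e r z = (z \in [:: b; c; w; q]) }.

(** * Trees on which every active leaf is idle and no leaf is active after an expansion *)

Section Stuck.
Variable I : {set G}.
Hypotheses (idleI : forall v, active I v -> idle I v)
  (stuckI : forall v x, active I v -> ~~ active (v |: I) x).

(** Expanding [v] is idle, so it does not kill [z], which must see an outside vertex other than [a]
    and [b]. *)
Lemma stuck_partner v a b z : active I v -> out I v = [set a; b] -> a != b ->
  z \in frontier I -> z != v -> e z a ->
  exists z', [/\ active I z, out I z = [set a; z'], z' != a & z' != b].
Proof.
move=> av E ab zf zv za; have vd : v \in dom I by case/andP: av => /setDP[].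
have [ad vva] : a \notin dom I /\ e v a.
  by have : a \in out I v; [rewrite E !inE eqxx | rewrite in_out => /andP[]].
have zf' : z \in frontier (v |: I) by rewrite frontier_expand // zf zv.
have oz : out I z != set0 by apply/set0Pn; exists a; rewrite in_out za ad.
have /set0Pn[z'] : out (v |: I) z != set0.
  by apply: idle_alive (idleI av) zf' _ => //; rewrite oz orbT.
rewrite in_out dom_out // E !inE !negb_or => /and4P[zz' zd' za' zb'].
have zact : active I z.
  by apply: (@active_ex _ _ _ a z') => //; [case/setDP: zf | rewrite eq_sym].
exists z'; split=> //.
apply/eqP; rewrite eq_sym eqEcard subUset !sub1set !in_out za ad zz' zd' /=.
by rewrite cards2 eq_sym za' /=; have /and4P[] := idleI zact.
Qed.

(** If [q'] and [r'] differed, [r] would still see [b] and [r'] after the expansion of [q], and so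
    would be active. *)
Lemma stuck_common v a b q q' r r' : active I v -> out I v = [set a; b] -> a != b ->
  active I q -> out I q = [set a; q'] -> q' != a -> q' != b ->
  active I r -> out I r = [set b; r'] -> r' != a -> r' != b -> q' = r'.
Proof.
move=> av E ab aq Eq q'a q'b ar Er r'a r'b; apply/eqP/negPn/negP=> qr'.
have qd : q \in dom I by case/andP: aq => /setDP[].
have [rb bd] : e r b /\ b \notin dom I.
  by apply/andP; rewrite -in_out Er !inE eqxx.
have [rr rd'] : e r r' /\ r' \notin dom I.
  by apply/andP; rewrite -in_out Er !inE eqxx orbT.
have rdm : r \in dom I by case/andP: ar => /setDP[].
case/negP: (stuckI r aq); apply: (@active_ex _ _ _ b r') => //.
- by rewrite dom_out // rdm.
- by rewrite eq_sym.
- by rewrite dom_out // Eq !inE !negb_or bd eq_sym ab eq_sym q'b.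
- by rewrite dom_out // Eq !inE !negb_or rd' r'a eq_sym qr'.
Qed.

(** After the expansion of [v] the leaf [a] is not active, so apart from [b] it has at most one
    neighbour outside the tree. *)
Lemma stuck_few v a b : active I v -> out I v = [set a; b] -> a != b ->
  [/\ a \notin dom I, e v a, 3 < dg a & out I a \subset b |: out (v |: I) a] /\
  #|out (v |: I) a| <= 1.
Proof.
move=> av E ab; have vd : v \in dom I by case/andP: av => /setDP[].
have ao : a \in out I v by rewrite E !inE eqxx.
have [va ad] : e v a /\ a \notin dom I by apply/andP; rewrite -in_out.
split; first split=> //.
- by have /and4P[_ _ /forall_inP/(_ _ ao)] := idleI av.
- apply/subsetP=> z; rewrite in_setU1 !in_out dom_out // E !inE => /andP[az zd].
  have [->|zb] //= := eqVneq z b; rewrite az (negPf zd) orbF /=.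
  by apply: contraTneq az => ->; rewrite sedge_irr.
- have := stuckI a av; rewrite /active frontier_expand // ao.
  rewrite (_ : a != v) ?orbT /= -?leqNgt //.
  by apply: contraNneq ad => ->.
Qed.

(** The degree of [a] is at least 4 and at most two of its neighbours are outside, so it has a tree
    neighbour besides [v]. *)
Lemma stuck_other v a b : active I v -> out I v = [set a; b] -> a != b ->
  exists q c, [/\ active I q, q != v, e q a, out I q = [set a; c] & c != a /\ c != b].
Proof.
move=> av E ab; have [[ad va d4 sub] o1] := stuck_few av E ab.
have [q] : exists2 q, q \in nbr a :&: dom I & q \notin [:: v].
  apply: card_gt_ex; have := cardsID (dom I) (nbr a); rewrite card_nbr -/(out I a).
  have := subset_leq_card sub; rewrite cardsU1; move: o1 d4; case: (_ \notin _) => /=; clear; lia.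
rewrite in_setI in_nbr !inE => /andP[aq qd] qv; have qa : e q a by rewrite sedge_sym.
have [c [actq Eq ca cb]] := stuck_partner av E ab (frontier_nbr qd ad qa) qv qa.
by exists q, c.
Qed.

Lemma stuck_vertex v a b : active I v -> out I v = [set a; b] -> a != b ->
  exists q c, [/\ active I q, q != v, out I q = [set a; c], c != a /\ c != b &
    forall z, e a z = (z \in [:: v; q; b; c])].
Proof.
move=> av E ab; have [[ad va d4 sub] o1] := stuck_few av E ab.
have [q [c [actq qv qa Eq [ca cb]]]] := stuck_other av E ab.
have E' : out I v = [set b; a] by rewrite setUC.
have ba : b != a by rewrite eq_sym.
have [r [c' [actr rv rb Er [c'b c'a]]]] := stuck_other av E' ba.
have Ec' : c = c' by apply: stuck_common av E ab actq Eq ca cb actr Er c'a c'b.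
have qd : q \in dom I by case/andP: actq => /setDP[].
(* A third tree neighbour of [a] would have the same outside neighbours as [q], namely [a] and [c],
   and would die when [q] is expanded. *)
have domv z : z \in nbr a :&: dom I -> z \in [set v; q].
  rewrite in_setI in_nbr => /andP[az zd]; have za : e z a by rewrite sedge_sym.
  rewrite !inE; case: (eqVneq z v) => //= zv; have zf := frontier_nbr zd ad za.
  have [z' [actz Ez z'a z'b]] := stuck_partner av E ab zf zv za.
  have Ez' : z' = c' by apply: stuck_common av E ab actz Ez z'a z'b actr Er c'a c'b.
  apply/negPn/negP=> zq; have /set0Pn[u] : out (q |: I) z != set0.
    apply: (idle_alive actq (idleI actq)); first by rewrite frontier_expand // zf zq.
    by rewrite (active_out actz) orbT.
  rewrite in_out dom_out // negb_or => /and3P[zu ud].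
  by rewrite Eq Ec' -Ez' -Ez in_out zu ud.
have ac : a != c by rewrite eq_sym.
(* The count of outside neighbours of [a] made for [v] is repeated for [q]. As [a] has two of them,
   the first count forces [b] and the second forces [c]. *)
have oa : out I a \subset c |: out (q |: I) a.
  by have [[]] := stuck_few actq Eq ac.
have oa1 : #|out (q |: I) a| <= 1.
  by have [] := stuck_few actq Eq ac.
have oa2 : 1 < #|out I a|.
  have := cardsID (dom I) (nbr a); rewrite card_nbr -/(out I a).
  have /subset_leq_card : nbr a :&: dom I \subset [set v; q] by apply/subsetP.
  by rewrite cards2; move: d4; case: (_ != _) => /=; clear; lia.
have bo : b \in out I a.
  apply/negPn/negP=> bo; move: oa2; rewrite ltnNge (leq_trans _ o1) //.
  apply/subset_leq_card/subsetP=> z zo; move/subsetP/(_ z zo): sub.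
  by rewrite in_setU1; case: eqP zo bo => // -> ->.
have co : c \in out I a.
  apply/negPn/negP=> co; move: oa2; rewrite ltnNge (leq_trans _ oa1) //.
  apply/subset_leq_card/subsetP=> z zo; move/subsetP/(_ z zo): oa.
  by rewrite in_setU1; case: eqP zo co => // -> ->.
have Eo : out I a = [set b; c].
  apply/esym/eqP; rewrite eqEcard subUset !sub1set bo co cards2 eq_sym cb /=.
  have := subset_leq_card sub; rewrite cardsU1; move: o1; case: (_ \notin _) => /=; clear; lia.
exists q, c; split=> // z; rewrite -[e a z]in_nbr.
have -> : (z \in nbr a) = (z \in [set v; q]) || (z \in [set b; c]).
  rewrite -Eo; apply/idP/idP => [az|].
    case zd: (z \in dom I); first by rewrite domv // in_setI az.
    by rewrite in_out -in_nbr az zd orbT.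
  case/orP => [|/setDP[]//]; rewrite !inE => /orP[]/eqP->; by rewrite sedge_sym.
by rewrite !inE !orbA.
Qed.

(** The neighbourhoods of [a] and [b] are determined starting from [v], that of [c] starting from
    [q]; [stuck_common] identifies the third vertices. *)
Lemma stuck_tripod v : active I v -> exists a b c q r, tripod I a b c v q r.
Proof.
move=> av; have o2 : #|out I v| <= 2 by have /and4P[] := idleI av.
have [a [b [ab E va vb [ad bd]]]] := out2P av o2.
have ba : b != a by rewrite eq_sym.
have E' : out I v = [set b; a] by rewrite setUC.
have [q [c [actq qv Eq [ca cb] Na]]] := stuck_vertex av E ab.
have [r [c' [actr rv Er [c'b c'a] Nb]]] := stuck_vertex av E' ba.
have Ec : c = c' by apply: stuck_common av E ab actq Eq ca cb actr Er c'a c'b.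
have Eq' : out I q = [set c; a] by rewrite setUC.
have [q2 [c3 [actq2 q2q Eq2 [c3c c3a] Nc]]] := stuck_vertex actq Eq' ca.
have fr u : active I u -> (u \in frontier I) * (u \in dom I).
  by move=> /andP[uf _]; rewrite uf; case/setDP: uf.
have nd u w : w \in out I u -> w \notin dom I by rewrite in_out => /andP[].
have cd : c \notin dom I by apply: (nd q); rewrite Eq !inE eqxx orbT.
have c3d : c3 \notin dom I by apply: (nd q2); rewrite Eq2 !inE eqxx orbT.
have rq : r != q.
  apply: contraNneq cb => rq; have : b \in out I q by rewrite -rq Er !inE eqxx.
  by rewrite Eq !inE (negPf ba) eq_sym.
have Er2 : r = q2.
  have : e c r.
    rewrite sedge_sym; have : c \in out I r by rewrite Er -Ec !inE eqxx orbT.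
    by rewrite in_out => /andP[].
  rewrite Nc !inE (negPf rq) /=; case/or3P=> /eqP // rE.
    by case: (fr r actr) => _; rewrite rE (negPf ad).
  by case: (fr r actr) => _; rewrite rE (negPf c3d).
have Eb : b = c3.
  have : e c b by rewrite sedge_sym Nb -Ec !inE eqxx !orbT.
  rewrite Nc !inE (negPf ba) /=; case/or3P=> /eqP // bE.
    by case: (fr q actq) => _; rewrite -bE (negPf bd).
  by case: (fr q2 actq2) => _; rewrite -bE (negPf bd).
exists a, b, c, q, r; split; rewrite ?(fr _ av) ?(fr _ actq) ?(fr _ actr) //.
- have H u w : u \notin dom I -> w \in dom I -> u != w.
    by move=> ud wd; apply: contraNneq ud => ->.
  rewrite /= !inE !negb_or ab (eq_sym a c) ca (eq_sym b c) cb !(H a) ?(H b) ?(H c)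
    ?(fr _ av) ?(fr _ actq) ?(fr _ actr) //=.
  by rewrite (eq_sym v) qv (eq_sym v) rv eq_sym rq.
- by rewrite Ec.
- by move=> z; rewrite Nc -Eb -Er2 !inE.
- by rewrite Er Ec.
Qed.

End Stuck.

(** A tripod that leaves further vertices outside gains 2 without spanning, which is more than
    enough; hence only a final one survives in the third case. *)
Lemma active_step I v k : grown I -> active I v -> value I k ->
  [\/ gains 2 I k,
      exists v x, [/\ forall u, active I u -> idle I u, active I v & active (v |: I) x] |
      exists a b c v q r, final_tripod I a b c v q r].
Proof.
move=> gI av Vk.
have [/exists_inP[u au iu]|/exists_inPn Hi] := boolP [exists u in active I, ~~ idle I u].
  by have [iu'|] := active_idle gI au Vk; [rewrite iu' in iu | constructor 1].
have idleI u : active I u -> idle I u by move=> au; apply/negPn/Hi.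
have [/exists_inP[u au /existsP[x ax]]|/exists_inPn Hs] :=
  boolP [exists u in active I, exists x, active (u |: I) x].
  by constructor 2; exists u, x.
have [|a [b [c [q [r T]]]]] := @stuck_tripod I idleI _ v av.
  by move=> u x au; apply: contra (Hs u au) => ax; apply/existsP; exists x.
have [E|E] := eqVneq (~: dom I) [set a; b; c].
  by constructor 3; exists a, b, c, v, q, r.
constructor 1; have [gI' D' V'] := tripod_gain T gI Vk.
have abcd : [set a; b; c] \subset ~: dom I.
  have o u w : w \in out I u -> w \in ~: dom I by rewrite in_out in_setC => /andP[].
  by rewrite !subUset !sub1set (o v a) ?(o v b) ?(o q c) // ?(tripod_out_v T) ?(tripod_out_q T) ?in_set2 eqxx ?orbT.
exists (a |: (v |: I)); split=> //.
  rewrite D' properE subsetUl /=; apply/subsetPn; exists a; first by rewrite !inE eqxx orbT.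
  by move/subsetP/(_ a): abcd; rewrite in_setC !inE eqxx => ->.
left; split; last by apply: value_le V'; rewrite addn2.
apply: contra E => /eqP D; rewrite eqEsubset abcd andbT; apply/subsetP=> z; rewrite in_setC => zd.
by have : z \in dom I :|: [set a; b; c]; [rewrite -D' D inE | rewrite in_setU (negPf zd)].
Qed.

End Tripods.

(** * Extending a tree to a spanning tree *)

Ltac neqs := repeat match goal with
  | H : is_true (?x != ?y) |- context [?x == ?y] => rewrite (negPf H)
  | H : is_true (?x != ?y) |- context [?y == ?x] => rewrite (eq_sym y x) (negPf H)
  end; rewrite ?eqxx ?orbT ?andbT ?orbF ?andbF /=.

Ltac distinct H := let K := fresh in
  have K := H; rewrite /= ?(inE, negb_or) in K;
  repeat match goal with Hx : is_true (_ && _) |- _ =>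
    let H1 := fresh in let H2 := fresh in case/andP: Hx => H1 H2 end.

Section Extension.
Variable G : sgraph.
Implicit Types (x y z v : G) (A B I : {set G}) (k : nat).
Local Notation e := (@sedge G).
Local Notation dg := (degree (@sedge G)).

Lemma nbr_full x (s : seq G) : (forall z, e x z -> z \in s) -> size s <= dg x ->
  forall z, e x z = (z \in s).
Proof.
move=> xs sx z; have Es : nbr x = [set z in s].
  apply/eqP; rewrite eqEcard cardsE; apply/andP; split.
    by apply/subsetP=> u; rewrite in_nbr inE; apply: xs.
  exact: leq_trans (card_size s) sx.
by rewrite -[e x z]in_nbr Es inE.
Qed.

Lemma final_tripod_gain I a b c v q r k : final_tripod I a b c v q r ->
  grown I -> value I k ->
  exists I', [/\ grown I', dom I \proper dom I', dom I' = setT & value I' (k + 2)].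
Proof.
move=> [T U] gI Vk; have [gI' D V'] := tripod_gain T gI Vk.
exists (a |: (v |: I)); split; rewrite // D; last by rewrite -U setUCr.
rewrite -U setUCr properT; apply/eqP=> DT; have : a \in ~: dom I by rewrite U !inE eqxx.
by rewrite DT setCT inE.
Qed.

Lemma final_tripod_rot I a b c v q r :
  final_tripod I a b c v q r -> final_tripod I b c a r v q.
Proof.
move=> [T U]; split; first exact: tripod_rot.
by rewrite U; apply/setP=> z; rewrite !inE; eqcases z.
Qed.

Lemma final_tripod_alive I a b c v q r z : final_tripod I a b c v q r ->
  z \in frontier I -> out I z != set0 -> z \in [:: v; q; r].
Proof.
move=> [T U] /setDP[zd _] /set0Pn[u]; rewrite in_out -in_setC U !inE => /andP[zu].
have H w : w \in [set a; b; c] -> z != w.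
  by rewrite -U in_setC => wd; apply: contraNneq wd => <-.
have [za zb zc] : [/\ z != a, z != b & z != c] by rewrite !H // !inE eqxx ?orbT.
case/orP=> [/orP[]|] /eqP uE; move: zu; rewrite uE sedge_sym
  ?(tripod_nbr_a T) ?(tripod_nbr_b T) ?(tripod_nbr_c T) !inE; neqs => /orP[]->;
by rewrite ?orbT.
Qed.

(** Here [v0] has brought in [q] and [r]. If another old leaf [x] sees [q] or [r], expanding [v],
    [a], [b] instead of [v0] spans the graph with a gain of 3. If not, the neighbourhoods of [q] and
    [r] are forced, and they form a wheel with [w] equal to [v0]. *)
Lemma before_final_tripod_aux I v0 a b c v q r k : grown I -> value I k ->
  (forall u, active I u -> idle I u) -> active I v0 -> out I v0 = [set q; r] ->
  final_tripod (v0 |: I) a b c v q r ->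
  gains 2 I k \/ exists c a b q r v w, @wheel G c a b q r v w.
Proof.
move=> gI Vk idleI act0 E0 [T U].
have v0f : v0 \in frontier I by case/andP: act0.
have v0d : v0 \in dom I by case/setDP: v0f.
have [q0 r0] : q \in out I v0 /\ r \in out I v0 by rewrite E0 !inE !eqxx orbT.
have [v0q qd] : e v0 q /\ q \notin dom I by apply/andP; rewrite -in_out.
have [v0r rd] : e v0 r /\ r \notin dom I by apply/andP; rewrite -in_out.
have Un := tripod_uniq T.
have D z : (z \in dom I) = (z \notin [:: a; b; c; q; r]).
  have := congr1 (fun S : {set G} => z \in S) U; rewrite /= in_setC dom_out // E0 !inE.
  case: (eqVneq z q) => [->|_]; first by rewrite (negPf qd) !orbT.
  case: (eqVneq z r) => [->|_]; first by rewrite (negPf rd) !orbT.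
  by rewrite !orbF -orbA => <-; rewrite negbK.
have [ad bd cd] : [/\ a \notin dom I, b \notin dom I & c \notin dom I].
  by rewrite !D !inE !eqxx !orbT.
have Na := tripod_nbr_a T; have Nb := tripod_nbr_b T; have Nc := tripod_nbr_c T.
have vf1 := tripod_v T.
have [vd1 vI1] : v \in dom (v0 |: I) /\ v \notin v0 |: I by case/setDP: vf1.
have vv0 : v != v0 by move: vI1; rewrite in_setU1 negb_or => /andP[].
distinct Un.
have vd : v \in dom I by move: vd1; rewrite dom_out // E0 !inE; neqs.
have va : e v a by rewrite sedge_sym Na !inE eqxx.
have vb : e v b by rewrite sedge_sym Nb !inE eqxx.
have vf := frontier_nbr vd ad va.
have ab : a != b by [].
have actv : active I v by apply: active_ex ab va vb ad bd.
have Ev : out I v = [set a; b].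
  apply/esym/eqP; rewrite eqEcard subUset !sub1set !in_out va ad vb bd cards2 ab /=.
  by have /and4P[] := idleI v actv.
have nvx u : u \notin dom I -> e v u -> (u == a) || (u == b).
  by move=> ud vu; have : u \in out I v; [rewrite in_out vu | rewrite Ev !inE].
have [d4q d4r] : 3 < dg q /\ 3 < dg r.
  by have /and4P[_ _ /forall_inP d4 _] := idleI v0 act0; split; apply: d4.
have [/exists_inP[x xf /andP[xv0 xqr]]|/exists_inPn nox] :=
    boolP [exists x in frontier I, (x != v0) && (e q x || e r x)]; [left|right].
  have xv : x != v.
    apply: contraTneq xqr => ->; rewrite negb_or; apply/andP; split; apply/negP=> H'.
      by have := nvx q qd; rewrite sedge_sym H'; neqs => /(_ isT).
    by have := nvx r rd; rewrite sedge_sym H'; neqs => /(_ isT).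
  have gI1 := grown_expand gI vf.
  have D1 z : (z \in dom (v |: I)) = (z \notin [:: c; q; r]).
    rewrite dom_out // Ev D !inE.
    case: (eqVneq z a) => [->|_]; first by neqs.
    case: (eqVneq z b) => [->|_]; first by neqs.
    by rewrite !orbF.
  have af1 : a \in frontier (v |: I) by rewrite frontier_expand // Ev in_set2; neqs.
  have ad1 : a \in dom (v |: I) by case/setDP: af1.
  have o1 : out (v |: I) a = [set q; c].
    apply/setP=> z; rewrite in_out Na D1 !inE negbK.
    case: (eqVneq z v) => [->|_]; first by neqs.
    case: (eqVneq z q) => [->|_]; first by neqs.
    case: (eqVneq z b) => [->|_]; first by neqs.
    by case: (eqVneq z c) => [->|_]; neqs.
  have gI2 := grown_expand gI1 af1.
  have D2 z : (z \in dom (a |: (v |: I))) = (z != r).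
    rewrite dom_out // o1 D1 !inE.
    case: (eqVneq z q) => [->|_]; first by neqs.
    by case: (eqVneq z c) => [->|_]; neqs.
  have bf2 : b \in frontier (a |: (v |: I)).
    by rewrite !frontier_expand // Ev in_set2; neqs.
  have o2 : out (a |: (v |: I)) b = [set r].
    apply/setP=> z; rewrite in_out Nb D2 !inE negbK.
    by case: (eqVneq z r) => [->|_]; neqs.
  have gI3 := grown_expand gI2 bf2.
  have bd2 : b \in dom (a |: (v |: I)) by case/setDP: bf2.
  have D3 : dom (b |: (a |: (v |: I))) = setT.
    by apply/setP=> z; rewrite dom_out // o2 D2 !inE; case: eqP.
  exists (b |: (a |: (v |: I))); split=> //.
    rewrite D3 properT; apply: contraNneq ad => ->; by rewrite inE.
  right; split=> //; rewrite value_full // -D3.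
  have N0 : out I v != set0 by rewrite Ev; apply/set0Pn; exists a; rewrite !inE eqxx.
  have N1 : out (v |: I) a != set0 by rewrite o1; apply/set0Pn; exists q; rewrite !inE eqxx.
  have N2 : out (a |: (v |: I)) b != set0 by rewrite o2; apply/set0Pn; exists r; rewrite !inE eqxx.
  have := expand_weight bd2; rewrite (expand_weight ad1) (expand_weight vd) => ->.
  have := expand_card bf2 N2; have := expand_card af1 N1; have := expand_card vf N0.
  have := weight_le (out I v); have := weight_le (out (v |: I) a).
  have := weight_le (out (a |: (v |: I)) b).
  rewrite Ev o1 o2 !cards2 cards1; neqs.
  (* With L leaves, D of them dead, and weight W, the final value is at least 5 (L + 2) - W - 10 = 5
     L - W. It exceeds 4 L + D - W by L - D, and [v], [v0], [x] are three leaves that are not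
     dead. *)
  have : #|dead I| + 3 <= #|leaves I|.
    have U3 : uniq [:: v; v0; x] by rewrite /= !inE; neqs.
    rewrite -[X in _ + X](card_uniqP U3) -[#|leaves I|](cardsID (dead I)).
    apply: leq_add.
      by apply/subset_leq_card/subsetP=> z zd; rewrite in_setI zd andbT; move: zd; rewrite inE => /andP[].
    apply/subset_leq_card/subsetP=> z; rewrite in_setD 3!in_cons in_nil orbF.
    case/or3P=> /eqP->; rewrite ?(frontier_leaf vf) ?(frontier_leaf v0f) ?(frontier_leaf xf) andbT.
    - exact: out_dead.
    - exact/out_dead/active_out.
    - apply: out_dead; apply/set0Pn; case/orP: xqr => [qx|rx].
        by exists q; rewrite in_out sedge_sym qx.
      by exists r; rewrite in_out sedge_sym rx.
  move: Vk; rewrite /value; clear; lia.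
have inU z : z \notin dom I -> z \in [:: a; b; c; q; r] by rewrite D negbK.
have nb u z : u \notin dom I -> (e u z -> e q z || e r z) -> e u z -> z \in [:: v0; a; b; c; q; r].
  move=> ud ur uz; rewrite inE; case: (eqVneq z v0) => //= zv0; apply: inU.
  apply/negP=> zd; have zu : e z u by rewrite sedge_sym.
  by case/negP: (nox z (frontier_nbr zd ud zu)); rewrite zv0 ur.
have Nq : forall z, e q z = (z \in [:: a; c; v0; r]).
  apply: nbr_full => // z qz; have := nb q z qd _ qz; rewrite qz => /(_ (fun=> isT)).
  have zq : z != q by apply: contraTneq qz => ->; rewrite sedge_irr.
  have zb : z != b by apply: contraTneq qz => ->; rewrite sedge_sym Nb !inE; neqs.
  by rewrite !inE; neqs; eqcases z.
have Nr : forall z, e r z = (z \in [:: b; c; v0; q]).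
  apply: nbr_full => // z rz; have := nb r z rd _ rz; rewrite rz orbT => /(_ (fun=> isT)).
  have zr : z != r by apply: contraTneq rz => ->; rewrite sedge_irr.
  have za : z != a by apply: contraTneq rz => ->; rewrite sedge_sym Na !inE; neqs.
  by rewrite !inE; neqs; eqcases z.
exists c, a, b, q, r, v, v0; split=> //.
have [v0a v0b] : v0 != a /\ v0 != b by split; apply: contraTneq v0d => ->.
have v0c : v0 != c by apply: contraTneq v0d => ->.
have [v0q' v0r'] : v0 != q /\ v0 != r by split; apply: contraTneq v0d => ->.
by rewrite /= !inE; neqs.
Qed.

(** The expansion of [v0] is idle, so its two new leaves are alive and lie among [v], [q], [r].
    Rotating the tripod turns them into [q] and [r]. *)
Lemma before_final_tripod I v0 a b c v q r k : grown I -> value I k ->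
  (forall u, active I u -> idle I u) -> active I v0 ->
  final_tripod (v0 |: I) a b c v q r ->
  gains 2 I k \/ exists c a b q r v w, @wheel G c a b q r v w.
Proof.
move=> gI Vk idleI act0 FT; have [T U] := FT.
have o2 : #|out I v0| <= 2 by have /and4P[] := idleI v0 act0.
have [p1 [p2 [p12 E vp1 vp2 [p1d p2d]]]] := out2P act0 o2.
have v0d : v0 \in dom I by case/andP: act0 => /setDP[].
have pin p : p \in out I v0 -> p \in [:: v; q; r].
  move=> po; have [v0p pd] : e v0 p /\ p \notin dom I by apply/andP; rewrite -in_out.
  have pd1 : p \in dom (v0 |: I) by rewrite dom_out // po orbT.
  have pf : p \in frontier (v0 |: I).
    by rewrite frontier_expand // po; apply/orP; right; apply: contraNneq pd => ->.
  by apply: (final_tripod_alive FT pf); apply: (idle_alive act0 (idleI _ act0) pf); rewrite pd.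
have p1o : p1 \in out I v0 by rewrite E !inE eqxx.
have p2o : p2 \in out I v0 by rewrite E !inE eqxx orbT.
have FT' := final_tripod_rot FT; have FT'' := final_tripod_rot FT'.
move: (pin _ p1o) (pin _ p2o) E p12; rewrite !inE.
case/or3P=> /eqP-> /or3P[]/eqP-> E; rewrite ?eqxx // => _;
  by [apply: before_final_tripod_aux FT | apply: before_final_tripod_aux FT' |
      apply: before_final_tripod_aux FT'' | rewrite setUC in E; by
      [apply: before_final_tripod_aux FT | apply: before_final_tripod_aux FT' |
      apply: before_final_tripod_aux FT'']].
Qed.

Definition wheel_free := forall c a b q r v w, ~ @wheel G c a b q r v w.

(** Idle expansions are made until something is gained or a final tripod appears. For slack at most
    1 the gain of 2 of the final tripod suffices; for slack 2 the idle expansion before it is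
    replaced. *)
Lemma active_gains slack I x k : slack <= 1 \/ slack = 2 /\ wheel_free ->
  grown I -> active I x -> value I k ->
  gains slack I k \/ exists a b c v q r, final_tripod I a b c v q r.
Proof.
move=> Hs gI aI Vk.
have slack2 : slack <= 2 by case: Hs => [|[->]] // s1; apply: leq_trans s1 _.
have gains2 J : gains 2 J k -> gains slack J k.
  case=> J' [gJ' pJ' H]; exists J'; split=> //; case: H => [|[DJ' VJ']]; [by left|right].
  by split=> //; apply: value_le VJ'; rewrite leq_add2l.
have trans J J' : dom J \proper dom J' -> gains slack J' k -> gains slack J k.
  by move=> JJ' [K [gK pK H]]; exists K; split=> //; apply: proper_trans pK.
elim: {I}_.+1 {-2}I (ltnSn #|~: dom I|) x gI aI Vk => // n IH I In x gI aI Vk.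
have [|[v [y [idleI av ay]]]|] := active_step gI aI Vk; [by left; apply: gains2| |by right].
left; case/andP: (av) => vf _.
have pv := expand_proper vf (active_out av); have gv := grown_expand gI vf.
have Vv := idle_value av (idleI _ av) Vk.
have ltn' : #|~: dom (v |: I)| < n.
  by rewrite -ltnS (leq_trans _ In) // ltnS proper_card // properC.
have [|[a [b [c [v' [q [r T]]]]]]] := IH _ ltn' y gv ay Vv; first exact: trans.
case: Hs => [s1|[-> wf]].
  have [I' [gI' pI' DI' VI']] := final_tripod_gain T gv Vv.
  exists I'; split=> //; first exact: proper_trans pI'.
  by right; split=> //; apply: value_le VI'; rewrite addSnnS leq_add2l.
have [//|[c' [a' [b' [q' [r' [v'' [w W]]]]]]]] := before_final_tripod gI Vk idleI av T.
by case: (wf _ _ _ _ _ _ _ W).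
Qed.

Lemma frontier_out_le1 I : (forall x, ~~ active I x) -> forall x, x \in frontier I -> #|out I x| <= 1.
Proof. by move=> H x xf; have := H x; rewrite /active xf -leqNgt. Qed.

(* The value decreases only when no leaf is active and the unique outside neighbour of a
   leaf is added; this debt of one unit is paid back by [active_gains]. *)
Lemma extend slack I k : is_connected e -> 1 < k -> 0 < slack ->
  slack <= 1 \/ [/\ slack = 2, wheel_free & forall x, 1 < dg x] ->
  grown I -> dom I != setT -> value I k ->
  exists I', [/\ grown I', dom I' = setT & value I' (k + slack)].
Proof.
move=> cG k1 s0 Hs gI dI Vk.
have slack2 : slack <= 2 by case: Hs => [|[->]] // s1; apply: leq_trans s1 _.
have Hs' : slack <= 1 \/ slack = 2 /\ wheel_free by case: Hs => [|[-> wf _]]; [left|right].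
elim: {I}_.+1 {-2}I (ltnSn #|~: dom I|) gI dI Vk => // n IH I In gI dI Vk.
have rec J : grown J -> dom I \proper dom J -> dom J != setT -> value J k ->
    exists I', [/\ grown I', dom I' = setT & value I' (k + slack)].
  move=> gJ IJ; apply: IH => //.
  by rewrite -ltnS (leq_trans _ In) // ltnS proper_card // properC.
have finish J k' : grown J -> dom I \proper dom J ->
    value J k -> (dom J = setT -> value J k') -> k + slack <= k' ->
    exists I', [/\ grown I', dom I' = setT & value I' (k + slack)].
  move=> gJ IJ VJ VJ' kk; have [E|] := eqVneq (dom J) setT; last by move=> N; apply: (rec J).
  by exists J; split=> //; apply: (value_le kk); apply: VJ'.
have [/existsP[x ax]|/existsPn nact] := boolP [exists x, active I x].
  have [[I' [gI' pI' [[NI' VI']|[DI' VI']]]]|] := active_gains Hs' gI ax Vk.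
  - by apply: rec NI' _ => //; apply: value_le VI'.
  - by exists I'; split=> //; apply: value_le VI'; rewrite leq_add2r.
  - case=> [a [b [c [v [q [r T]]]]]]; have [I' [gI' pI' DI' VI']] := final_tripod_gain T gI Vk.
    by exists I'; split=> //; apply: value_le VI'; rewrite leq_add2l.
have out1 := frontier_out_le1 nact.
have [x xf xo] := grown_connected cG gI dI.
have [y Ey] : exists y, out I x = [set y].
  by apply/cards1P; rewrite eqn_leq out1 // card_gt0.
have xd : x \in dom I by case/setDP: xf.
have [xy yd] : e x y /\ y \notin dom I by apply/andP; rewrite -in_out Ey inE.
set I1 := x |: I; have gI1 : grown I1 by apply: grown_expand.
have p1 : dom I \proper dom I1 by apply: expand_proper.
have D1 z : (z \in dom I1) = (z \in dom I) || (z == y) by rewrite dom_out // Ey inE.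
have yd1 : y \in dom I1 by rewrite D1 eqxx orbT.
have yf1 : y \in frontier I1.
  by rewrite frontier_expand // Ey inE eqxx; apply/orP; right; apply: contraNneq yd => ->.
(* The other tree neighbours of [y]: since no leaf is active, [y] is their only outside neighbour,
   and all of them die when [y] joins. *)
pose B := (nbr y :&: dom I) :\ x.
have xB : #|nbr y :&: dom I| = #|B|.+1.
  by rewrite (cardsD1 x) in_setI in_nbr sedge_sym xy xd.
have outy : out I1 y = nbr y :\: dom I.
  apply/setP=> z; rewrite in_out in_setD in_nbr D1 negb_or.
  by case: eqP => [->|]; rewrite ?sedge_irr ?andbF // andbT andbC.
have dgy : dg y = #|B|.+1 + #|out I1 y|.
  by rewrite -xB outy cardsID.
have Bf z : z \in B -> [/\ z != x, z \in frontier I & out I z = [set y]].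
  rewrite in_setD1 in_setI in_nbr => /and3P[zx yz zd]; have zy : e z y by rewrite sedge_sym.
  have zf := frontier_nbr zd yd zy; split=> //; apply/esym/eqP.
  by rewrite eqEcard sub1set in_out zy yd cards1 out1.
have Bdead : {subset enum B <= dead I1 :\: dead I}.
  move=> z; rewrite mem_enum => /Bf[zx zf Ez]; apply: new_dead => //.
  - by rewrite frontier_expand // zf zx.
  - apply/subsetP=> u; rewrite in_nbr D1 => zu; case ud: (u \in dom I) => //=.
    by have : u \in out I z; [rewrite in_out zu ud | rewrite Ez inE].
  - by rewrite Ez; apply/orP; right; apply/set0Pn; exists y; rewrite inE.
have VB k' : cost y + k' <= #|B| + k -> value I1 k'.
  move=> H; apply: (@expand_value _ _ _ (enum B)) Vk _ => //; first exact: enum_uniq.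
  by rewrite Ey weight1 cards1 -cardE; move: H; clear; lia.
have Vy k' : out I1 y = set0 -> cost y + k' <= #|B| + k.+1 -> value I1 k'.
  move=> oy0 H; apply: (@expand_value _ _ _ (y :: enum B)) Vk _ => //.
  - by rewrite /= enum_uniq mem_enum !inE (negPf yd) !andbF.
  - move=> z; rewrite in_cons => /orP[/eqP->|/Bdead//]; apply: new_dead => //.
      by rewrite -out0 oy0.
    by rewrite yd.
  - by rewrite Ey weight1 cards1 /= -cardE; move: H; clear; lia.
have cy : cost y <= minn (#|B| + #|out I1 y| - 1) 2.
  by rewrite /cost dgy; clear; lia.
case En: #|out I1 y| => [|[|j]].
- have oy0 : out I1 y = set0 by apply/eqP; rewrite -cards_eq0 En.
  (* If [B] is empty here, [y] is pendant and its own death gains only 1; otherwise the gain is at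
     least 2. *)
  have dy2 : slack <= 1 \/ 0 < #|B|.
    by case: Hs => [|[_ _ /(_ y)]]; [left | rewrite dgy En addn0 ltnS; right].
  apply: (finish I1 (k + slack)) => //.
  + by apply: Vy => //; move: cy; rewrite En; clear; lia.
  + by move=> _; apply: Vy => //; move: cy dy2 slack2 s0; rewrite En; clear; lia.
- have N1 : dom I1 != setT.
    have /set0Pn[z] : out I1 y != set0 by rewrite -card_gt0 En.
    by rewrite in_out => /andP[_]; apply: contraNneq => ->; rewrite inE.
  by apply: (rec I1) => //; apply: VB; move: cy; rewrite En; clear; lia.
- have oy0 : out I1 y != set0 by rewrite -card_gt0 En.
  have N1 : dom I1 != setT.
    have /set0Pn[z] := oy0.
    by rewrite in_out => /andP[_]; apply: contraNneq => ->; rewrite inE.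
  have [B2|B1] := leqP 2 #|B|.
    by apply: (rec I1) => //; apply: VB; move: B2 (cost_le2 y); clear; lia.
  have gI2 : grown (y |: I1) by apply: grown_expand.
  have pI2 : dom I \proper dom (y |: I1).
    exact: proper_trans p1 (expand_proper yf1 oy0).
  case: j En => [|j] En.
    (* The cost of [y] exceeds the number of deaths by at most 1. As [y] is now active,
       [active_gains] repays this debt. *)
    have V1 : value I1 k.-1 by apply: VB; move: k1 cy; rewrite En; clear; lia.
    have k0 := ltnW k1.
    have a1 : active I1 y by rewrite /active yf1 En.
    have := active_gains Hs' gI1 a1 V1; rewrite /gains (prednK k0).
    case=> [[I' [gI' pI' [[NI' VI']|[DI' VI']]]]|].
    + by apply: (rec I') => //; apply: proper_trans pI'.
    + by exists I'; split.
    + case=> [a [b [c [v [q [r [T _]]]]]]].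
      (* A final tripod needs three leaves with two outside neighbours each, but [y] is the only
         one. *)
      have fr z : z \in frontier I1 -> 1 < #|out I1 z| -> z = y.
        rewrite frontier_expand // Ey in_set1 => /orP[/andP[zf _] o2|/andP[/eqP]//].
        suff : #|out I1 z| <= 1 by rewrite leqNgt o2.
        by apply: leq_trans (out1 z zf); apply/subset_leq_card/setDS/dom_expand.
      have U := tripod_uniq T; distinct U.
      have oo u w : u != w -> 1 < #|[set u; w]| by move=> uw; rewrite cards2 uw.
      have vy : v = y by apply: fr (tripod_v T) _; rewrite (tripod_out_v T) oo.
      have qy : q = y by apply: fr (tripod_q T) _; rewrite (tripod_out_q T) oo.
      by have : v != q by []; rewrite vy qy eqxx.
  have wo := weight_le (out I1 y).
  (* The debt is now at most 2, so [1 < k] keeps the subtraction from truncating. Expanding [y] with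
     at least three new leaves gains at least 2. *)
  have V1 : value I1 (k + #|B| - cost y).
    by apply: VB; move: k1 (cost_le2 y); clear; lia.
  apply: (finish (y |: I1) (k + slack)) => //.
  - apply: (@expand_value _ _ _ [::]) V1 _ => //.
    by move: wo k1 (cost_le2 y); rewrite En /=; clear; lia.
  - move=> DT; apply: (@expand_value _ _ _ (enum (out I1 y))) V1 _ => //.
    + exact: enum_uniq.
    + move=> z; rewrite mem_enum => zo.
      have [yz zd] : e y z /\ z \notin dom I1 by apply/andP; rewrite -in_out.
      apply: new_dead => //; last by rewrite zd.
        by rewrite frontier_expand // zo; apply/orP; right; apply: contraNneq zd => ->.
      by rewrite DT subsetT.
    + by rewrite -cardE; move: wo k1 slack2 (cost_le2 y); rewrite En; clear; lia.
Qed.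

End Extension.

(** * Graphs missing the bound are 4-regular *)

Section Local.
Variable G : sgraph.
Implicit Types (x y z v : G) (A B I : {set G}) (k : nat).
Local Notation e := (@sedge G).
Local Notation dg := (degree (@sedge G)).
Hypotheses (cG : is_connected e) (G2 : 1 < #|G|).

(** Slack 1 is available without any assumption on pendant vertices and wheels, so this lemma can be
    used to deal with both. *)
Lemma rich_value9 I : grown I -> value I 9 -> (dom I = setT -> value I 10) -> rich G.
Proof.
move=> gI V9 V10; have [DT|DT] := eqVneq (dom I) setT.
  exact: rich_value (V10 DT).
have [I' [gI' DI' VI']] := extend (k := 9) (slack := 1) cG isT isT (or_introl isT) gI DT V9.
exact: rich_value VI'.
Qed.

(** Values are estimated from lists of inner vertices, leaves and dead leaves, every vertex being
    charged the maximal cost 2. *)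
Lemma value_seq (si l d : seq G) k : grown [set x in si] -> uniq (si ++ l) ->
  (forall x, x \in si -> forall z, e x z -> z \in si ++ l) ->
  (forall z, z \in l -> exists2 x, x \in si & e x z) ->
  uniq d -> {subset d <= l} -> (forall x, x \in d -> forall z, e x z -> z \in si ++ l) ->
  (2 * (size si + size l) + k <= 4 * size l + size d -> value [set x in si] k) /\
  (2 * (size si + size l) + k <= 5 * size l -> dom [set x in si] = setT ->
     value [set x in si] k).
Proof.
move=> gI U Hi Hl Ud dl Hd; pose I := [set x in si].
have D : dom I = [set x in si ++ l].
  apply/setP=> z; rewrite in_dom !inE mem_cat; apply/orP/orP => [[|/exists_inP[x]]|[|]].
  - by left.
  - by rewrite inE => /Hi/[apply]; rewrite mem_cat => /orP.
  - by left.
  - by move=> /Hl[x xi xz]; right; apply/exists_inP; exists x; rewrite ?inE.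
have wD : weight (dom I) <= 2 * (size si + size l).
  by apply: leq_trans (weight_le _) _; rewrite leq_mul2l D cardsE -size_cat card_size.
move: U; rewrite cat_uniq => /and3P[_ /hasPn il Ul].
have lI z : z \in l -> z \in leaves I.
  by move=> zl; rewrite inE D !inE mem_cat zl orbT (il z zl).
have cl : size l <= #|leaves I|.
  rewrite -(card_uniqP Ul); apply/subset_leq_card/subsetP=> z; exact: lI.
have cd : size d <= #|dead I|.
  rewrite -(card_uniqP Ud); apply/subset_leq_card/subsetP=> z zd.
  rewrite inE lI ?dl //; apply/subsetP=> u; rewrite in_nbr D inE; exact: Hd.
split=> [H|H DT]; last by rewrite value_full // -DT -/I; move: H cl wD; clear; lia.
by rewrite /value -/I; move: H cl cd wD; clear; lia.
Qed.

(** The inner vertices [a] and [q] give seven vertices with five leaves, of which [b], [c], [r] are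
    dead: 20 + 3 - 14 = 9, and 25 - 14 = 11 if the tree spans. *)
Lemma wheel_rich c a b q r v w : @wheel G c a b q r v w -> rich G.
Proof.
case=> U Nc Na Nb Nq Nr; distinct U.
have gI : grown [set x in [:: a; q]].
  have -> : [set x in [:: a; q]] = q |: [set a] by apply/setP=> z; rewrite !inE orbC.
  apply: grownU1; first exact: grown1; last by rewrite inE; neqs.
  by rewrite dom1 in_setU1 in_nbr Na !inE; neqs.
have [||||||V V'] := @value_seq [:: a; q] [:: v; b; c; r; w] [:: b; c; r] 9 gI.
- by rewrite /= !inE; neqs.
- move=> x; rewrite !inE => /orP[]/eqP-> z; rewrite ?Na ?Nq !inE; by eqcases z.
- move=> z; rewrite !inE => Hz; case: (boolP (e a z)) => [az|].
    by exists a; rewrite ?inE ?eqxx.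
  rewrite Na !inE => za; exists q; first by rewrite !inE eqxx orbT.
  by rewrite Nq !inE; move: Hz za; eqcases z.
- by rewrite /= !inE; neqs.
- by move=> z; rewrite !inE; eqcases z.
- move=> x; rewrite !inE => /or3P[]/eqP-> z; rewrite ?Nb ?Nc ?Nr !inE; by eqcases z.
have {V'} V' : dom [set x in [:: a; q]] = setT -> value [set x in [:: a; q]] 10.
  have [||||||_ V2] := @value_seq [:: a; q] [:: v; b; c; r; w] [::] 10 gI => //.
  - by rewrite /= !inE; neqs.
  - move=> x; rewrite !inE => /orP[]/eqP-> z; rewrite ?Na ?Nq !inE; by eqcases z.
  - move=> z; rewrite !inE => Hz; case: (boolP (e a z)) => [az|].
      by exists a; rewrite ?inE ?eqxx.
    rewrite Na !inE => za; exists q; first by rewrite !inE eqxx orbT.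
    by rewrite Nq !inE; move: Hz za; eqcases z.
  exact: V2.
by apply: rich_value9 V'; [|exact: V].
Qed.

(** In the tree around [y] both [y] and [x] count as leaves and [y] is dead, so the value is at
    least 9 - [cost x]. If [x] costs 1 it is active and the gain is at least 1; if it costs 2, it
    has three outside neighbours and gains at least 2. *)
Lemma pendant_rich y : dg y = 1 -> rich G.
Proof.
move=> dy; have [x Ex] : exists x, nbr y = [set x] by apply/cards1P; rewrite card_nbr dy.
have yx : e y x by rewrite -in_nbr Ex inE.
have xy : x != y by apply: contraTneq yx => ->; rewrite sedge_irr.
have gy := grown1 y.
have D z : (z \in dom [set y]) = (z == y) || (z == x) by rewrite dom1 Ex !inE.
have xf : x \in frontier [set y] by rewrite in_frontier D inE eqxx orbT.
have ly : #|leaves [set y]| = 2.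
  have -> : leaves [set y] = [set y; x].
    apply/setP=> z; rewrite [LHS]inE D !inE; case: (eqVneq z y) => [->|zy] //=.
      by rewrite dy.
    by rewrite andbT.
  by rewrite cards2 eq_sym xy.
have dead1 : 0 < #|dead [set y]|.
  apply/card_gt0P; exists y; rewrite inE inE D eqxx dy orbT /= dom1.
  exact: subsetUr.
have wy : weight (dom [set y]) = cost x.
  rewrite dom1 Ex -/[set y; x] weight2 1?eq_sym // /cost dy; clear; lia.
have Vy k : cost x + k <= 9 -> value [set y] k.
  by rewrite /value wy ly; move: dead1; clear; lia.
have [d2|d2] := leqP (dg x) 2.
  have c0 : cost x = 0 by rewrite /cost; move: d2; clear; lia.
  apply: rich_value9 gy _ _; first by apply: Vy; rewrite c0.
  by move=> DT; rewrite value_full // -DT wy c0 ly.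
have ox : out [set y] x = nbr x :\ y.
  apply/setP=> z; rewrite in_out D in_setD1 in_nbr negb_or.
  by case: (eqVneq z x) => [->|]; rewrite ?sedge_irr ?andbF // andbC andbT.
have cx : #|out [set y] x|.+1 = dg x.
  by rewrite ox -card_nbr [#|nbr x|](cardsD1 y) in_nbr sedge_sym yx.
have ax : active [set y] x by rewrite /active xf; move: cx d2; clear; lia.
have [d3|d4] := leqP (dg x) 3.
  have V8 : value [set y] 8 by apply: Vy; rewrite /cost; move: d3; clear; lia.
  have [[I' [gI' _ [[N V]|[DT V]]]]|[a [b [c [v [q [r [T _]]]]]]]] :=
    active_gains (slack := 1) (or_introl isT) gy ax V8.
  - by apply: rich_value9 gI' V _ => DT; rewrite DT eqxx in N.
  - exact: rich_value V.
  - have := tripod_v T; have := tripod_q T; rewrite !in_frontier !D !inE.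
    have U := tripod_uniq T; distinct U.
    case: (eqVneq q y) => //= _ /andP[/eqP qx _]; case: (eqVneq v y) => //= _ /andP[/eqP vx _].
    by have : v != q by []; rewrite qx vx eqxx.
have V7 : value [set y] 7 by apply: Vy; move: (cost_le2 x); clear; lia.
have o0 := active_out ax; have gI := grown_expand gy xf.
have wo := weight_le (out [set y] x).
apply: (rich_value9 gI).
  by apply: (@expand_value _ _ _ [::]) V7 _ => //=; move: wo cx d4; clear; lia.
move=> DT; apply: (@expand_value _ _ _ (enum (out [set y] x))) V7 _ => //.
- exact: enum_uniq.
- move=> z; rewrite mem_enum => zo.
  have [xz zd] : e x z /\ z \notin dom [set y] by apply/andP; rewrite -in_out.
  apply: new_dead => //; rewrite ?DT ?subsetT ?zd //.
  by rewrite frontier_expand ?D ?eqxx ?orbT // zo; apply/orP; right; apply: contraNneq zd => ->; rewrite D eqxx orbT.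
- by rewrite -cardE; move: wo cx d4; clear; lia.
Qed.

Lemma degree_gt0 x : 0 < dg x.
Proof.
have [y yx] : exists y, y != x.
  have [y _ yx] : exists2 y, y \in [set: G] & y \notin [:: x].
    by apply: card_gt_ex; rewrite cardsT.
  by exists y; rewrite inE in yx.
have /forallP/(_ x)/forallP/(_ y)/connectP[[/= _ E|z p /= /andP[xz _] _]] := cG.
  by rewrite E eqxx in yx.
by apply/card_gt0P; exists z; rewrite inE.
Qed.

Section Poor.
Hypothesis poor : ~~ rich G.

Lemma poor_wheel_free : wheel_free G.
Proof. by move=> c a b q r v w W; case/negP: poor; apply: wheel_rich W. Qed.

Lemma poor_degree_gt1 x : 1 < dg x.
Proof.
have := degree_gt0 x; rewrite leq_eqVlt => /orP[/eqP d1|//].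
by case/negP: poor; apply: (@pendant_rich x).
Qed.

Lemma poor_slack : 2 <= 1 \/ [/\ 2 = 2, wheel_free G & forall x, 1 < dg x].
Proof. by right; split=> //; [exact: poor_wheel_free | exact: poor_degree_gt1]. Qed.

Lemma poor_value8 I : grown I -> value I 8 -> (dom I = setT -> value I 10) -> False.
Proof.
move=> gI V8 V10; case/negP: poor; have [DT|DT] := eqVneq (dom I) setT.
  exact: rich_value (V10 DT).
have [I' [gI' DI' VI']] := extend (k := 8) (slack := 2) cG isT isT poor_slack gI DT V8.
exact: rich_value VI'.
Qed.

(** A gain would give value 8 on a non-spanning tree or 10 on a spanning one, and both are
    impossible. *)
Lemma poor_value7 I x : grown I -> value I 7 -> active I x ->
  exists a b c v q r, final_tripod I a b c v q r.
Proof.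
move=> gI V7 ax; have Hs : 2 <= 1 \/ 2 = 2 /\ wheel_free G by right; split=> //; exact: poor_wheel_free.
have [[I' [gI' _ H]]|//] := active_gains Hs gI ax V7; exfalso.
case: H => [[N V]|[DT V]]; last by case/negP: poor; apply: rich_value V.
by apply: poor_value8 gI' V _ => DT; rewrite DT eqxx in N.
Qed.

Lemma star_leaves v : leaves [set v] = nbr v.
Proof.
apply/setP=> z; rewrite [LHS]inE dom1 !inE; case: (eqVneq z v) => [->|_] /=.
  by rewrite sedge_irr leqNgt poor_degree_gt1.
by rewrite andbT.
Qed.

Lemma star_frontier v : frontier [set v] = nbr v.
Proof.
apply/setP=> z; rewrite in_frontier dom1 !inE.
by case: (eqVneq z v) => [->|_]; rewrite ?sedge_irr ?andbT.
Qed.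

Lemma star_weight v : weight (dom [set v]) = cost v + weight (nbr v).
Proof.
by rewrite dom1 weightU ?weight1 // disjoints1 in_nbr sedge_irr.
Qed.

Lemma star_value v k :
  cost v + weight (nbr v) + k <= 4 * dg v + #|dead [set v]| -> value [set v] k.
Proof. by rewrite /value star_weight star_leaves. Qed.

Lemma star_value_full v k : cost v + weight (nbr v) + k <= 5 * dg v ->
  dom [set v] = setT -> value [set v] k.
Proof. by move=> H DT; rewrite value_full // -DT star_weight star_leaves. Qed.

Lemma poor_star v : cost v + weight (nbr v) + 8 <= 4 * dg v + #|dead [set v]| ->
  cost v + weight (nbr v) + 10 <= 5 * dg v -> False.
Proof.
move=> H8 H10; apply: (@poor_value8 [set v] (grown1 v)); first exact: star_value.
exact: star_value_full.
Qed.

(** A star with d leaves has value at least 4 d - 2 - 2 d, which reaches 8 for d = 5. *)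
Lemma poor_degree_le4 v : dg v <= 4.
Proof.
rewrite leqNgt; apply/negP=> d5; apply: (@poor_star v);
by move: (cost_le2 v) (weight_le (nbr v)) d5; rewrite card_nbr; clear; lia.
Qed.

Lemma weight_le1 A : (forall x, x \in A -> dg x <= 3) -> weight A <= #|A|.
Proof.
by move=> H; rewrite -sum1_card; apply: leq_sum => x /H; apply: cost_lt4.
Qed.

Lemma card_nbr_in x (s : seq G) : uniq s -> #|nbr x :&: [set y in s]| = count (e x) s.
Proof.
move=> U; rewrite -size_filter -(card_uniqP (filter_uniq _ U)).
by apply: eq_card => y; rewrite !inE mem_filter.
Qed.

Lemma star_card v x : x \in nbr v -> dg x = (#|nbr x :&: nbr v| + #|out [set v] x|).+1.
Proof.
rewrite in_nbr => vx; rewrite -card_nbr (cardsD1 v) in_nbr sedge_sym vx add1n.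
rewrite -(cardsID (nbr v) (nbr x :\ v)); congr (_ + _).+1; apply: eq_card => z.
  rewrite !inE; case: (eqVneq z v) => [->|_] //=; by rewrite sedge_irr andbF.
by rewrite in_out dom1 !inE negb_or; case: (eqVneq z v); case: (e x z); case: (e v z).
Qed.

(** Otherwise the star at [v] stays below 8 only if exactly one neighbour has degree 3, the others
    have degree 4, and no leaf is dead. Its value is then 7, but a final tripod has only three
    leaves alive; so no leaf is active, and a parity count ends the proof. *)
Lemma poor_degree4_nbr v x : dg v = 4 -> e v x -> dg x = 4.
Proof.
move=> d4 vx; apply/eqP; rewrite eqn_leq poor_degree_le4 leqNgt; apply/negP=> dx.
have xn : x \in nbr v by rewrite in_nbr.
have cx := cost_lt4 dx; have cv := cost_le2 v.
have wE : weight (nbr v) = cost x + weight (nbr v :\ x) by rewrite /weight (big_setD1 x).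
have c3 : #|nbr v :\ x| = 3.
  by have := cardsD1 x (nbr v); rewrite xn card_nbr d4 => -[].
have w3 := weight_le (nbr v :\ x).
have oth y : y \in nbr v :\ x -> dg y = 4.
  move=> yn; apply/eqP; rewrite eqn_leq poor_degree_le4 leqNgt; apply/negP=> dy.
  have cy := cost_lt4 dy.
  have wE' : weight (nbr v :\ x) = cost y + weight (nbr v :\ x :\ y) by rewrite /weight (big_setD1 y).
  have := weight_le (nbr v :\ x :\ y); have := cardsD1 y (nbr v :\ x); rewrite yn c3.
  by move=> c2 w2; apply: (@poor_star v); rewrite wE wE' d4; move: cx cy cv c2 w2; clear; lia.
have cx1 : cost x = 1.
  apply/eqP; rewrite eqn_leq cx lt0n; apply/eqP=> c0.
  by apply: (@poor_star v); rewrite wE c0 d4; move: w3 cv; rewrite c3; clear; lia.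
have nd : dead [set v] = set0.
  apply/eqP; rewrite -cards_eq0 -leqn0 leqNgt; apply/negP=> d0.
  by apply: (@poor_star v); rewrite wE cx1 d4; move: w3 cv d0; rewrite c3; clear; lia.
have V7 : value [set v] 7.
  by apply: star_value; rewrite wE cx1 d4; move: w3 cv; rewrite c3; clear; lia.
have alive z : z \in nbr v -> out [set v] z != set0.
  move=> zn; apply/negP=> o0; have : z \in dead [set v] by rewrite frontier_dead ?star_frontier.
  by rewrite nd inE.
have inact z : ~~ active [set v] z.
  apply/negP=> az; have [a [b [c [v' [q [r T]]]]]] := poor_value7 (grown1 v) V7 az.
  have [u un] : exists2 u, u \in nbr v & u \notin [:: v'; q; r].
    by apply: card_gt_ex; rewrite card_nbr d4.
  by rewrite (final_tripod_alive T) ?star_frontier ?alive.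
have o1 z : z \in nbr v -> #|out [set v] z| = 1.
  move=> zn; apply/eqP; rewrite eqn_leq card_gt0 alive // andbT.
  by have := inact z; rewrite /active star_frontier zn -leqNgt.
pose s := enum (nbr v); have Us : uniq s := enum_uniq _.
have Es : [set y in s] = nbr v by apply/setP=> z; rewrite inE mem_enum.
(* Each leaf has one neighbour outside the star besides the centre, so the degrees inside [s] are 1,
   2, 2, 2. Their sum is odd, which the final case analysis refutes. *)
have cnt z : z \in s -> count (e z) s + 2 = dg z.
  rewrite mem_enum => zn; rewrite -card_nbr_in // Es (star_card zn) o1 //; clear; lia.
have dgs z : z \in s -> dg z = if z == x then 3 else 4.
  rewrite mem_enum => zn; case: eqVneq => [->|zx]; last by apply: oth; rewrite !inE zx -in_nbr.
  by move: cx1 dx; rewrite /cost; clear; lia.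
have ss : size s = 4 by rewrite -cardE card_nbr d4.
have xs : x \in s by rewrite mem_enum.
clearbody s; case: s Us {Es} cnt dgs ss xs => [|x0 [|x1 [|x2 [|x3 [|]]]]] //= U cnt dgs _ xs.
have [cnt0 cnt1 cnt2 cnt3] : [/\ count (e x0) [:: x0; x1; x2; x3] + 2 = dg x0,
   count (e x1) [:: x0; x1; x2; x3] + 2 = dg x1,
   count (e x2) [:: x0; x1; x2; x3] + 2 = dg x2 &
   count (e x3) [:: x0; x1; x2; x3] + 2 = dg x3] by split; apply: cnt; rewrite !inE eqxx ?orbT.
move: cnt0 cnt1 cnt2 cnt3; rewrite !dgs ?inE ?eqxx ?orbT //= !sedge_irr.
rewrite (sedge_sym x1 x0) (sedge_sym x2 x0) (sedge_sym x3 x0) (sedge_sym x2 x1) (sedge_sym x3 x1) (sedge_sym x3 x2).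
distinct U; move: xs; rewrite !inE => /or4P[]/eqP->; neqs;
  by case: (e x0 x1); case: (e x0 x2); case: (e x0 x3); case: (e x1 x2); case: (e x1 x3); case: (e x2 x3).
Qed.

(** Degree 4 spreads along edges. If it does not occur, a star at a vertex of degree 3 has value at
    least 12 - 4 = 8, and when all degrees are 2 a star has value at least 8. *)
Lemma poor_regular x : dg x = 4.
Proof.
have [/existsP[v /eqP d4]|/existsPn nd4] := boolP [exists v, dg v == 4].
  have /forallP/(_ v)/forallP/(_ x) vx := cG.
  apply/eqP; rewrite -[dg x == 4]/(x \in [pred z | dg z == 4]).
  rewrite -(@closed_connect _ e [pred z | dg z == 4] _ _ _ vx) ?inE ?d4 //.
  apply: intro_closed => [|u w uw]; first exact/sym_connect_sym/sedge_sym.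
  by rewrite !inE => /eqP du; rewrite (poor_degree4_nbr du uw).
have d3 y : dg y <= 3 by have := poor_degree_le4 y; rewrite leq_eqVlt (negPf (nd4 y)).
have w3 y : weight (nbr y) <= dg y by rewrite -card_nbr; apply: weight_le1.
exfalso; have [/existsP[v /eqP dv]|/existsPn nd3] := boolP [exists v, dg v == 3].
  apply: (@poor_star v); move: (w3 v) (cost_lt4 (d3 v)); rewrite dv; clear; lia.
have d2 y : dg y = 2.
  apply/eqP; rewrite eqn_leq poor_degree_gt1 andbT.
  by have := d3 y; rewrite leq_eqVlt (negPf (nd3 y)).
have c0 y : cost y = 0 by rewrite /cost d2.
have w0 : weight (nbr x) = 0 by rewrite /weight big1.
by apply: (@poor_star x); rewrite c0 w0 d2.
Qed.

End Poor.
End Local.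

(** * Triangles in 4-regular graphs missing the bound *)

Section Regular.
Variable G : sgraph.
Implicit Types (x y z v : G) (A B I : {set G}) (k : nat).
Local Notation e := (@sedge G).
Local Notation dg := (degree (@sedge G)).

(** The list [s] labels the vertices by positions and [x0] is only the default of [nth]. Tables of
    numbers can be checked by computation. *)
Definition has_adjacency (nb : seq (seq nat)) := exists x0 (s : seq G),
  [/\ size s = size nb, uniq s, forall x, x \in s &
      forall i, i < size nb -> forall z,
        e (nth x0 s i) z = (z \in [seq nth x0 s j | j <- nth [::] nb i])].

Hypotheses (cG : is_connected e) (G2 : 1 < #|G|) (poor : ~~ rich G).
Let regG := poor_regular cG G2 poor.

(** The table makes [s] closed under adjacency, so by connectedness [s] contains every vertex. *)
Lemma adjacency_intro nb x0 (s : seq G) : 0 < size s -> size s = size nb -> uniq s ->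
  all (all (fun j => j < size nb)) nb ->
  (forall i, i < size nb -> forall z,
     e (nth x0 s i) z = (z \in [seq nth x0 s j | j <- nth [::] nb i])) ->
  has_adjacency nb.
Proof.
move=> s0 ss Us /(all_nthP [::]) nbl Hs; exists x0, s; split=> // x.
have /forallP/(_ (nth x0 s 0))/forallP/(_ x) xx := cG.
rewrite -[x \in s]/(x \in mem s) -(closed_connect _ xx) ?mem_nth //.
apply: intro_closed => [|u w uw us]; first exact/sym_connect_sym/sedge_sym.
move: uw; rewrite -(nth_index x0 us) Hs; last by rewrite -ss index_mem.
case/mapP=> j jn ->; rewrite mem_nth //.
have := nbl (index u s); rewrite -ss index_mem => /(_ us)/allP/(_ j jn).
by [].
Qed.

Lemma nbr_eq x (s : seq G) : uniq s -> all (e x) s -> size s = 4 ->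
  forall z, e x z = (z \in s).
Proof.
move=> Us /allP xs s4 z; have Es : [set z in s] = nbr x.
  apply/eqP; rewrite eqEcard card_nbr regG cardsE (card_uniqP Us) s4 andbT.
  by apply/subsetP=> u; rewrite inE in_nbr; apply: xs.
by rewrite -[e x z]in_nbr -Es inE.
Qed.

Lemma nbr_ext x (s : seq G) : uniq s -> all (e x) s -> size s < 4 ->
  exists y, uniq (rcons s y) /\ e x y.
Proof.
move=> Us xs s4; have [y] : exists2 y, y \in nbr x & y \notin s.
  by apply: card_gt_ex; rewrite card_nbr regG.
by rewrite in_nbr => xy ys; exists y; rewrite rcons_uniq ys.
Qed.

Lemma nbr3 x a b c : uniq [:: a; b; c] -> e x a -> e x b -> e x c ->
  exists d, uniq [:: a; b; c; d] /\ forall z, e x z = (z \in [:: a; b; c; d]).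
Proof.
move=> U xa xb xc; have [|//|d [Ud xd]] := @nbr_ext x _ U; first by rewrite /= xa xb xc.
by exists d; split=> //; apply: nbr_eq => //=; rewrite xa xb xc xd.
Qed.

Lemma nbr2 x a b : a != b -> e x a -> e x b ->
  exists c d, uniq [:: a; b; c; d] /\ forall z, e x z = (z \in [:: a; b; c; d]).
Proof.
move=> ab xa xb; have [||//|c [Uc xc]] := @nbr_ext x [:: a; b].
- by rewrite /= inE ab.
- by rewrite /= xa xb.
by have [d H] := nbr3 Uc xa xb xc; exists c, d.
Qed.

Lemma nbr1 x a : e x a ->
  exists b c d, uniq [:: a; b; c; d] /\ forall z, e x z = (z \in [:: a; b; c; d]).
Proof.
move=> xa; have [//||//|b [Ub xb]] := @nbr_ext x [:: a]; first by rewrite /= xa.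
have ab : a != b by move: Ub; rewrite /= inE andbT.
by have [c [d H]] := nbr2 ab xa xb; exists b, c, d.
Qed.

Lemma nbr0 x :
  exists a b c d, uniq [:: a; b; c; d] /\ forall z, e x z = (z \in [:: a; b; c; d]).
Proof.
have [//|//|//|a [_ xa]] := @nbr_ext x [::].
by have [b [c [d H]]] := nbr1 xa; exists a, b, c, d.
Qed.

Lemma edge_neq x y : e x y -> x != y.
Proof. by apply: contraTneq => ->; rewrite sedge_irr. Qed.

Lemma poor_seq x0 (si l d : seq G) : grown [set x in x0 :: si] -> uniq (x0 :: si ++ l) ->
  (forall x, x \in x0 :: si -> forall z, e x z -> z \in x0 :: si ++ l) ->
  all (fun z => has (fun x => e x z) (x0 :: si)) l ->
  uniq d -> all (mem l) d -> (forall x, x \in d -> forall z, e x z -> z \in x0 :: si ++ l) ->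
  2 * (size (x0 :: si) + size l) + 8 <= 4 * size l + size d ->
  2 * (size (x0 :: si) + size l) + 10 <= 5 * size l -> False.
Proof.
move=> gI U Hi /allP Hl Ud /allP dl Hd H8 H10.
have Hl' z : z \in l -> exists2 x, x \in x0 :: si & e x z by move/Hl/hasP.
have V k := @value_seq _ (x0 :: si) l d k gI U Hi Hl' Ud dl Hd.
by apply: (poor_value8 cG G2 poor gI); [apply: (V 8).1 | apply: (V 10).2].
Qed.

Lemma grown2 x y : e x y -> grown [set z in [:: x; y]].
Proof.
move=> xy; have -> : [set z in [:: x; y]] = y |: [set x] by apply/setP=> z; rewrite !inE orbC.
apply: grownU1; first exact: grown1; first by rewrite dom1 in_setU1 in_nbr xy orbT.
by rewrite inE eq_sym edge_neq.
Qed.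

Lemma grown3 x y z : e x y -> e x z -> y != z -> grown [set u in [:: x; y; z]].
Proof.
move=> xy xz yz; have -> : [set u in [:: x; y; z]] = z |: [set u in [:: x; y]].
  by apply/setP=> w; rewrite !inE; eqcases w.
apply: grownU1; first exact: grown2.
  by rewrite in_dom; apply/orP; right; apply/exists_inP; exists x; rewrite ?inE ?eqxx.
by rewrite !inE eq_sym (negPf (edge_neq xz)) eq_sym (negPf yz).
Qed.

(** Without a common neighbour the double star on [x] and [y] has six leaves: 24 - 16 = 8. *)
Lemma poor_triangle x y : e x y -> exists2 z, e x z & e y z.
Proof.
move=> xy; have yx : e y x by rewrite sedge_sym.
have [x1 [x2 [x3 [Ux Nx]]]] := nbr1 xy; have [y1 [y2 [y3 [Uy Ny]]]] := nbr1 yx.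
have [/existsP[z /andP[xz yz]]|/existsPn no] := boolP [exists z, e x z && e y z].
  by exists z.
exfalso; have xyN := edge_neq xy.
have n z : z \in [:: x1; x2; x3] -> z \notin [:: y1; y2; y3] /\ z != x.
  move=> zx; have xz : e x z by rewrite Nx inE zx orbT.
  split; last by rewrite eq_sym edge_neq.
  by apply: contra (no z) => zy; rewrite xz Ny inE zy orbT.
have m z : z \in [:: y1; y2; y3] -> z != y.
  by move=> zy; rewrite eq_sym edge_neq // Ny inE zy orbT.
have [n1 n1'] : x1 \notin [:: y1; y2; y3] /\ x1 != x by apply: n; rewrite !inE eqxx.
have [n2 n2'] : x2 \notin [:: y1; y2; y3] /\ x2 != x by apply: n; rewrite !inE eqxx ?orbT.
have [n3 n3'] : x3 \notin [:: y1; y2; y3] /\ x3 != x by apply: n; rewrite !inE eqxx ?orbT.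
have [m1 m2 m3] : [/\ y1 != y, y2 != y & y3 != y] by rewrite !m // !inE eqxx ?orbT.
distinct Ux; distinct Uy; distinct n1; distinct n2; distinct n3.
apply: (@poor_seq x [:: y] [:: x1; x2; x3; y1; y2; y3] [::] (grown2 xy)) => //.
- by rewrite /= !inE; neqs.
- by move=> u; rewrite !inE => /orP[]/eqP-> z; rewrite ?Nx ?Ny !inE; eqcases z.
- by rewrite /= !Nx !Ny !inE !eqxx !orbT.
Qed.

End Regular.

(** * Stars of the exceptional graphs *)

Definition octahedron_nb := [:: [:: 1; 2; 4; 5]; [:: 0; 2; 3; 5]; [:: 0; 1; 3; 4];
  [:: 1; 2; 4; 5]; [:: 0; 2; 3; 5]; [:: 0; 1; 3; 4]].
Definition C8sq_nb := [:: [:: 1; 2; 6; 7]; [:: 0; 2; 3; 7]; [:: 0; 1; 3; 4];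
  [:: 1; 2; 4; 5]; [:: 2; 3; 5; 6]; [:: 3; 4; 6; 7]; [:: 0; 4; 5; 7]; [:: 0; 1; 5; 6]].
Definition G8_nb := [:: [:: 1; 2; 3; 4]; [:: 0; 2; 3; 4]; [:: 0; 1; 5; 6];
  [:: 0; 1; 5; 7]; [:: 0; 1; 6; 7]; [:: 2; 3; 6; 7]; [:: 2; 4; 5; 7]; [:: 3; 4; 5; 6]].

Section Exceptions.
Variable G : sgraph.
Implicit Types (x y z v : G) (A B I : {set G}) (k : nat).
Local Notation e := (@sedge G).
Local Notation dg := (degree (@sedge G)).
Hypotheses (cG : is_connected e) (G2 : 1 < #|G|) (poor : ~~ rich G).
Let regG := poor_regular cG G2 poor.

Lemma cost4 x : cost x = 2.
Proof. by rewrite /cost regG. Qed.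

Lemma regular_star_value v k : k <= 6 + #|dead [set v]| -> value [set v] k.
Proof.
move=> H; apply: star_value => //; rewrite regG cost4.
by move: (weight_le (nbr v)) H; rewrite card_nbr regG; clear; lia.
Qed.

Lemma regular_star_dead v : #|dead [set v]| <= 1.
Proof.
rewrite leqNgt; apply/negP=> d2; apply: (@poor_star _ cG G2 poor v); rewrite cost4 regG;
  by move: (weight_le (nbr v)) d2; rewrite card_nbr regG; clear; lia.
Qed.

Lemma frontier_nbrs v x : x \in frontier [set v] -> e v x.
Proof. by rewrite star_frontier // in_nbr. Qed.

(** The leaf [d] is dead, so the star has value 7 and an active leaf forces a final tripod. Its
    three leaves are the remaining neighbours of [v], and the eight vertices form [G8]. *)
Lemma star_dead_G8 v d : e v d -> (forall z, e v z -> z != d -> e d z) ->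
  has_adjacency G G8_nb.
Proof.
move=> vd Hd; have dv : e d v by rewrite sedge_sym.
have df : d \in frontier [set v] by rewrite star_frontier // in_nbr.
have [r1 [r2 [r3 [Ud Nv]]]] := nbr1 cG G2 poor vd; have Un := Ud; distinct Ud.
have [vr1 vr2 vr3] : [/\ e v r1, e v r2 & e v r3] by rewrite !Nv !inE !eqxx !orbT.
have vN : {in [:: d; r1; r2; r3], forall z, z != v}.
  by move=> z zn; rewrite eq_sym edge_neq // Nv.
have [dv' rv1 rv2 rv3] : [/\ d != v, r1 != v, r2 != v & r3 != v] by rewrite !vN // !inE eqxx ?orbT.
have Nd : forall z, e d z = (z \in [:: v; r1; r2; r3]).
  apply: (nbr_eq cG G2 poor) => //=; first by rewrite !inE; neqs.
  by rewrite dv !Hd //; neqs.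
have D z : (z \in dom [set v]) = (z \in [:: v; d; r1; r2; r3]) by rewrite dom1 !inE Nv !inE.
have dd : d \in dead [set v].
  by rewrite frontier_dead // out0; apply/subsetP=> z; rewrite in_nbr Nd D !inE; eqcases z.
have V7 : value [set v] 7.
  by apply: regular_star_value; rewrite (cardsD1 d) dd; clear; lia.
have alive x : e v x -> x != d -> out [set v] x != set0.
  move=> vx xd; apply/negP=> o0.
  have xdead : x \in dead [set v] by rewrite frontier_dead // star_frontier // in_nbr.
  by have := regular_star_dead v; rewrite (cardsD1 d) dd (cardsD1 x) in_setD1 xd xdead.
have [/existsP[x ax]|/existsPn inact] := boolP [exists x, active [set v] x]; last first.
  exfalso; have cnt r : e v r -> r != d -> count (e r) [:: d; r1; r2; r3] = 2.
    move=> vr rd; have rn : r \in nbr v by rewrite in_nbr.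
    have o1 : #|out [set v] r| = 1.
      apply/eqP; rewrite eqn_leq card_gt0 alive // andbT.
      by have := inact r; rewrite /active star_frontier // rn -leqNgt.
    rewrite -card_nbr_in //; have := star_card rn; rewrite regG o1.
    have -> : [set y in [:: d; r1; r2; r3]] = nbr v.
      by apply/setP=> z; rewrite in_nbr Nv !inE.
    by clear; lia.
  (* Besides [d], each of [r1], [r2], [r3] would have exactly one neighbour among the other two:
     again an odd degree sum. *)
  have := cnt r1 vr1; have := cnt r2 vr2; have := cnt r3 vr3; neqs.
  rewrite /= !sedge_irr !(sedge_sym _ d) !Nd !inE; neqs.
  rewrite (sedge_sym r2 r1) (sedge_sym r3 r1) (sedge_sym r3 r2).
  by case: (e r1 r2); case: (e r1 r3); case: (e r2 r3) => /(_ isT)//= _ /(_ isT)//= _ /(_ isT).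
have [a [b [c [v' [q [r FT]]]]]] := poor_value7 cG G2 poor (grown1 v) V7 ax.
have [T U] := FT; have UT := tripod_uniq T; distinct UT.
have Na := tripod_nbr_a T; have Nb := tripod_nbr_b T; have Nc := tripod_nbr_c T.
have od : out [set v] d = set0 by apply/eqP; rewrite -frontier_dead.
have [v'd qd rd] : [/\ v' != d, q != d & r != d].
  split.
  - by apply: contraTneq isT => E; have := tripod_out_v T; rewrite E od => /setP/(_ a); rewrite !inE eqxx.
  - by apply: contraTneq isT => E; have := tripod_out_q T; rewrite E od => /setP/(_ a); rewrite !inE eqxx.
  - by apply: contraTneq isT => E; have := tripod_out_r T; rewrite E od => /setP/(_ b); rewrite !inE eqxx.
have vv' := frontier_nbrs (tripod_v T); have vq := frontier_nbrs (tripod_q T).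
have vr := frontier_nbrs (tripod_r T).
have Nv' : forall z, e v z = (z \in [:: d; v'; q; r]).
  by apply: (nbr_eq cG G2 poor) => //=; [rewrite !inE; neqs | rewrite vd vv' vq vr].
have Nd' : forall z, e d z = (z \in [:: v; v'; q; r]).
  have [v'v qv rv] : [/\ v' != v, q != v & r != v] by rewrite !(eq_sym _ v) !edge_neq.
  by apply: (nbr_eq cG G2 poor) => //=; [rewrite !inE; neqs | rewrite dv !Hd].
have dU z : z \in [:: a; b; c] -> (z != v) && (z != d).
  move=> zU; have : z \in ~: dom [set v] by rewrite U !inE -orbA; rewrite !inE in zU.
  by rewrite in_setC D !inE !negb_or => /and3P[-> ->].
have [/andP[av ad] /andP[bv bd] /andP[cv cd]] : [/\ (a != v) && (a != d), (b != v) && (b != d) &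
   (c != v) && (c != d)] by rewrite !dU // !inE eqxx ?orbT.
have [v'v qv rv] : [/\ v' != v, q != v & r != v] by rewrite !(eq_sym _ v) !edge_neq.
have Nv1 : forall z, e v' z = (z \in [:: v; d; a; b]).
  apply: (nbr_eq cG G2 poor) => //=; first by rewrite !inE; neqs.
  by rewrite !(sedge_sym v') Nv' Nd' Na Nb !inE; neqs.
have Nq : forall z, e q z = (z \in [:: v; d; a; c]).
  apply: (nbr_eq cG G2 poor) => //=; first by rewrite !inE; neqs.
  by rewrite !(sedge_sym q) Nv' Nd' Na Nc !inE; neqs.
have Nr : forall z, e r z = (z \in [:: v; d; b; c]).
  apply: (nbr_eq cG G2 poor) => //=; first by rewrite !inE; neqs.
  by rewrite !(sedge_sym r) Nv' Nd' Nb Nc !inE; neqs.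
apply: (@adjacency_intro _ cG _ v [:: v; d; v'; q; r; a; b; c]) => //.
  by rewrite /= !inE; neqs.
do 8?[case=> [_ z|]] => //=; rewrite ?Nv' ?Nd' ?Nv1 ?Nq ?Nr ?Na ?Nb ?Nc !inE; by eqcases z.
Qed.

(** The triangle on the edge from a rim vertex to its fourth neighbour shows that a neighbour on the
    rim shares this fourth neighbour. Either the four coincide, giving the octahedron, or they pair
    up along opposite rim edges, giving a wheel. *)
Lemma cycle_star v p1 p2 p3 p4 : uniq [:: p1; p2; p3; p4] ->
  (forall z, e v z = (z \in [:: p1; p2; p3; p4])) ->
  e p1 p2 -> e p2 p3 -> e p3 p4 -> e p4 p1 -> ~~ e p1 p3 -> ~~ e p2 p4 ->
  has_adjacency G octahedron_nb.
Proof.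
move=> Up Nv e12 e23 e34 e41 n13 n24.
have Un := Up; distinct Un.
have [v1 v2 v3 v4] : [/\ e p1 v, e p2 v, e p3 v & e p4 v].
  by rewrite !(sedge_sym _ v) !Nv !inE !eqxx !orbT.
have [e21 e32 e43 e14] : [/\ e p2 p1, e p3 p2, e p4 p3 & e p1 p4].
  by split; rewrite sedge_sym.
have [V1 V2 V3 V4] : [/\ p1 != v, p2 != v, p3 != v & p4 != v].
  by rewrite !edge_neq.
have [|w1 [U1 N1]] := @nbr3 _ cG G2 poor p1 v p2 p4 _ v1 e12 e14; first by rewrite /= !inE; neqs.
have [|w2 [U2 N2]] := @nbr3 _ cG G2 poor p2 v p1 p3 _ v2 e21 e23; first by rewrite /= !inE; neqs.
have [|w3 [U3 N3]] := @nbr3 _ cG G2 poor p3 v p2 p4 _ v3 e32 e34; first by rewrite /= !inE; neqs.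
have [|w4 [U4 N4]] := @nbr3 _ cG G2 poor p4 v p1 p3 _ v4 e41 e43; first by rewrite /= !inE; neqs.
have [e1w e2w e3w e4w] : [/\ e p1 w1, e p2 w2, e p3 w3 & e p4 w4].
  by rewrite N1 N2 N3 N4 !inE !eqxx !orbT.
have [w1p w2p w3p w4p] : [/\ w1 \notin [:: v; p1; p2; p3; p4], w2 \notin [:: v; p1; p2; p3; p4],
    w3 \notin [:: v; p1; p2; p3; p4] & w4 \notin [:: v; p1; p2; p3; p4]].
  have n31 : ~~ e p3 p1 by rewrite sedge_sym.
  have n42 : ~~ e p4 p2 by rewrite sedge_sym.
  have L p w s : e p w -> uniq (rcons s w) -> all (fun z => (z == p) || (z \in s) || ~~ e p z) [:: v; p1; p2; p3; p4] ->
      w \notin [:: v; p1; p2; p3; p4].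
    rewrite rcons_uniq => pw /andP[ws _] /allP H; apply/negP=> /H; rewrite pw (negPf ws) !orbF.
    by rewrite eq_sym (negPf (edge_neq pw)).
  split; [apply: (@L p1 w1 [:: v; p2; p4] e1w U1) | apply: (@L p2 w2 [:: v; p1; p3] e2w U2) |
    apply: (@L p3 w3 [:: v; p2; p4] e3w U3) | apply: (@L p4 w4 [:: v; p1; p3] e4w U4)];
    by rewrite /= !inE !eqxx ?n13 ?n24 ?n31 ?n42 ?orbT.
have nvw w : w \notin [:: v; p1; p2; p3; p4] -> e w v = false.
  by move=> wn; rewrite sedge_sym Nv; apply: contraNF wn => wp; rewrite in_cons wp orbT.
distinct w1p; distinct w2p; distinct w3p; distinct w4p.
have w124 : (w1 == w2) || (w1 == w4).
  have [z] := poor_triangle cG G2 poor e1w.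
  rewrite N1 !inE => /or4P[]/eqP->; rewrite ?nvw ?sedge_irr // sedge_sym ?N2 ?N4 !inE; neqs => -> //.
  by rewrite orbT.
have w213 : (w2 == w1) || (w2 == w3).
  have [z] := poor_triangle cG G2 poor e2w.
  rewrite N2 !inE => /or4P[]/eqP->; rewrite ?nvw ?sedge_irr // sedge_sym ?N1 ?N3 !inE; neqs => -> //.
  by rewrite orbT.
have w324 : (w3 == w2) || (w3 == w4).
  have [z] := poor_triangle cG G2 poor e3w.
  rewrite N3 !inE => /or4P[]/eqP->; rewrite ?nvw ?sedge_irr // sedge_sym ?N2 ?N4 !inE; neqs => -> //.
  by rewrite orbT.
have w413 : (w4 == w1) || (w4 == w3).
  have [z] := poor_triangle cG G2 poor e4w.
  rewrite N4 !inE => /or4P[]/eqP->; rewrite ?nvw ?sedge_irr // sedge_sym ?N1 ?N3 !inE; neqs => -> //.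
  by rewrite orbT.
have wf := poor_wheel_free cG G2 poor.
have [E13|N13] := eqVneq w1 w3; last first.
  exfalso; have [E12|N12] := eqVneq w1 w2.
    have E43 : w4 = w3.
      by move: w413 w324; case: eqP => [->|_ /eqP//]; rewrite -E12 !(eq_sym w3) (negPf N13).
    apply: (wf v p1 p2 p4 p3 w1 w3); split.
    - by rewrite /= !inE; neqs.
    - by move=> z; rewrite Nv !inE; eqcases z.
    - by move=> z; rewrite N1 !inE; eqcases z.
    - by move=> z; rewrite N2 -E12 !inE; eqcases z.
    - by move=> z; rewrite N4 E43 !inE; eqcases z.
    - by move=> z; rewrite N3 !inE; eqcases z.
  have E14 : w1 = w4 by apply/eqP; move: w124; rewrite (negPf N12).
  have E23 : w2 = w3 by apply/eqP; move: w213; rewrite (eq_sym w2) (negPf N12).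
  apply: (wf v p4 p1 p3 p2 w1 w3); split.
  - by rewrite /= !inE; neqs.
  - by move=> z; rewrite Nv !inE; eqcases z.
  - by move=> z; rewrite N4 -E14 !inE; eqcases z.
  - by move=> z; rewrite N1 !inE; eqcases z.
  - by move=> z; rewrite N3 !inE; eqcases z.
  - by move=> z; rewrite N2 E23 !inE; eqcases z.
have E12 : w1 = w2 by move: w213; rewrite -E13 orbb => /eqP.
have E14 : w1 = w4 by move: w413; rewrite -E13 orbb => /eqP.
have Nw : forall z, e w1 z = (z \in [:: p1; p2; p3; p4]).
  apply: (nbr_eq cG G2 poor) => //=.
  by rewrite !(sedge_sym w1) N1 N2 N3 N4 -E12 -E13 -E14 !inE !eqxx !orbT.
apply: (@adjacency_intro _ cG _ v [:: v; p1; p2; w1; p3; p4]) => //.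
  by rewrite /= !inE; neqs.
do 6?[case=> [_ z|]] => //=; rewrite ?Nv ?N1 ?N2 ?N3 ?N4 ?Nw -?E12 -?E13 -?E14 !inE; by eqcases z.
Qed.

End Exceptions.

(** * The square of the 8-cycle from a star whose rim is a path *)

Section PathStar.
Variable G : sgraph.
Implicit Types (x y z v : G) (A B I : {set G}) (k : nat).
Local Notation e := (@sedge G).
Hypotheses (cG : is_connected e) (G2 : 1 < #|G|) (poor : ~~ rich G).

Lemma path_star_C8 v p1 p2 p3 p4 b2 : uniq [:: p1; p2; p3; p4] ->
  (forall z, e v z = (z \in [:: p1; p2; p3; p4])) ->
  e p1 p2 -> e p2 p3 -> e p3 p4 -> ~~ e p1 p3 -> ~~ e p1 p4 -> ~~ e p2 p4 ->
  e p3 b2 -> b2 \notin [:: v; p2; p4] -> ~~ e p2 b2 -> has_adjacency G C8sq_nb.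
Proof.
move=> Up Nv e12 e23 e34 n13 n14 n24 e3b bn n2b.
have Un := Up; distinct Un; distinct bn.
have [v1 v2 v3 v4] : [/\ e p1 v, e p2 v, e p3 v & e p4 v].
  by rewrite !(sedge_sym _ v) !Nv !inE !eqxx !orbT.
have [e21 e32 e43] : [/\ e p2 p1, e p3 p2 & e p4 p3] by split; rewrite sedge_sym.
have [n31 n41 n42] : [/\ ~~ e p3 p1, ~~ e p4 p1 & ~~ e p4 p2] by split; rewrite sedge_sym.
have [V1 V2 V3 V4] : [/\ p1 != v, p2 != v, p3 != v & p4 != v] by rewrite !edge_neq.
have [|a [Ua N2]] := @nbr3 _ cG G2 poor p2 v p1 p3 _ v2 e21 e23; first by rewrite /= !inE; neqs.
have b1 : b2 != p1 by apply: contraTneq e3b => ->.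
have b3 : b2 != p3 by rewrite eq_sym edge_neq.
have N3 : forall z, e p3 z = (z \in [:: v; p2; p4; b2]).
  by apply: (nbr_eq cG G2 poor) => //=; [rewrite !inE; neqs | rewrite v3 e32 e34 e3b].
distinct Ua; have ea2 : e p2 a by rewrite N2 !inE eqxx !orbT.
have a2 : a != p2 by rewrite eq_sym edge_neq.
have a4 : a != p4 by apply: contraTneq ea2 => ->.
have ab2 : a != b2 by apply: contraTneq ea2 => ->.
have nvout z : z \notin [:: p1; p2; p3; p4] -> e z v = false.
  by rewrite -Nv sedge_sym => /negPf.
have e1a : e p1 a.
  have [z] := poor_triangle cG G2 poor ea2.
  rewrite N2 !inE => /or4P[]/eqP->; rewrite ?sedge_irr //.
  - by rewrite nvout // !inE; neqs.
  - by rewrite sedge_sym.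
  - by rewrite sedge_sym N3 !inE; neqs.
have e4b : e p4 b2.
  have [z] := poor_triangle cG G2 poor e3b.
  rewrite N3 !inE => /or4P[]/eqP->; rewrite ?sedge_irr //.
  - by rewrite nvout // !inE; neqs.
  - by rewrite sedge_sym N2 !inE; neqs.
  - by rewrite sedge_sym.
have [|b [Ub N1]] := @nbr3 _ cG G2 poor p1 v p2 a _ v1 e12 e1a; first by rewrite /= !inE; neqs.
have [|f [Uf N4]] := @nbr3 _ cG G2 poor p4 v p3 b2 _ v4 e43 e4b; first by rewrite /= !inE; neqs.
distinct Ub; distinct Uf.
have e1b : e p1 b by rewrite N1 !inE eqxx !orbT.
have e4f : e p4 f by rewrite N4 !inE eqxx !orbT.
have bp1 : b != p1 by rewrite eq_sym edge_neq.
have bp3 : b != p3 by apply: contraTneq e1b => ->.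
have bp4 : b != p4 by apply: contraTneq e1b => ->.
have fp4 : f != p4 by rewrite eq_sym edge_neq.
have fp1 : f != p1 by apply: contraTneq e4f => ->.
have fp2 : f != p2 by apply: contraTneq e4f => ->.
have e_ab : e b a.
  have [z] := poor_triangle cG G2 poor e1b.
  rewrite N1 !inE => /or4P[]/eqP->; rewrite ?sedge_irr //.
  - by rewrite nvout // !inE; neqs.
  - by rewrite sedge_sym N2 !inE; neqs.
have e_fb : e f b2.
  have [z] := poor_triangle cG G2 poor e4f.
  rewrite N4 !inE => /or4P[]/eqP->; rewrite ?sedge_irr //.
  - by rewrite nvout // !inE; neqs.
  - by rewrite sedge_sym N3 !inE; neqs.
have [vp1 vp4] : e v p1 /\ e v p4 by rewrite !(sedge_sym v).
have [eab e2a ea1] : [/\ e a b, e a p2 & e a p1] by split; rewrite sedge_sym.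
have [ebf eb3 eb4] : [/\ e b2 f, e b2 p3 & e b2 p4] by split; rewrite sedge_sym.
(* If the two strips beyond [p1] and [p4] do not meet, the inner vertices [v], [p1], [p4] have six
   leaves with [p2] and [p3] dead: 24 + 2 - 18 = 8. *)
have [abf|] := boolP [&& a != f, b != b2 & b != f].
  case/and3P: abf => af bb2 bf; exfalso.
  apply: (@poor_seq _ cG G2 poor v [:: p1; p4] [:: p2; p3; a; b; b2; f] [:: p2; p3]) => //.
  - exact: grown3.
  - by rewrite /= !inE; neqs.
  - by move=> u; rewrite !inE => /or3P[]/eqP-> z; rewrite ?Nv ?N1 ?N4 !inE; eqcases z.
  - by rewrite /= !Nv !N1 !N4 !inE !eqxx !orbT.
  - by rewrite /= !inE; neqs.
  - by rewrite /= !inE !eqxx !orbT.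
  - by move=> u; rewrite !inE => /orP[]/eqP-> z; rewrite ?N2 ?N3 !inE; eqcases z.
(* This forces [b2 = b]. The inner vertices [v] and [p1] then have five leaves, three of them dead:
   20 + 3 - 14 = 9. *)
have [af|af] := eqVneq a f.
  have Na : forall z, e a z = (z \in [:: p1; p2; b; p4]).
    apply: (nbr_eq cG G2 poor) => //=; first by rewrite !inE; neqs.
    by rewrite ea1 e2a eab sedge_sym af e4f.
  have bb2 : b2 = b.
    have : e a b2 by rewrite af.
    by rewrite Na !inE; neqs => /eqP.
  move=> _; exfalso; rewrite -{}af {}bb2 in N4 N3 *.
  apply: (@poor_seq _ cG G2 poor v [:: p1] [:: p2; p3; p4; a; b] [:: p2; p3; p4]) => //.
  - exact: grown2.
  - by rewrite /= !inE; neqs.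
  - by move=> u; rewrite !inE => /orP[]/eqP-> z; rewrite ?Nv ?N1 !inE; eqcases z.
  - by rewrite /= !Nv !N1 !inE !eqxx !orbT.
  - by rewrite /= !inE; neqs.
  - by rewrite /= !inE !eqxx !orbT.
  - by move=> u; rewrite !inE => /or3P[]/eqP-> z; rewrite ?N2 ?N3 ?N4 !inE; eqcases z.
(* Here [f] would be a fifth neighbour of [b]. *)
have [bb|bb] := eqVneq b b2.
  exfalso; have Nb : forall z, e b z = (z \in [:: p1; a; p3; p4]).
    apply: (nbr_eq cG G2 poor) => //=; first by rewrite !inE; neqs.
    by rewrite e_ab !(sedge_sym b) e1b bb e3b e4b.
  have : e b f by rewrite bb.
  by rewrite Nb !inE; neqs.
have [bf _|//] := eqVneq b f; subst f.
have ebp1 : e b p1 by rewrite sedge_sym.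
have ebp4 : e b p4 by rewrite sedge_sym.
have Nb : forall z, e b z = (z \in [:: p1; a; p4; b2]).
  apply: (nbr_eq cG G2 poor) => //=; first by rewrite !inE; neqs.
  by rewrite ebp1 e_ab ebp4 e_fb.
have [|a1 [Ua1 Na]] := @nbr3 _ cG G2 poor a p1 p2 b _ ea1 e2a eab.
  by rewrite /= !inE; neqs.
distinct Ua1; have eaa1 : e a a1 by rewrite Na !inE eqxx !orbT.
have aa1 := edge_neq eaa1.
have a1v : a1 != v by apply: contraTneq eaa1 => ->; rewrite nvout // !inE; neqs.
(* The triangle on the edge from [a] to its last neighbour [a1] can only pass through [b], which
   closes the strip. *)
have a1b : a1 = b2.
  have a1p3 : a1 != p3 by apply: contraTneq eaa1 => ->; rewrite sedge_sym N3 !inE; neqs.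
  have a1p4 : a1 != p4 by apply: contraTneq eaa1 => ->; rewrite sedge_sym N4 !inE; neqs.
  have [z] := poor_triangle cG G2 poor eaa1.
  rewrite Na !inE => /or4P[]/eqP->; rewrite ?sedge_irr //.
  - by rewrite sedge_sym N1 !inE; neqs.
  - by rewrite sedge_sym N2 !inE; neqs.
  - by rewrite sedge_sym Nb !inE; neqs => /eqP.
rewrite {}a1b in eaa1 Na.
have Nb2 : forall z, e b2 z = (z \in [:: p3; p4; b; a]).
  apply: (nbr_eq cG G2 poor) => //=; first by rewrite !inE; neqs.
  by rewrite eb3 eb4 ebf sedge_sym eaa1.
apply: (@adjacency_intro _ cG _ v [:: v; p3; p4; b2; b; a; p1; p2]) => //.
  by rewrite /= !inE; neqs.
do 8?[case=> [_ z|]] => //=; rewrite ?Nv ?N1 ?N2 ?N3 ?N4 ?Na ?Nb ?Nb2 !inE; by eqcases z.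
Qed.

End PathStar.

(** * Graphs without exceptional stars *)

Section Nice.
Variable G : sgraph.
Implicit Types (x y z v : G) (A B I : {set G}) (k : nat).
Local Notation e := (@sedge G).
Hypotheses (cG : is_connected e) (G2 : 1 < #|G|) (poor : ~~ rich G).
(* These exclude G8, C_6^2 and C_8^2, respectively. *)
Hypothesis no_hub : forall v d, e v d -> ~ (forall z, e v z -> z != d -> e d z).
Hypothesis no_cycle : forall v p1 p2 p3 p4, uniq [:: p1; p2; p3; p4] ->
  (forall z, e v z = (z \in [:: p1; p2; p3; p4])) ->
  e p1 p2 -> e p2 p3 -> e p3 p4 -> ~ e p4 p1.
Hypothesis no_strip : forall v p1 p2 p3 p4 w, uniq [:: p1; p2; p3; p4] ->
  (forall z, e v z = (z \in [:: p1; p2; p3; p4])) ->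
  e p1 p2 -> e p2 p3 -> e p3 p4 -> e p3 w -> w \notin [:: v; p2; p4] -> e p2 w.

Lemma no_hub4 v x y z t : (forall u, e v u = (u \in [:: x; y; z; t])) ->
  e x y -> e x z -> ~ e x t.
Proof.
move=> Nv xy xz xt; apply: (@no_hub v x); first by rewrite Nv !inE eqxx.
by move=> u; rewrite Nv !inE => /or4P[]/eqP->; rewrite ?eqxx.
Qed.

Lemma frontier_out I v a : v \in frontier I -> a \in out I v -> e v a /\ a \notin dom I.
Proof. by move=> _; rewrite in_out => /andP. Qed.

Lemma not_inner I u a : u \in I -> a \notin dom I -> e u a = false.
Proof. by move=> uI ad; apply: contraNF ad => ua; apply: (subsetP (nbr_dom uI)); rewrite in_nbr. Qed.

(** The triangle on the edge to an inner neighbour [u] lies in the tree, so only two neighbours of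
    [v] are outside. If these were not adjacent, their triangles with [v] would both use [x], making
    [x] a hub. *)
Lemma active_nbrs I v : active I v -> exists u x a b,
  [/\ u \in I, x \in dom I, uniq [:: u; x; a; b] &
      forall z, e v z = (z \in [:: u; x; a; b])] /\
  [/\ a \notin dom I, b \notin dom I, out I v = [set a; b] & e a b].
Proof.
case/andP=> vf o2; have [u uI uv] := frontier_inner vf.
have vu : e v u by rewrite sedge_sym.
have [a ao _] : exists2 a, a \in out I v & a \notin [::] by apply: card_gt_ex; apply: ltnW.
have [b bo ba] : exists2 b, b \in out I v & b \notin [:: a] by apply: card_gt_ex.
move: ao bo ba; rewrite !in_out inE => /andP[va ad] /andP[vb bd] ba.
have [x vx ux] := poor_triangle cG G2 poor vu.
have xd : x \in dom I by apply: (subsetP (nbr_dom uI)); rewrite in_nbr.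
have ud := mem_dom uI.
have H p q : p \in dom I -> q \notin dom I -> p != q.
  by move=> pd qd; apply: contraNneq qd => <-.
have U : uniq [:: u; x; a; b].
  have [ua ub xa xb] : [/\ u != a, u != b, x != a & x != b] by rewrite !H.
  by have uxN := edge_neq ux; rewrite /= !inE; neqs.
have Nv := nbr_eq cG G2 poor U (_ : all (e v) _) erefl.
have {}Nv : forall z, e v z = (z \in [:: u; x; a; b]) by apply: Nv; rewrite /= vu vx va vb.
exists u, x, a, b; split=> //; split=> //.
  apply/setP=> z; rewrite in_out Nv !inE.
  case: (eqVneq z u) => [->|_]; first by rewrite ud (negPf (H _ _ ud ad)) (negPf (H _ _ ud bd)).
  case: (eqVneq z x) => [->|_]; first by rewrite xd (negPf (H _ _ xd ad)) (negPf (H _ _ xd bd)).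
  by case: (eqVneq z a) => [->|_]; rewrite ?ad //; case: (eqVneq z b) => [->|_]; rewrite ?bd.
apply/negPn/negP=> nab.
have xa : e x a.
  have [w] := poor_triangle cG G2 poor va; rewrite Nv !inE => /or4P[]/eqP->; rewrite ?sedge_irr //.
  - by rewrite sedge_sym (not_inner uI ad).
  - by rewrite sedge_sym.
  - by rewrite (negPf nab).
have xb : e x b.
  have [w] := poor_triangle cG G2 poor vb; rewrite Nv !inE => /or4P[]/eqP->; rewrite ?sedge_irr //.
  - by rewrite sedge_sym (not_inner uI bd).
  - by rewrite sedge_sym.
  - by rewrite sedge_sym (negPf nab).
apply: (@no_hub4 v x u a b) => //; last by rewrite sedge_sym.
by move=> z; rewrite Nv !inE; eqcases z.
Qed.

(** An expansion with two new leaves costs nothing, so two deaths lift the value from 6 to 8. *)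
Lemma two_deaths I v y z : grown I -> value I 6 -> active I v -> dom (v |: I) != setT ->
  y != z -> y \in dead (v |: I) :\: dead I -> z \in dead (v |: I) :\: dead I -> False.
Proof.
move=> gI V6 av NT yz yd zd; case/andP: (av) => vf _.
apply: (poor_value8 cG G2 poor (grown_expand gI vf)); last by move=> E; rewrite E eqxx in NT.
apply: (@expand_value _ _ _ [:: y; z]) V6 _ => //.
- exact: active_out.
- by rewrite /= inE yz.
- by move=> w; rewrite 2!in_cons in_nil orbF => /orP[]/eqP->.
have [u [x [a [b [[_ _ U _] [_ _ -> _]]]]]] := active_nbrs av; distinct U.
by rewrite cards2; neqs; have := weight_le [set a; b]; rewrite cards2; neqs; clear; lia.
Qed.

(** If the tree became spanning, both new leaves and the two remaining neighbours of one of them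
    would die, giving 6 + 4 = 10. *)
Lemma active_nonspanning I v : grown I -> value I 6 -> active I v -> dom (v |: I) != setT.
Proof.
move=> gI V6 av; apply/negP=> /eqP DT; case/andP: (av) => vf _.
have [u [x [a [b [[uI xd U Nv] [ad bd Eo ab]]]]]] := active_nbrs av; distinct U.
have av' : e a v by rewrite sedge_sym Nv !inE eqxx !orbT.
have vd : v \in dom I by case/setDP: vf.
have vb : v != b by apply: contraNneq bd => <-.
have va : v != a by apply: contraNneq ad => <-.
have [c [d [Ua Na]]] := nbr2 cG G2 poor vb av' ab; distinct Ua.
case/negP: poor; apply: (rich_value G2 (grown_expand gI vf) DT).
have H z : z != v -> z \in frontier I :|: out I v -> (z \notin dom I) || (out I z != set0) ->
    z \in dead (v |: I) :\: dead I.
  move=> zv zfo zI; apply: new_dead => //; last by rewrite DT subsetT.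
  by rewrite frontier_expand // zv !andbT -in_setU.
have K z : e a z -> z != v -> z != b -> z \in dead (v |: I) :\: dead I.
  move=> az zv zb; have za : e z a by rewrite sedge_sym.
  have zd : z \in dom I.
    have : z \in dom (v |: I) by rewrite DT inE.
    by rewrite dom_out // Eo !inE (negPf zb) orbF eq_sym (negPf (edge_neq az)) orbF.
  apply: H => //; first by rewrite in_setU (frontier_nbr zd ad za).
  by apply/orP; right; apply/set0Pn; exists a; rewrite in_out za.
apply: (@expand_value _ _ _ [:: a; b; c; d]) V6 _ => //.
- exact: active_out.
- have [ac ad'] : a != c /\ a != d by rewrite !edge_neq // Na !inE eqxx !orbT.
  by rewrite /= !inE; neqs.
- move=> w; rewrite 4!in_cons in_nil orbF => /or4P[]/eqP->.
  + by apply: H; rewrite ?ad // 1?eq_sym // Eo !inE eqxx !orbT.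
  + by apply: H; rewrite ?bd // 1?eq_sym // Eo !inE eqxx !orbT.
  + by apply: K; rewrite ?Na ?inE ?eqxx ?orbT // eq_sym.
  + by apply: K; rewrite ?Na ?inE ?eqxx ?orbT // eq_sym.
- by rewrite Eo; have := weight_le [set a; b]; rewrite cards2; neqs; clear; lia.
Qed.

(** Otherwise the rim of the star at [c] would be a 4-cycle. *)
Lemma tripod_not_adjacent I a b c v q r : tripod I a b c v q r -> ~ e q r.
Proof.
move=> T qr; have U := tripod_uniq T; distinct U.
apply: (@no_cycle c q r b a).
- by rewrite /= !inE; neqs.
- by move=> z; rewrite (tripod_nbr_c T) !inE; eqcases z.
- by [].
- by rewrite sedge_sym (tripod_nbr_b T) !inE eqxx !orbT.
- by rewrite (tripod_nbr_b T) !inE eqxx !orbT.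
- by rewrite (tripod_nbr_a T) !inE eqxx !orbT.
Qed.

(** The two neighbours of [p] other than [v0] and [q] die, contrary to [two_deaths]. If one of them
    survived, it would be [v] or [r], and its edge to [p] would lie in no triangle. *)
Lemma not_before_tripod_aux I v0 a b c v q r p : grown I -> value I 6 -> active I v0 ->
  final_tripod (v0 |: I) a b c v q r -> out I v0 = [set q; p] -> q != p ->
  out (v0 |: I) p = set0 -> e q p -> False.
Proof.
move=> gI V6 act0 FT E0 qp0 op0 qp; have [T U] := FT.
have NT := active_nonspanning gI V6 act0.
have v0f : v0 \in frontier I by case/andP: act0.
have v0d : v0 \in dom I by case/setDP: v0f.
have pq : e p q by rewrite sedge_sym.
have [v0q qd] : e v0 q /\ q \notin dom I by apply/andP; rewrite -in_out E0 !inE eqxx.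
have [v0p pd] : e v0 p /\ p \notin dom I by apply/andP; rewrite -in_out E0 !inE eqxx orbT.
have pv0 : e p v0 by rewrite sedge_sym.
have v0qN := edge_neq v0q.
have [y1 [y2 [Up Np]]] := nbr2 cG G2 poor v0qN pv0 pq; distinct Up.
have D1 z : (z \in dom (v0 |: I)) = (z \in dom I) || (z == q) || (z == p).
  by rewrite dom_out // E0 !inE orbA.
have pd1 z : e p z -> z \in dom (v0 |: I).
  move=> pz; apply/negPn/negP=> zd.
  by have := in_out (v0 |: I) p z; rewrite op0 inE pz zd.
have K y : e p y -> y != v0 -> y != q -> y \in dead (v0 |: I) :\: dead I.
  move=> py yv0 yq; have yp : e y p by rewrite sedge_sym.
  have yd : y \in dom I.
    by have := pd1 y py; rewrite D1 (negPf yq) (eq_sym y p) (negPf (edge_neq py)) !orbF.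
  have yf := frontier_nbr yd pd yp.
  have yf1 : y \in frontier (v0 |: I) by rewrite frontier_expand // yf yv0.
  apply: new_dead => //; last first.
    by apply/orP; right; apply/set0Pn; exists p; rewrite in_out yp.
  rewrite -out0; apply/negPn/negP=> oy.
  have := final_tripod_alive FT yf1 oy; rewrite !inE (negPf yq) /= => yvr.
  have [t tI ty] := frontier_inner yf.
  have [w1 [w2 [w12 w1d w2d [yw1 yw2]]]] : exists w1 w2, [/\ w1 != w2,
     w1 \notin dom (v0 |: I), w2 \notin dom (v0 |: I) & e y w1 /\ e y w2].
    have UT := tripod_uniq T; distinct UT.
    case/orP: yvr => /eqP->.
      exists a, b; split=> //; try by apply: (frontier_out (tripod_v T) _).2; rewrite (tripod_out_v T) !inE eqxx ?orbT.
      by rewrite !(sedge_sym v) (tripod_nbr_a T) (tripod_nbr_b T) !inE !eqxx.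
    exists b, c; split=> //; try by apply: (frontier_out (tripod_r T) _).2; rewrite (tripod_out_r T) !inE eqxx ?orbT.
    by rewrite !(sedge_sym r) (tripod_nbr_b T) (tripod_nbr_c T) !inE !eqxx ?orbT.
  have pd1' : p \in dom (v0 |: I) by rewrite D1 eqxx orbT.
  have td : t \in dom I := mem_dom tI.
  have td1 : t \in dom (v0 |: I) by rewrite D1 td.
  have tp : t != p by apply: contraNneq pd => <-.
  have H w z : w \in dom (v0 |: I) -> z \notin dom (v0 |: I) -> w != z.
    by move=> wd zd; apply: contraNneq zd => <-.
  have Ny : forall z, e y z = (z \in [:: t; p; w1; w2]).
    apply: (nbr_eq cG G2 poor) => //=; first by rewrite !inE !negb_or tp w12 !H.
    by rewrite sedge_sym ty yp yw1 yw2.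
  have [w] := poor_triangle cG G2 poor yp; rewrite Ny !inE => /or4P[]/eqP->.
  - by rewrite sedge_sym (not_inner tI pd).
  - by rewrite sedge_irr.
  - by move=> /pd1; rewrite (negPf w1d).
  - by move=> /pd1; rewrite (negPf w2d).
apply: (two_deaths gI V6 act0 NT (y := y1) (z := y2)) => //; apply: K;
  by rewrite ?Np ?inE ?eqxx ?orbT // eq_sym.
Qed.

(** The new leaves [p1] and [p2] are adjacent. Both dead is [two_deaths]; exactly one dead is the
    auxiliary lemma; both alive would make two leaves of the tripod adjacent. *)
Lemma not_before_tripod I v0 a b c v q r : grown I -> value I 6 -> active I v0 ->
  ~ final_tripod (v0 |: I) a b c v q r.
Proof.
move=> gI V6 act0 FT; have NT := active_nonspanning gI V6 act0.
have [u [x [p1 [p2 [[uI xd U Nv] [p1d p2d Eo p12]]]]]] := active_nbrs act0; distinct U.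
have v0f : v0 \in frontier I by case/andP: act0.
have v0d : v0 \in dom I by case/setDP: v0f.
have FT' := final_tripod_rot FT; have FT'' := final_tripod_rot FT'.
have fr p : p \in out I v0 -> p \in frontier (v0 |: I).
  move=> po; have [_ pd] := frontier_out v0f po.
  by rewrite frontier_expand // po; apply/orP; right; apply: contraNneq pd => ->.
have dd p : p \in out I v0 -> out (v0 |: I) p = set0 -> p \in dead (v0 |: I) :\: dead I.
  move=> po o0; have [_ pd] := frontier_out v0f po.
  by apply: new_dead; rewrite ?fr -?out0 ?o0 ?pd.
have o1 : p1 \in out I v0 by rewrite Eo !inE eqxx.
have o2 : p2 \in out I v0 by rewrite Eo !inE eqxx orbT.
have p12N : p1 != p2 := edge_neq p12.
have aux p p' : p \in out I v0 -> out (v0 |: I) p != set0 -> out I v0 = [set p; p'] -> p != p' ->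
    out (v0 |: I) p' = set0 -> e p p' -> False.
  move=> po oN E pp op' pp'; have := final_tripod_alive FT (fr p po) oN.
  rewrite !inE => /or3P[]/eqP pE; subst p.
  - exact: not_before_tripod_aux gI V6 act0 FT' E pp op' pp'.
  - exact: not_before_tripod_aux gI V6 act0 FT E pp op' pp'.
  - exact: not_before_tripod_aux gI V6 act0 FT'' E pp op' pp'.
have [z1|n1] := eqVneq (out (v0 |: I) p1) set0; have [z2|n2] := eqVneq (out (v0 |: I) p2) set0.
- exact: two_deaths gI V6 act0 NT p12N (dd _ o1 z1) (dd _ o2 z2).
- by apply: (aux p2 p1) => //; rewrite 1?setUC 1?eq_sym 1?sedge_sym.
- exact: (aux p1 p2).
- have := final_tripod_alive FT (fr _ o1) n1; have := final_tripod_alive FT (fr _ o2) n2.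
  have [T _] := FT; have [T' _] := FT'; have [T'' _] := FT''.
  have a1 := tripod_not_adjacent T; have a2 := tripod_not_adjacent T'.
  have a3 := tripod_not_adjacent T''.
  rewrite !inE => /or3P[]/eqP E2 /or3P[]/eqP E1; move: p12; rewrite E1 E2 ?sedge_irr //;
    by rewrite 1?sedge_sym.
Qed.

Lemma active_out_at I z a : active I z -> e z a -> a \notin dom I ->
  exists c, [/\ out I z = [set a; c], e a c, c \notin dom I & e z c].
Proof.
move=> az za ad; have [u [x [c [d [[_ _ _ Nz] [cd dd Eo cdE]]]]]] := active_nbrs az.
have : a \in out I z by rewrite in_out za.
have [zc zd] : e z c /\ e z d by rewrite !Nz !inE !eqxx !orbT.
rewrite {1}Eo !inE => /orP[]/eqP->; first by exists d.
by exists c; split; rewrite // 1?setUC // sedge_sym.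
Qed.

(** * Trees of value 6 on which no leaf is active after an expansion *)

Section Stuck.
Variable I : {set G}.
Hypotheses (gI : grown I) (V6 : value I 6)
  (stuck : forall v x, active I v -> ~~ active (v |: I) x).

(** Otherwise [a] has neighbours [v], [b], [z] and a fourth one, [a4], whose triangle with [a]
    passes through one of them. Through [b] it makes [b] a hub; through [v] or [z] the rim of [a] is
    a path, and [no_strip] joins [b] to an inner vertex. *)
Lemma no_parallel v a b z : active I v -> out I v = [set a; b] -> e a b ->
  z \in frontier I -> z != v -> e z a -> ~ e z b.
Proof.
move=> av Eo ab zf zv za zb.
have [va ad] : e v a /\ a \notin dom I by apply/andP; rewrite -in_out Eo !inE eqxx.
have [vb bd] : e v b /\ b \notin dom I by apply/andP; rewrite -in_out Eo !inE eqxx orbT.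
have [vf zd] : v \in frontier I /\ z \in dom I by split; [case/andP: av | case/setDP: zf].
have vd : v \in dom I by case/setDP: vf.
have vbN : v != b by apply: contraNneq bd => <-.
have zbN : z != b by apply: contraNneq bd => <-.
have [eav eaz] : e a v /\ e a z by rewrite !(sedge_sym a).
have [ebv ebz eba] : [/\ e b v, e b z & e b a] by rewrite !(sedge_sym b).
have [|a4 [Ua Na]] := @nbr3 _ cG G2 poor a v b z _ eav ab eaz.
  by rewrite /= !inE; neqs.
distinct Ua; have ea4 : e a a4 by rewrite Na !inE eqxx !orbT.
have inner y : y \in frontier I -> y != b -> y != a4 -> e b y -> e y a4 ->
   (exists x, [/\ uniq [:: x; b; y; a4], forall w, e a w = (w \in [:: x; b; y; a4]) & e x b]) -> False.
  move=> yf yb ya4 eby ey4 [x [Ux Nx xb]]; have [u uI uy] := frontier_inner yf.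
  have ud := mem_dom uI.
  have eyu : e y u by rewrite sedge_sym.
  have un : u \notin [:: a; b; a4].
    rewrite !inE !negb_or; apply/and3P; split.
    - by apply: contraNneq ad => <-.
    - by apply: contraNneq bd => <-.
    - by apply: contraTneq ea4 => <-; rewrite sedge_sym (not_inner uI ad).
  have := no_strip Ux Nx xb eby ey4 eyu un.
  by rewrite sedge_sym (not_inner uI bd).
have [w] := poor_triangle cG G2 poor ea4; rewrite Na !inE => /or4P[]/eqP->; rewrite ?sedge_irr // sedge_sym => E4.
- apply: (inner v) => //; exists z; split=> //; first by rewrite /= !inE; neqs.
  by move=> t; rewrite Na !inE; eqcases t.
- apply: (@no_hub4 a b v z a4) => // t; rewrite Na !inE; by eqcases t.
- apply: (inner z) => //; exists v; split=> //; by rewrite /= !inE; neqs.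
Qed.

(** If neither of the two remaining neighbours of [a] were in the tree, [a] would be active after
    the expansion of [v]. *)
Lemma second_leaf v a b : active I v -> out I v = [set a; b] -> e a b ->
  exists z, [/\ z \in frontier I, z != v & e z a].
Proof.
move=> av Eo ab; have abN := edge_neq ab.
have [va ad] : e v a /\ a \notin dom I by apply/andP; rewrite -in_out Eo !inE eqxx.
have [vb bd] : e v b /\ b \notin dom I by apply/andP; rewrite -in_out Eo !inE eqxx orbT.
have vf : v \in frontier I by case/andP: av.
have vd : v \in dom I by case/setDP: vf.
have vbN : v != b by apply: contraNneq bd => <-.
have eav : e a v by rewrite sedge_sym.
have [c [d [Ua Na]]] := nbr2 cG G2 poor vbN eav ab; distinct Ua.
have [ac ad'] : e a c /\ e a d by rewrite !Na !inE !eqxx !orbT.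
have D1 z : (z \in dom (v |: I)) = (z \in dom I) || (z == a) || (z == b).
  by rewrite dom_out // Eo !inE orbA.
have K z : e a z -> z != v -> z != b -> z \in dom (v |: I) ->
    exists z, [/\ z \in frontier I, z != v & e z a].
  move=> az zv zb; have za : e z a by rewrite sedge_sym.
  rewrite D1 (negPf zb) (negPf (edge_neq za)) !orbF => zd.
  by exists z; split=> //; apply: frontier_nbr ad za.
have [cd|cd] := boolP (c \in dom (v |: I)); first by apply: (K c) => //; rewrite eq_sym.
have [dd|dd] := boolP (d \in dom (v |: I)); first by apply: (K d) => //; rewrite eq_sym.
case/negP: (stuck a av); apply: (active_ex _ _ ac ad') => //.
by rewrite D1 eqxx orbT.
Qed.

(** If a leaf [y] other than [v] that sees [b] is active, the three leaves form a tripod, and the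
    value 8 it yields forces it to be final. If [y] is inactive it dies with [v], and the fourth
    neighbour of [b] decides. *)
Lemma second_active v a b z : active I v -> out I v = [set a; b] -> e a b ->
  active I z -> z != v -> e z a -> exists a b c v q r, final_tripod I a b c v q r.
Proof.
move=> av Eo ab az zv za; have abN := edge_neq ab.
have NT := active_nonspanning gI V6 av.
have [va ad] : e v a /\ a \notin dom I by apply/andP; rewrite -in_out Eo !inE eqxx.
have [vb bd] : e v b /\ b \notin dom I by apply/andP; rewrite -in_out Eo !inE eqxx orbT.
have fd y : y \in frontier I -> y \in dom I by case/setDP.
have vf : v \in frontier I by case/andP: av.
have zf : z \in frontier I by case/andP: az.
have [vd zd] := (fd v vf, fd z zf).
have nzb : ~ e z b := no_parallel av Eo ab zf zv za.
have [c [Ez ac cd zc]] := active_out_at az za ad.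
have acN := edge_neq ac.
have cb : c != b by apply: contra_not_neq nzb => <-.
have H p q : p \in dom I -> q \notin dom I -> p != q.
  by move=> pd qd; apply: contraNneq qd => <-.
have [vaN vbN vcN] : [/\ v != a, v != b & v != c] by rewrite !H.
have [zaN zbN zcN] : [/\ z != a, z != b & z != c] by rewrite !H.
have eav : e a v by rewrite sedge_sym.
have eaz : e a z by rewrite sedge_sym.
have Na : forall t, e a t = (t \in [:: v; z; b; c]).
  by apply: (nbr_eq cG G2 poor) => //=; [rewrite !inE; neqs | rewrite eav eaz ab ac].
have Eo' : out I v = [set b; a] by rewrite setUC.
have ba : e b a by rewrite sedge_sym.
have D1 t : (t \in dom (v |: I)) = (t \in dom I) || (t == a) || (t == b).
  by rewrite dom_out // Eo !inE orbA.
have dying y : y \in frontier I -> y != v -> e y b -> ~~ active I y ->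
    y \in dead (v |: I) :\: dead I.
  move=> yf yv yb yna; have oy : b \in out I y by rewrite in_out yb.
  have Ey : out I y = [set b].
    apply/esym/eqP; rewrite eqEcard sub1set oy cards1.
    by move: yna; rewrite /active yf -leqNgt.
  apply: new_dead => //; first by rewrite frontier_expand // yf yv.
    apply/subsetP=> t; rewrite in_nbr D1 => yt; case td: (t \in dom I) => //=.
    by have : t \in out I y; [rewrite in_out yt td | rewrite Ey inE => ->; rewrite orbT].
  by apply/orP; right; apply/set0Pn; exists b.
have done_ y : active I y -> y != v -> e y b -> exists a b c v q r, final_tripod I a b c v q r.
  move=> ay yv yb; have yf : y \in frontier I by case/andP: ay.
  have yd := fd y yf.
  have [d [Ey bd' dd yd']] := active_out_at ay yb bd.
  have bdN := edge_neq bd'.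
  have nya : ~ e y a := no_parallel av Eo' ba yf yv yb.
  have da : d != a by apply: contra_not_neq nya => <-.
  have yz : y != z by apply: contra_not_neq nya => ->.
  have zy : z != y by rewrite eq_sym.
  (* Otherwise [y] would still see [b] and [d] after the expansion of [z]. *)
  have cdE : c = d.
    apply/eqP/negPn/negP=> cdN; case/negP: (stuck y az).
    have Dz t : (t \in dom (z |: I)) = (t \in dom I) || (t == a) || (t == c).
      by rewrite dom_out // Ez !inE orbA.
    apply: (active_ex _ bdN yb yd').
    - by rewrite Dz yd.
    - by rewrite Dz (negPf bd); neqs.
    - by rewrite Dz (negPf dd); neqs.
  subst d; have ybN : y != b by rewrite H.
  have [yaN ycN] : y != a /\ y != c by rewrite !H.
  have [ebv eby] : e b v /\ e b y by rewrite !(sedge_sym b).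
  have Nb : forall t, e b t = (t \in [:: v; y; a; c]).
    by apply: (nbr_eq cG G2 poor) => //=; [rewrite !inE; neqs | rewrite ebv eby ba bd'].
  have Nc : forall t, e c t = (t \in [:: z; y; a; b]).
    apply: (nbr_eq cG G2 poor) => //=; first by rewrite !inE; neqs.
    by rewrite !(sedge_sym c) zc yd' ac bd'.
  have T : tripod I a b c v z y.
    by split=> //; rewrite /= !inE; neqs.
  have [gI2 D2 V8] := tripod_gain T gI V6.
  have [DT|DN] := eqVneq (dom (a |: (v |: I))) setT; last first.
    by case: (poor_value8 cG G2 poor gI2 V8) => E; rewrite E eqxx in DN.
  exists a, b, c, v, z, y; split=> //; apply/setP=> t; rewrite in_setC.
  have : t \in dom I :|: [set a; b; c] by rewrite -D2 DT inE.
  rewrite in_setU; case td: (t \in dom I) => //= _; rewrite !inE.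
  by rewrite !(negPf (H _ _ td _)).
have [y [yf yv yb]] := second_leaf av Eo' ba.
have [ay|nay] := boolP (active I y); first exact: done_ ay yv yb.
have ydead := dying y yf yv yb nay.
have nya : ~ e y a := no_parallel av Eo' ba yf yv yb.
have yvb : uniq [:: v; a; y].
  rewrite /= !inE; have yaN : a != y by apply: contraNneq ad => ->; apply: fd.
  by neqs.
have [ebv eby] : e b v /\ e b y by rewrite !(sedge_sym b).
have [b4 [Ub Nb]] := nbr3 cG G2 poor yvb ebv ba eby.
distinct Ub; have eb4 : e b b4 by rewrite Nb !inE eqxx !orbT.
have e4b : e b4 b by rewrite sedge_sym.
(* In the tree, [b4] is either active, giving the tripod, or a second death. Outside, the triangle
   on the edge from [b] to [b4] makes [y] active after all. *)
have [b4d|b4d] := boolP (b4 \in dom I).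
  have b4f := frontier_nbr b4d bd e4b.
  have b4v : b4 != v by rewrite eq_sym.
  have [a4|na4] := boolP (active I b4); first exact: done_ a4 b4v e4b.
  by case: (two_deaths gI V6 av NT _ ydead (dying _ b4f b4v e4b na4)).
have [t] := poor_triangle cG G2 poor eb4; rewrite Nb !inE => /or4P[]/eqP->; rewrite ?sedge_irr //.
- move=> e4v; have : b4 \in out I v by rewrite in_out sedge_sym e4v.
  by rewrite Eo !inE; neqs => /eqP E; rewrite E sedge_irr in eb4.
- rewrite sedge_sym Na !inE; neqs => /or3P[]/eqP E.
  + by rewrite E zd in b4d.
  + by rewrite E sedge_irr in eb4.
  + subst b4; have [U5 N5] : uniq [:: z; c; b; v] /\ forall t, e a t = (t \in [:: z; c; b; v]).
      split; first by rewrite /= !inE; neqs.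
      by move=> s; rewrite Na !inE; eqcases s.
    have yn : y \notin [:: a; c; v].
      by rewrite !inE (negPf yv); neqs.
    have := no_strip U5 N5 zc e4b ebv eby yn; rewrite sedge_sym => yc.
    case/negP: nay; exact: (active_ex (fd y yf) cb yc yb).
- move=> e4y; case/negP: nay; have b4b : b4 != b by rewrite eq_sym (edge_neq eb4).
  by apply: (active_ex (fd y yf) b4b _ yb b4d bd); rewrite sedge_sym.
Qed.

(** If the second leaves at [a] and at [b] are both inactive, they are distinct by [no_parallel] and
    both die. *)
Lemma stuck_final v : active I v -> exists a b c v q r, final_tripod I a b c v q r.
Proof.
move=> av; have [u [x [a [b [[_ _ _ Nv] [ad bd Eo ab]]]]]] := active_nbrs av.
have Eo' : out I v = [set b; a] by rewrite setUC.
have ba : e b a by rewrite sedge_sym.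
have vf : v \in frontier I by case/andP: av.
have vd : v \in dom I by case/setDP: vf.
have [y [yf yv ya]] := second_leaf av Eo ab; have [z [zf zv zb]] := second_leaf av Eo' ba.
have [ay|nay] := boolP (active I y); first exact: second_active av Eo ab ay yv ya.
have [az|naz] := boolP (active I z); first exact: second_active av Eo' ba az zv zb.
exfalso; have D1 t : (t \in dom (v |: I)) = (t \in dom I) || (t \in [:: a; b]).
  by rewrite dom_out // Eo !inE.
have K t w : t \in frontier I -> t != v -> e t w -> w \in [:: a; b] -> ~~ active I t ->
    t \in dead (v |: I) :\: dead I.
  move=> tf tv tw wab nat_.
  have wd : w \notin dom I by move: wab; rewrite !inE => /orP[]/eqP->.
  have ot : w \in out I t by rewrite in_out tw.
  have Et : out I t = [set w].
    apply/esym/eqP; rewrite eqEcard sub1set ot cards1.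
    by move: nat_; rewrite /active tf -leqNgt.
  apply: new_dead => //; first by rewrite frontier_expand // tf tv.
    apply/subsetP=> s; rewrite in_nbr D1 => ts; case sd: (s \in dom I) => //=.
    have : s \in out I t by rewrite in_out ts sd.
    by rewrite Et inE => /eqP->.
  by apply/orP; right; apply/set0Pn; exists w.
apply: (two_deaths gI V6 av (active_nonspanning gI V6 av) (y := y) (z := z)).
- apply: contra_not_neq (no_parallel av Eo ab yf yv ya) => ->; exact: zb.
- by apply: (K y a); rewrite // !inE eqxx.
- by apply: (K z b); rewrite // !inE eqxx orbT.
Qed.

End Stuck.

(** If some expansion leaves an active leaf, induction yields a final tripod after it, which
    [not_before_tripod] excludes. *)
Lemma nice_final_tripod I v : grown I -> value I 6 -> active I v ->
  exists a b c v q r, final_tripod I a b c v q r.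
Proof.
elim: {I}_.+1 {-2}I (ltnSn #|~: dom I|) v => // n IH I In v gI V6 av.
have [/exists_inP[w aw /existsP[x ax]]|/exists_inPn Hs] :=
  boolP [exists w in active I, exists x, active (w |: I) x]; last first.
  apply: (stuck_final gI V6 _ av) => w x aw; apply: contra (Hs w aw) => ax.
  by apply/existsP; exists x.
exfalso; case/andP: (aw) => wf _; have gw := grown_expand gI wf.
have pw := expand_proper wf (active_out aw).
have ltn' : #|~: dom (w |: I)| < n.
  by rewrite -ltnS (leq_trans _ In) // ltnS proper_card // properC.
have Vw : value (w |: I) 6.
  apply: (@expand_value _ _ _ [::]) V6 _ => //; first exact: active_out.
  have [u [y [a [b [[_ _ U _] [_ _ -> _]]]]]] := active_nbrs aw; distinct U.
  by rewrite cards2; neqs; have := weight_le [set a; b]; rewrite cards2; neqs; clear; lia.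
have [a [b [c [v' [q [r T]]]]]] := IH _ ltn' x gw Vw ax.
exact: not_before_tripod gI V6 aw T.
Qed.

(** All four leaves of a star are alive, one too many for a final tripod; so no leaf is active. *)
Lemma nice_absurd : False.
Proof.
have [v _] : exists2 v : G, v \in [set: G] & v \notin [::].
  by apply: card_gt_ex; rewrite cardsT ltnW.
have V6 : value [set v] 6 by apply: (regular_star_value cG G2 poor); rewrite leq_addr.
have alive z : e v z -> out [set v] z != set0.
  move=> vz; rewrite out0 dom1; apply/subsetP=> Hz.
  have zv : e z v by rewrite sedge_sym.
  have [a [b [c [U Nz]]]] := nbr1 cG G2 poor zv; distinct U.
  have H y : e z y -> v != y -> e v y.
    by move=> zy vy; have := Hz y; rewrite !inE zy (eq_sym y) (negPf vy) => /(_ isT).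
  have [za zb zc] : [/\ e z a, e z b & e z c] by rewrite !Nz !inE !eqxx !orbT.
  have zaN := edge_neq za; have zbN := edge_neq zb; have zcN := edge_neq zc.
  have Nv : forall u, e v u = (u \in [:: z; a; b; c]).
    by apply: (nbr_eq cG G2 poor) => //=; [rewrite !inE; neqs | rewrite vz !H].
  exact: (no_hub4 Nv za zb zc).
have [/existsP[x ax]|/existsPn inact] := boolP [exists x, active [set v] x].
  have [a [b [c [v' [q [r T]]]]]] := nice_final_tripod (grown1 v) V6 ax.
  have [z zn] : exists2 z, z \in nbr v & z \notin [:: v'; q; r].
    by apply: card_gt_ex; rewrite card_nbr poor_regular.
  rewrite (final_tripod_alive T) ?alive -?in_nbr //.
  by rewrite star_frontier.
have [p1 [p2 [p3 [p4 [U Nv]]]]] := nbr0 cG G2 poor v; distinct U.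
(* Each leaf has exactly one outside neighbour, so the rim is 2-regular on four vertices, that is, a
   4-cycle. *)
have cnt p : e v p -> count (e p) [:: p1; p2; p3; p4] = 2.
  move=> vp; have pn : p \in nbr v by rewrite in_nbr.
  have o1 : #|out [set v] p| = 1.
    apply/eqP; rewrite eqn_leq card_gt0 alive // andbT.
    by have := inact p; rewrite /active star_frontier // pn -leqNgt.
  rewrite -card_nbr_in //; have := star_card pn; rewrite (poor_regular cG G2 poor) o1.
  have -> : [set y in [:: p1; p2; p3; p4]] = nbr v.
    by apply/setP=> z; rewrite in_nbr Nv !inE.
  by clear; lia.
have core a b c d : uniq [:: a; b; c; d] -> (forall z, (z \in [:: a; b; c; d]) = (z \in [:: p1; p2; p3; p4])) ->
    e a b -> e b c -> e c d -> e d a -> False.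
  by move=> Ua E; apply: (@no_cycle v) => // z; rewrite Nv E.
have [vp1 vp2 vp3 vp4] : [/\ e v p1, e v p2, e v p3 & e v p4] by rewrite !Nv !inE !eqxx !orbT.
move: (cnt p1 vp1) (cnt p2 vp2) (cnt p3 vp3) (cnt p4 vp4); rewrite /= !sedge_irr.
rewrite (sedge_sym p2 p1) (sedge_sym p3 p1) (sedge_sym p4 p1) (sedge_sym p3 p2) (sedge_sym p4 p2) (sedge_sym p4 p3).
have e41 := sedge_sym p4 p1; have e32 := sedge_sym p3 p2; have e43 := sedge_sym p4 p3.
have e21 := sedge_sym p2 p1; have e31 := sedge_sym p3 p1; have e42 := sedge_sym p4 p2.
case E12: (e p1 p2); case E13: (e p1 p3); case E14: (e p1 p4); case E23: (e p2 p3);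
  case E24: (e p2 p4); case E34: (e p3 p4) => c1 c2 c3 c4;
  try by move: c1 c2 c3 c4; clear; lia.
- by move=> _; apply: (core p1 p2 p4 p3); rewrite ?e43 ?e31 //=;
    try (by rewrite !inE; neqs); move=> z; rewrite !inE; eqcases z.
- by move=> _; apply: (core p1 p2 p3 p4); rewrite ?e41 //=;
    try (by rewrite !inE; neqs); move=> z; rewrite !inE; eqcases z.
- by move=> _; apply: (core p1 p3 p2 p4); rewrite ?e32 ?e41 //=;
    try (by rewrite !inE; neqs); move=> z; rewrite !inE; eqcases z.
Qed.

End Nice.

(** * Adjacency tables *)

Section Classification.
Variable G : sgraph.
Local Notation e := (@sedge G).
Hypotheses (cG : is_connected e) (G2 : 1 < #|G|) (poor : ~~ rich G).

(** The hypotheses of the preceding section are decided as boolean quantifications over the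
    vertices; a counterexample to any of them yields its table. *)
Lemma poor_adjacency :
  [\/ has_adjacency G octahedron_nb, has_adjacency G C8sq_nb | has_adjacency G G8_nb].
Proof.
have [/existsP[v /existsP[d /andP[vd /forallP Hd]]]|/existsPn no_hub] :=
    boolP [exists v, exists d, e v d && [forall z, e v z ==> (z != d) ==> e d z]].
  constructor 3; apply: (star_dead_G8 cG G2 poor vd) => z vz zd.
  by have := Hd z; rewrite vz zd.
have hub v d : e v d -> ~ (forall z, e v z -> z != d -> e d z).
  move=> vd H; have /existsPn/(_ d) := no_hub v; rewrite vd /= => /negP[].
  by apply/forallP=> z; apply/implyP=> vz; apply/implyP=> zd; apply: H.
have hub4 v x y z t : (forall u, e v u = (u \in [:: x; y; z; t])) -> e x y -> e x z -> ~~ e x t.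
  by move=> Nv xy xz; apply/negP; apply: no_hub4 Nv xy xz.
(* A chord would make [p2] or [p3] adjacent to all other neighbours of [v], and hubs are already
   excluded. *)
have diag v p1 p2 p3 p4 : (forall z, e v z = (z \in [:: p1; p2; p3; p4])) ->
    e p1 p2 -> e p2 p3 -> e p3 p4 -> ~~ e p1 p3 /\ ~~ e p2 p4.
  move=> Nv e12 e23 e34; have [e21 e32] : e p2 p1 /\ e p3 p2 by split; rewrite sedge_sym.
  split; [rewrite sedge_sym; apply: (hub4 v p3 p2 p4 p1) | apply: (hub4 v p2 p1 p3 p4)] => //;
    by move=> z; rewrite Nv !inE; eqcases z.
pose path4 v p1 p2 p3 p4 := [&& uniq [:: p1; p2; p3; p4],
  [forall z, e v z == (z \in [:: p1; p2; p3; p4])], e p1 p2, e p2 p3 & e p3 p4].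
have [/existsP[v /existsP[p1 /existsP[p2 /existsP[p3 /existsP[p4 /andP[P e41]]]]]]|no_cyc] :=
    boolP [exists v, exists p1, exists p2, exists p3, exists p4, path4 v p1 p2 p3 p4 && e p4 p1].
  constructor 1; case/and5P: P => U /forallP Nv e12 e23 e34.
  have {}Nv z : e v z = (z \in [:: p1; p2; p3; p4]) by apply/eqP/Nv.
  have [n13 n24] := diag _ _ _ _ _ Nv e12 e23 e34.
  exact: (cycle_star cG G2 poor U Nv).
have cyc v p1 p2 p3 p4 : uniq [:: p1; p2; p3; p4] ->
    (forall z, e v z = (z \in [:: p1; p2; p3; p4])) ->
    e p1 p2 -> e p2 p3 -> e p3 p4 -> ~ e p4 p1.
  move=> U Nv e12 e23 e34 e41; case/negP: no_cyc; apply/existsP; exists v.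
  apply/existsP; exists p1; apply/existsP; exists p2; apply/existsP; exists p3.
  apply/existsP; exists p4; rewrite /path4 U e12 e23 e34 e41 !andbT /=.
  by apply/forallP=> z; rewrite Nv.
have [/existsP[v /existsP[p1 /existsP[p2 /existsP[p3 /existsP[p4 /existsP[w /and4P[P e3w wn n2w]]]]]]]|no_str] :=
    boolP [exists v, exists p1, exists p2, exists p3, exists p4, exists w,
      [&& path4 v p1 p2 p3 p4, e p3 w, w \notin [:: v; p2; p4] & ~~ e p2 w]].
  constructor 2; case/and5P: P => U /forallP Nv e12 e23 e34.
  have {}Nv z : e v z = (z \in [:: p1; p2; p3; p4]) by apply/eqP/Nv.
  have [n13 n24] := diag _ _ _ _ _ Nv e12 e23 e34.
  have n14 : ~~ e p1 p4 by rewrite sedge_sym; apply/negP; apply: cyc e12 e23 e34.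
  exact: (path_star_C8 cG G2 poor U Nv e12 e23 e34 n13 n14 n24 e3w).
exfalso; apply: (nice_absurd cG G2 poor hub cyc).
move=> v p1 p2 p3 p4 w U Nv e12 e23 e34 e3w wn; apply/negPn/negP=> n2w.
case/negP: no_str; apply/existsP; exists v.
apply/existsP; exists p1; apply/existsP; exists p2; apply/existsP; exists p3.
apply/existsP; exists p4; apply/existsP; exists w.
rewrite /path4 U e12 e23 e34 e3w wn n2w !andbT /=.
by apply/forallP=> z; rewrite Nv.
Qed.

Lemma poor_leaves8 : 2 * nvert_deg_ge4 G + nvert_deg3 G + 8 <= 5 * max_leaves G.
Proof.
have [v _ _] : exists2 v : G, v \in [set: G] & v \notin [::].
  by apply: card_gt_ex; rewrite cardsT ltnW.
have V6 : value [set v] 6 by apply: (regular_star_value cG G2 poor); rewrite leq_addr.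
have [DT|DT] := eqVneq (dom [set v]) setT.
  apply: (value_max_leaves G2 (grown1 v) DT).
  apply: (star_value_full cG G2 poor _ DT).
  rewrite (cost4 cG G2 poor) (poor_regular cG G2 poor).
  by have := weight_le (nbr v); rewrite card_nbr (poor_regular cG G2 poor); clear; lia.
have [I [gI DI VI]] := extend (k := 6) (slack := 2) cG isT isT (poor_slack cG G2 poor) (grown1 v) DT V6.
exact: value_max_leaves VI.
Qed.

End Classification.

(** * Upper bounds on the number of leaves *)

Section UpperBound.
Variable G : sgraph.
Local Notation e := (@sedge G).

(* Bounds the number of leaves through the complement of the set of leaves, which
   is connected and dominating. *)
Lemma nleaves_le (F : {set {set G}}) : 2 < #|G| -> spanning_tree F ->
  (forall x : G, exists2 z, z != x & ~~ e x z) ->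
  nleaves F + 2 <= #|G| /\
  ((forall x y, e x y -> exists z, [/\ z != x, z != y, ~~ e x z & ~~ e y z]) ->
   nleaves F + 3 <= #|G|).
Proof.
move=> G3 /and3P[FE /forallP cF _] no1.
pose J : {set G} := ~: [set x | degree (adj F) x == 1].
have EJ : nleaves F + #|J| = #|G| by rewrite /nleaves cardsC.
have adjF x y : adj F x y -> e x y by apply: adj_sedge.
have csym := sym_connect_sym (@adj_sym G F).
have closedF (A : {set G}) x y : (forall u w, adj F u w -> u \in A -> w \in A) -> x \in A -> y \in A.
  move=> H xA; rewrite -(@closed_connect _ (adj F) (mem A) _ x) //; last by have /forallP := cF x.
  exact: intro_closed.
have uniqF x y z : x \notin J -> adj F x y -> adj F x z -> y = z.
  rewrite !inE negbK => /cards1P[w Ew] xy xz.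
  have : y \in [set u | adj F x u] by rewrite inE.
  have : z \in [set u | adj F x u] by rewrite inE.
  by rewrite Ew !inE => /eqP-> /eqP->.
have leafJ x : x \notin J -> exists2 y, y \in J & adj F x y.
  move=> xJ; have := xJ; rewrite !inE negbK => /cards1P[y Ey].
  have xy : adj F x y by have : y \in [set u | adj F x u]; [rewrite Ey inE | rewrite inE].
  exists y => //; apply/negPn/negP=> yJ.
  have yx : adj F y x by rewrite adj_sym.
  have [z _] : exists2 z, z \in [set: G] & z \notin [:: x; y].
    by apply: card_gt_ex; rewrite cardsT.
  (* Two leaves adjacent in the tree would form a component, against the existence of a third
     vertex. *)
  have : z \in [set x; y].
    apply: (closedF _ x); last by rewrite !inE eqxx.
    move=> u w uw; rewrite !inE => /orP[]/eqP uE; rewrite uE in uw.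
      by rewrite (uniqF x w y) ?eqxx ?orbT.
    by rewrite (uniqF y w x) ?eqxx.
  by rewrite !inE => ->.
have [v _ _] : exists2 v : G, v \in [set: G] & v \notin [::].
  by apply: card_gt_ex; rewrite cardsT (leq_trans _ G3).
have J0 : 0 < #|J|.
  rewrite card_gt0; apply/set0Pn; case vJ: (v \in J); first by exists v.
  by have [y yJ _] := leafJ v (negbT vJ); exists y.
have J1 : 1 < #|J|.
  rewrite ltn_neqAle J0 andbT eq_sym; apply/negP=> /cards1P[x Ex].
  have [z zx] := no1 x; case/negP; have [|y] := leafJ z; first by rewrite Ex inE.
  by rewrite Ex inE => /eqP-> zxF; rewrite sedge_sym adjF.
split=> [|no2]; first by rewrite -EJ leq_add2l.
rewrite -EJ leq_add2l ltn_neqAle J1 andbT eq_sym; apply/negP=> /cards2P[x [y [xy Exy]]].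
have xyF : adj F x y.
  apply/negPn/negP=> nxy.
  (* If the only two non-leaves were not adjacent, [x] and the leaves hanging on it would be a
     component of the tree. *)
  have : y \in [set z | (z == x) || ((z \notin J) && adj F x z)].
    apply: (closedF _ x); last by rewrite !inE eqxx.
    move=> u w uw; rewrite in_set => /orP[/eqP uE|/andP[uJ xu]]; rewrite in_set.
      rewrite uE in uw; rewrite uw andbT Exy !inE negb_or.
      case: (eqVneq w x) => //= wx; apply: contraNneq nxy => <-; exact: uw.
    by rewrite (uniqF u w x) ?eqxx // adj_sym.
  by rewrite in_set eq_sym (negPf xy) Exy !inE eqxx orbT.
have [z [zx zy nxz nyz]] := no2 x y (adjF _ _ xyF).
have [|w wJ zw] := leafJ z; first by rewrite Exy !inE negb_or zx.
move: wJ; rewrite Exy !inE => /orP[]/eqP wE; rewrite wE in zw.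
  by rewrite sedge_sym adjF in nxz.
by rewrite sedge_sym adjF in nyz.
Qed.

End UpperBound.

(** * Graphs given by an adjacency table *)

Section Tables.
Variables (n : nat) (nb : seq (seq nat)).
Local Notation N i := (nth [::] nb i).

(** The fourth condition is diameter at most 2, from which connectedness follows; the last excludes
    a dominating vertex, which bounds the number of leaves by n - 2. *)
Definition table_ok := [&& 2 < n, size nb == n,
  all (fun l => [&& size l == 4, uniq l & all (ltn^~ n) l]) nb,
  all (fun i => all (fun j => [|| i == j, j \in N i | has (fun k => (k \in N i) && (j \in N k)) (iota 0 n)]) (iota 0 n)) (iota 0 n) &
  all (fun i => has (fun k => (k != i) && (k \notin N i)) (iota 0 n)) (iota 0 n)].

Definition table_no_dominating_edge :=
  all (fun i => all (fun j => (j \in N i) ==>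
    has (fun k => [&& k != i, k != j, k \notin N i & k \notin N j]) (iota 0 n)) (iota 0 n)) (iota 0 n).

Hypothesis ok : table_ok.

Lemma table_size : size nb = n.
Proof. by case/and5P: ok => _ /eqP. Qed.

Lemma table_lt i j : i < n -> j \in N i -> j < n.
Proof.
case/and5P: ok => _ _ /allP H _ _ ni; have /and3P[_ _ /allP] : [&& size (N i) == 4, uniq (N i) & all (ltn^~ n) (N i)].
  by apply: H; apply: mem_nth; rewrite table_size.
exact.
Qed.

Lemma has_adjacencyP (G : sgraph) : has_adjacency G nb ->
  exists s : seq G, [/\ size s = n, uniq s, forall x, x \in s &
    forall x y, sedge x y = (index y s \in N (index x s))].
Proof.
case=> x0 [s [ss Us Hs Es]]; rewrite table_size in ss.
exists s; split=> // x y; have ix : index x s < n by rewrite -ss index_mem.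
rewrite -{1}(nth_index x0 (Hs x)) Es ?table_size //.
apply/mapP/idP => [[j jn ->]|jn].
  by rewrite index_uniq // ss (table_lt ix jn).
by exists (index y s); rewrite // nth_index.
Qed.

Section Graph.
Variable G : sgraph.
Hypothesis adj : has_adjacency G nb.

Lemma table_card : #|G| = n.
Proof.
have [s [ss Us Hs _]] := has_adjacencyP adj.
by rewrite -ss -(card_uniqP Us); apply: eq_card => x; rewrite Hs.
Qed.

Lemma table_degree x : degree (@sedge G) x = 4.
Proof.
have [s [ss Us Hs Es]] := has_adjacencyP adj.
have ix : index x s < n by rewrite -ss index_mem.
have /and3P[/eqP s4 Un _] : [&& size (N (index x s)) == 4, uniq (N (index x s)) & all (ltn^~ n) (N (index x s))].
  by case/and5P: ok => _ _ /allP H _ _; apply: H; apply: mem_nth; rewrite table_size.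
rewrite -s4 -(size_map (nth x s)) /degree.
have Um : uniq [seq nth x s i | i <- N (index x s)].
  rewrite map_inj_in_uniq // => i j iN jN.
  have [li lj] := (table_lt ix iN, table_lt ix jN).
  by move/eqP; rewrite nth_uniq ?ss // => /eqP.
rewrite -(card_uniqP Um); apply: eq_card => y; rewrite inE Es.
apply/idP/mapP => [iy|[j jN ->]]; first by exists (index y s); rewrite // nth_index.
by rewrite index_uniq // ss (table_lt ix jN).
Qed.

Lemma table_connected : is_connected (@sedge G).
Proof.
have [s [ss Us Hs Es]] := has_adjacencyP adj.
apply/forallP=> x; apply/forallP=> y; case/and5P: ok => _ _ _ /allP H _.
have il z : index z s \in iota 0 n by rewrite mem_iota add0n -ss index_mem Hs.
have /allP/(_ _ (il y)) := H _ (il x); case/or3P=> [/eqP E|xy|/hasP[k kn /andP[xk ky]]].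
- by rewrite -(nth_index x (Hs x)) E nth_index.
- by apply: connect1; rewrite Es.
- have kz : index (nth x s k) s = k by rewrite index_uniq // ss; move: kn; rewrite mem_iota.
  apply: (@connect_trans _ _ (nth x s k)); apply: connect1; by rewrite Es kz.
Qed.

Lemma table_max_leaves : max_leaves G + 2 <= n /\
  (table_no_dominating_edge -> max_leaves G + 3 <= n).
Proof.
have [s [ss Us Hs Es]] := has_adjacencyP adj; have Gn := table_card.
case/and5P: (ok) => n3 _ _ _ /allP H.
have il z : index z s \in iota 0 n by rewrite mem_iota add0n -ss index_mem Hs.
have wit x k : k \in iota 0 n -> exists z, index z s = k /\ (z == x) = (k == index x s).
  rewrite mem_iota add0n => kn; exists (nth x s k); rewrite index_uniq ?ss //; split=> //.
  by rewrite -{2}(nth_index x (Hs x)) nth_uniq ?ss ?index_mem // -ss index_mem.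
have no1 (x : G) : exists2 z, z != x & ~~ sedge x z.
  have /hasP[k kn /andP[kx kN]] := H _ (il x); have [z [zk zx]] := wit x k kn.
  by exists z; rewrite ?zx // Es zk.
have n2 : 2 < #|G| by rewrite Gn.
have le c : (forall F : {set {set G}}, spanning_tree F -> nleaves F + c <= n) -> c <= n -> max_leaves G + c <= n.
  move=> HF cn; have : max_leaves G <= n - c.
    by apply/bigmax_leqP=> F sF; rewrite leq_subRL // addnC HF.
  by move: cn; clear; lia.
split=> [|/allP nd]; apply: le => //; [move=> F sF | exact: ltnW | move=> F sF]; rewrite -Gn.
  by have [] := nleaves_le n2 sF no1.
have [_] := nleaves_le n2 sF no1; apply=> x y xy.
have /allP/(_ _ (il y)) := nd _ (il x); rewrite -Es xy /= => /hasP[k kn /and4P[kx ky nx ny]].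
have [z [zk zx]] := wit x k kn; have [z' [zk' zy]] := wit y k kn.
have zz : z = z' by rewrite -(nth_index x (Hs z)) zk -zk' nth_index.
by exists z; rewrite zx {1}zz zy !Es zk.
Qed.

(** All n vertices have degree 4. The first alternative is met by n = 6, as 22 > 20, and the second
    inequality by n = 8, as 26 > 25. *)
Lemma table_poor : (2 * n + 10 > 5 * (n - 2)) || table_no_dominating_edge && (2 * n + 10 > 5 * (n - 3)) -> ~~ rich G.
Proof.
move=> H; have [l2 l3] := table_max_leaves.
have t : nvert_deg_ge4 G = n.
  by rewrite -table_card -cardsT; apply: eq_card => x; rewrite !inE table_degree.
rewrite /rich t -ltnNge; case/orP: H => [|/andP[/l3]]; first by move: l2; clear; lia.
by clear; lia.
Qed.

End Graph.

(** An isomorphism lists the vertices in the order of their labels. Conversely the position in the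
    list is an injection between sets of n elements. *)
Lemma isomorphic_table (r : rel 'I_n) (sr : symmetric r) (ir : irreflexive r) (G : sgraph) :
  (forall i j : 'I_n, r i j = (val j \in N i)) ->
  isomorphic G (SGraph sr ir) <-> has_adjacency G nb.
Proof.
move=> rE; split.
  case=> f [g fK gK] fe; have n0 : 0 < n by case/and5P: ok => n3 *; apply: leq_trans n3.
  pose x0 := g (Ordinal n0 : SGraph sr ir); pose s := [seq g i | i <- enum 'I_n].
  have ss : size s = n by rewrite size_map size_enum_ord.
  have sn (i : 'I_n) : nth x0 s i = g i.
    by rewrite (nth_map (Ordinal n0)) ?size_enum_ord ?nth_ord_enum.
  exists x0, s; rewrite table_size; split=> //.
  - by rewrite map_inj_uniq ?enum_uniq //; apply: can_inj gK.
  - by move=> x; apply/mapP; exists (f x); rewrite ?mem_enum ?fK.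
  - move=> i li z; rewrite -(fK z) -[i]/(val (Ordinal li)) sn -fe !gK /= rE /=.
    apply/idP/mapP => [jN|[j jN]]; first by exists (val (f z)); rewrite ?sn.
    by have lj := table_lt li jN; rewrite -[j]/(val (Ordinal lj)) sn => /(can_inj gK)->.
move=> adj; have [s [ss Us Hs Es]] := has_adjacencyP adj.
have ilt x : index x s < n by rewrite -ss index_mem.
pose f (x : G) : SGraph sr ir := Ordinal (ilt x).
have fi : injective f.
  by move=> x y [E]; rewrite -(nth_index x (Hs x)) E nth_index.
exists f; last by move=> x y; rewrite /= rE Es.
by apply: inj_card_bij fi _; rewrite (table_card adj) card_ord.
Qed.

End Tables.

(** * Squares of cycles in computable form *)

Section SquareCycle.
Variable n : nat.

(** The cycle relation is moved from ordinals to natural numbers so that tables can be compared by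
    evaluation. *)
Definition cycle_nat i j := (i != j) && ((j == i.+1 %[mod n]) || (i == j.+1 %[mod n])).

Definition square_cycle_nat i j := (i != j) &&
  (cycle_nat i j || has (fun k => cycle_nat i k && cycle_nat k j) (iota 0 n)).

(** Unconnected vertices get distance [#|T|]; with at most two vertices this default would itself be
    at most 2. *)
Lemma dist_le2 (T : finType) (r : rel T) x y : 2 < #|T| ->
  (dist r x y <= 2) = [|| x == y, r x y | [exists z, r x z && r z y]].
Proof.
rewrite /dist; case: #|T| => [|[|[|k]]] // _; set s := iota 3 k.
have w1 u : walk r 1 u y = r u y.
  apply/existsP/idP => [[z /andP[uz /eqP <-]]|uy] //; by exists y; rewrite uy /=.
have -> : iota 0 k.+3 = [:: 0, 1, 2 & s] by [].
rewrite /= -/(walk r 1 x y) w1; case: (x == y) => //=; case: (r x y) => //=.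
have -> : [exists z, r x z && [exists z0, r z z0 && (z0 == y)]] = [exists z, r x z && r z y].
  by apply: eq_existsb => z; rewrite -[[exists z0, _]]/(walk r 1 z y) w1.
by case: [exists z, _].
Qed.

Lemma square_cycleE (i j : 'I_n) : 2 < n ->
  @square_rel (cycle_graph n) i j = square_cycle_nat (val i) (val j).
Proof.
move=> n2; rewrite /square_rel /square_cycle_nat dist_le2 ?card_ord //.
have E (u w : 'I_n) : @cycle_rel n u w = cycle_nat (val u) (val w) by [].
have -> : (i == j) = (val i == val j) by [].
case: (val i =P val j) => //= _; rewrite E; congr orb.
apply/existsP/hasP => [[k]|[k]] /=; first by rewrite !E; exists (val k); rewrite // mem_iota ltn_ord.
by rewrite mem_iota => lk H; exists (Ordinal (lk : k < n)); rewrite /= !E.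
Qed.

End SquareCycle.

Lemma table_relP n nb (f : nat -> nat -> bool) :
  all (fun i => all (fun j => f i j == (j \in nth [::] nb i)) (iota 0 n)) (iota 0 n) ->
  forall i j : 'I_n, f (val i) (val j) = (val j \in nth [::] nb (val i)).
Proof.
have l (i : 'I_n) : val i \in iota 0 n by rewrite mem_iota ltn_ord.
by move=> /allP H i j; have /allP/(_ _ (l j))/eqP := H _ (l i).
Qed.

Lemma octahedron_table : table_ok 6 octahedron_nb. Proof. by vm_compute. Qed.
Lemma C8sq_table : table_ok 8 C8sq_nb. Proof. by vm_compute. Qed.
Lemma G8_table : table_ok 8 G8_nb. Proof. by vm_compute. Qed.

Lemma isomorphic_C6sq (G : sgraph) :
  isomorphic G (square (cycle_graph 6)) <-> has_adjacency G octahedron_nb.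
Proof.
apply: (isomorphic_table octahedron_table) => i j; rewrite square_cycleE //.
by move: i j; apply: table_relP; vm_compute.
Qed.

Lemma isomorphic_C8sq (G : sgraph) :
  isomorphic G (square (cycle_graph 8)) <-> has_adjacency G C8sq_nb.
Proof.
apply: (isomorphic_table C8sq_table) => i j; rewrite square_cycleE //.
by move: i j; apply: table_relP; vm_compute.
Qed.

Lemma isomorphic_G8 (G : sgraph) : isomorphic G G8 <-> has_adjacency G G8_nb.
Proof.
apply: (isomorphic_table G8_table) => i j.
pose f i j := ((i, j) \in G8_edges) || ((j, i) \in G8_edges).
by apply: (@table_relP 8 G8_nb f); vm_compute.
Qed.

(** Common neighbours of adjacent vertices tell C_8^2 from G_8, where a_1 and a_2 have three of
    them. *)
Lemma C8sq_common (G : sgraph) (x y : G) : has_adjacency G C8sq_nb -> sedge x y ->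
  #|[set z | sedge x z && sedge y z]| <= 2.
Proof.
move=> adj xy; have [s [ss Us Hs Es]] := has_adjacencyP C8sq_table adj.
pose N := nth [::] C8sq_nb.
have il z : index z s \in iota 0 8 by rewrite mem_iota add0n -ss index_mem Hs.
have /allP/(_ _ (il x))/allP/(_ _ (il y)) :
  all (fun i => all (fun j => (j \in N i) ==> (count (fun k => (k \in N i) && (k \in N j)) (iota 0 8) <= 2)) (iota 0 8)) (iota 0 8).
  by vm_compute.
rewrite -Es xy implyTb -size_filter; apply: leq_trans.
rewrite cardE -(size_map (index^~ s)); apply: uniq_leq_size.
  rewrite map_inj_in_uniq ?enum_uniq // => u w _ _ E.
  by rewrite -(nth_index x (Hs u)) E nth_index.
move=> k /mapP[z]; rewrite mem_enum inE => /andP[xz yz] ->.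
by rewrite mem_filter il -!Es xz yz.
Qed.

Lemma G8_common (G : sgraph) : has_adjacency G G8_nb ->
  exists x y : G, sedge x y /\ 2 < #|[set z | sedge x z && sedge y z]|.
Proof.
case=> x0 [s [ss Us Hs Es]].
have E i z (li : i < 8) := Es i li z; exists (nth x0 s 0), (nth x0 s 1); rewrite !E //=; split.
  by rewrite !inE eqxx.
have U3 : uniq [seq nth x0 s i | i <- [:: 2; 3; 4]].
  rewrite map_inj_in_uniq // => i j iN jN /eqP; rewrite nth_uniq ?ss ?Us //; first by move/eqP.
    by move: iN; rewrite !inE => /or3P[]/eqP->.
  by move: jN; rewrite !inE => /or3P[]/eqP->.
have <- : #|[seq nth x0 s i | i <- [:: 2; 3; 4]]| = 3 := card_uniqP U3.
apply/subset_leq_card/subsetP=> z.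
by rewrite !inE !E //= !inE => /or3P[]/eqP->; rewrite eqxx ?orbT.
Qed.

(** * Passage from natural-number inequalities to the rational bounds *)

Import Order.TTheory GRing.Theory Num.Theory.
Local Open Scope ring_scope.

(** The constant is a separate variable so that both 8/5 and 2 = 10/5 are covered. *)
Lemma bound_ratE (t s u m : nat) (q : rat) : q = m%:R / 5 ->
  (2 / 5 * t%:R + 1 / 5 * s%:R + q <= u%:R :> rat) = (2 * t + s + m <= 5 * u)%N.
Proof.
move=> ->; rewrite -(ler_nat rat) !natrD.
by apply/idP/idP => h; lra.
Qed.

Theorem theorem1 :
  (forall G : sgraph, is_connected (@sedge G) -> (2 <= #|G|)%N ->
     2 / 5 * (nvert_deg_ge4 G)%:R + 1 / 5 * (nvert_deg3 G)%:R + 8 / 5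
       <= (max_leaves G)%:R :> rat)
  /\ (forall G : sgraph,
       (is_connected (@sedge G) /\ (2 <= #|G|)%N /\
        ~ (2 / 5 * (nvert_deg_ge4 G)%:R + 1 / 5 * (nvert_deg3 G)%:R + 2
             <= (max_leaves G)%:R :> rat))
       <-> (isomorphic G (square (cycle_graph 6))
            \/ isomorphic G (square (cycle_graph 8))
            \/ isomorphic G G8))
  /\ (~ isomorphic (square (cycle_graph 6)) (square (cycle_graph 8))
      /\ ~ isomorphic (square (cycle_graph 6)) G8
      /\ ~ isomorphic (square (cycle_graph 8)) G8).
Proof.
have self (G : sgraph) : isomorphic G G by exists id => //; exists id.
have r10 : 2 = 10%:R / 5 :> rat by lra.
split.
  move=> G cG G2; rewrite (@bound_ratE _ _ _ 8) //.
  have [R|poor] := boolP (rich G); last exact: poor_leaves8.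
  by move: R; rewrite /rich; lia.
split=> [G|].
  rewrite (bound_ratE _ _ _ r10) -/(rich G).
  rewrite isomorphic_C6sq isomorphic_C8sq isomorphic_G8; split.
    case=> cG [G2 /negP poor]; have [] := poor_adjacency cG G2 poor; tauto.
  have main n nb : table_ok n nb -> has_adjacency G nb ->
    (2 * n + 10 > 5 * (n - 2))%N || table_no_dominating_edge n nb && (2 * n + 10 > 5 * (n - 3))%N ->
      is_connected (@sedge G) /\ (2 <= #|G|)%N /\ ~ rich G.
    move=> ok adj H; split; first exact: table_connected ok _ adj.
    split; last exact/negP/(table_poor ok adj).
    by rewrite (table_card ok adj); case/and5P: ok => /ltnW.
  case=> [adj|[adj|adj]].
  - exact: main octahedron_table adj _.
  - by apply: main C8sq_table adj _; vm_compute.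
  - by apply: main G8_table adj _; vm_compute.
have c6 := (isomorphic_C6sq _).1 (self (square (cycle_graph 6))).
have c8 := (isomorphic_C8sq _).1 (self (square (cycle_graph 8))).
split; [|split].
- move=> /isomorphic_C8sq H; have := table_card C8sq_table H.
  by rewrite (table_card octahedron_table c6).
- move=> /isomorphic_G8 H; have := table_card G8_table H.
  by rewrite (table_card octahedron_table c6).
- move=> /isomorphic_G8 /G8_common[x [y [xy]]].
  by rewrite ltnNge C8sq_common.
Qed.
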